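(* Let $r\ge c>0$, $n_0,\dots,n_r>0$ and $m\ge 0$ be integers, $n:=n_0+\dots+n_r$, let $A=(a_0,\dots,a_r)$ be a complex $(c+1)\times(r+1)$ matrix of full rank with pairwise linearly independent columns, let $l_i=(l_{i1},\dots,l_{in_i})$, $i=0,\dots,r$, be tuples of positive integers and let $P_0$ be the $r\times(n+m)$ integer matrix whose $i$-th row ($1\le i\le r$) is $(-l_0,0,\dots,0,l_i,0,\dots,0,0,\dots,0)$ (the block $-l_0$ in the columns indexed by $(0,1),\dots,(0,n_0)$, the block $l_i$ in the columns indexed by $(i,1),\dots,(i,n_i)$, zeros elsewhere, in particular in the last $m$ columns). Let $$R(A,P_0):=\mathbb{C}[T_{ij},S_k]/\langle g_v;\ v\in\ker(A)\rangle,\qquad g_v:=v_0T_0^{l_0}+\dots+v_rT_r^{l_r},\quad T_i^{l_i}:=T_{i1}^{l_{i1}}\cdots T_{in_i}^{l_{in_i}},$$ graded by $K_0:=\mathbb{Z}^{n+m}/\operatorname{im}(P_0^* )$ via $\deg T_{ij}:=Q_0(e_{ij})$, $\deg S_k:=Q_0(e_k)$, where $Q_0\colon\mathbb{Z}^{n+m}\to K_0$ is the projection. Then $R(A,P_0)$ is an integral, normal, complete intersection ring with $$\dim R(A,P_0)=n+m-r+c,\qquad R(A,P_0)^*=\mathbb{C}^*,$$ and the $K_0$-grading is effective, pointed, factorial and of complexity $c$.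
   Context: Here $\mathbb{C}[T_{ij},S_k]$ is the polynomial ring in variables $T_{ij}$ ($0\le i\le r$, $1\le j\le n_i$) and $S_k$ ($1\le k\le m$), and $e_{ij}$, $e_k$ denote the corresponding canonical basis vectors of $\mathbb{Z}^{n+m}$. For a finitely generated abelian group $K$ and a $K$-graded $\mathbb{C}$-algebra $B=\bigoplus_{w\in K}B_w$: the grading is effective if the $w$ with $B_w\neq 0$ generate $K$; it is pointed if $B_w\ne 0\ne B_{-w}$ holds only for torsion elements $w$ and $B_0=\mathbb{C}$; $B$ is $K$-integral if it has no homogeneous zero divisors; a $K$-prime element is a nonzero homogeneous non-unit $f$ such that whenever $f$ divides a product of homogeneous elements it divides one of the factors; the grading is (K-)factorial if $B$ is $K$-integral and every nonzero homogeneous non-unit is a product of $K$-primes; the complexity of the grading is $\dim B-\operatorname{rk}K$. *)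

(* Defs.v *)
From HB Require Import structures.
From mathcomp Require Import all_boot all_order all_algebra.
From mathcomp Require Import reals.
From mathcomp Require Import complex.
From mathcomp Require Import mpoly.

Set Implicit Arguments.
Unset Strict Implicit.
Unset Printing Implicit Defensive.

Import Order.TTheory GRing.Theory Num.Theory.
Local Open Scope ring_scope.

(* Elements of S/I are represented by their representatives in S.          *)
Section CommAlg.
Variables (K : fieldType) (N : nat).
Local Notation S := {mpoly K[N]}.

Definition gen_ideal (G : S -> Prop) (p : S) : Prop :=
  exists s : seq (S * S), (forall x, x \in s -> G x.2) /\
                          p = \sum_(x <- s) x.1 * x.2.

Definition is_ideal (J : S -> Prop) : Prop :=
  [/\ J 0, (forall a b, J a -> J b -> J (a + b)) & (forall a b, J b -> J (a * b))].

Definition prime_ideal (J : S -> Prop) : Prop :=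
  [/\ is_ideal J, ~ J 1 & (forall a b, J (a * b) -> J a \/ J b)].

Definition quot_integral (I : S -> Prop) : Prop := prime_ideal I.

(* a chain P_0 < P_1 < ... < P_d of prime ideals of S containing I,
   i.e. a chain of prime ideals of length d in S/I *)
Definition prime_chain (I : S -> Prop) (d : nat) (P : nat -> S -> Prop) : Prop :=
  (forall t, (t <= d)%N -> prime_ideal (P t) /\ (forall p, I p -> P t p)) /\
  (forall t, (t < d)%N -> (forall p, P t p -> P t.+1 p) /\
                          (exists p, P t.+1 p /\ ~ P t p)).

Definition quot_dim (I : S -> Prop) (d : nat) : Prop :=
  (exists P, prime_chain I d P) /\ (forall d' P, prime_chain I d' P -> (d' <= d)%N).

Definition quot_unit (I : S -> Prop) (u : S) : Prop := exists v, I (u * v - 1).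

Definition quot_dvd (I : S -> Prop) (a b : S) : Prop := exists h, I (b - a * h).

(* S/I is normal: (assuming it is a domain) every element a/b of its field
   of fractions that is integral over S/I lies in S/I.  The integrality
   equation (a/b)^k + c_1 (a/b)^(k-1) + ... + c_k = 0 is cleared of
   denominators. *)
Definition quot_normal (I : S -> Prop) : Prop :=
  quot_integral I /\
  forall a b : S, ~ I b ->
    (exists (k : nat) (cs : seq S), (0 < k)%N /\ size cs = k /\
        I (a ^+ k + \sum_(t < k) cs`_t * a ^+ (k - t.+1) * b ^+ t.+1)) ->
    exists s, I (a - s * b).

Definition quot_complete_intersection (I : S -> Prop) : Prop :=
  exists (gs : seq S) (d : nat),
    quot_dim I d /\ (size gs + d)%N = N /\
    (forall p, I p <-> gen_ideal (fun g => g \in gs) p).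

Variable (k : nat) (P : 'M[int]_(k, N)).

(* w lies in im(P^T), i.e. represents 0 in K_0 = Z^N / im(P^T) *)
Definition in_imP (w : 'rV[int]_N) : Prop := exists z : 'rV[int]_k, w = z *m P.

(* degree (representative in Z^N) of a monomial: Q_0(e) *)
Definition mdeg (e : 'X_{1..N}) : 'rV[int]_N := \row_j (e j)%:Z.

Definition hom_of (w : 'rV[int]_N) (p : S) : Prop :=
  forall e, e \in msupp p -> in_imP (mdeg e - w).

Definition Khomog (p : S) : Prop := exists w, hom_of w p.

Variable I : S -> Prop.

Definition comp_nz (w : 'rV[int]_N) : Prop := exists p, hom_of w p /\ ~ I p.

Definition grading_effective : Prop :=
  forall u : 'rV[int]_N, exists s : seq ('rV[int]_N * int),
    (forall x, x \in s -> comp_nz x.1) /\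
    in_imP (u - \sum_(x <- s) x.1 *~ x.2).

Definition torsion (w : 'rV[int]_N) : Prop := exists n : nat, (0 < n)%N /\ in_imP (w *+ n).

Definition grading_pointed : Prop :=
  (forall w, comp_nz w -> comp_nz (- w) -> torsion w) /\
  (forall p, hom_of 0 p -> exists a : K, I (p - a%:MP)).

(* homogeneous elements of S/I are exactly classes of homogeneous
   polynomials; we quantify over such representatives *)
Definition K_integral : Prop :=
  forall a b, Khomog a -> Khomog b -> I (a * b) -> I a \/ I b.

Definition K_prime (f : S) : Prop :=
  [/\ Khomog f, ~ I f, ~ quot_unit I f &
      forall a b, Khomog a -> Khomog b -> quot_dvd I f (a * b) ->
                  quot_dvd I f a \/ quot_dvd I f b].

Definition K_factorial : Prop :=
  K_integral /\
  forall p, Khomog p -> ~ I p -> ~ quot_unit I p ->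
    exists fs : seq S, (forall f, f \in fs -> K_prime f) /\ I (p - \prod_(f <- fs) f).

Definition K_indep (ws : seq 'rV[int]_N) : Prop :=
  forall zs : seq int, size zs = size ws ->
    in_imP (\sum_(t < size ws) ws`_t *~ zs`_t) -> forall t, zs`_t = 0.

Definition K_rank (rk : nat) : Prop :=
  (exists ws, size ws = rk /\ K_indep ws) /\
  (forall ws, K_indep ws -> (size ws <= rk)%N).

Definition grading_complexity (cx : nat) : Prop :=
  exists d rk, quot_dim I d /\ K_rank rk /\ (d%:Z - rk%:Z = cx%:Z).

End CommAlg.

(* ns i = n_i (i = 0..r), l i j = l_{i,j+1}; variables T_{ij} are numbered  *)
(* consecutively block by block (position pos ns i j), followed by S_1..S_m *)
Section Data.
Variables (r : nat) (ns : 'I_r.+1 -> nat) (l : forall i : 'I_r.+1, 'I_(ns i) -> nat).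

Definition ntot : nat := (\sum_(i < r.+1) ns i)%N.

(* position of the variable T_{i,j+1} *)
Definition pos (i : 'I_r.+1) (j : nat) : nat := ((\sum_(i' < r.+1 | (i' < i)%N) ns i') + j)%N.

Definition Texp (m : nat) (i : 'I_r.+1) : 'X_{1..ntot + m} :=
  [multinom (\sum_(j < ns i) @l i j * (nat_of_ord k == pos i j))%N | k < ntot + m].

Definition P0 (m : nat) : 'M[int]_(r, ntot + m) :=
  \matrix_(i < r, k < ntot + m) ((Texp m (lift ord0 i) k)%:Z - (Texp m ord0 k)%:Z).

Variable (R : realType) (m : nat).

Definition gv (v : 'cV[R[i]]_r.+1) : {mpoly R[i][ntot + m]} :=
  \sum_(i < r.+1) v i 0 *: 'X_[Texp m i].

Definition idealRAP (c : nat) (A : 'M[R[i]]_(c.+1, r.+1)) : {mpoly R[i][ntot + m]} -> Prop :=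
  gen_ideal (fun g => exists v : 'cV[R[i]]_r.+1, A *m v = 0 /\ g = gv v).

End Data.

(* Main.v *)
Require Import Defs.
From HB Require Import structures.
From mathcomp Require Import all_boot all_order all_algebra.
From mathcomp Require Import reals.
From mathcomp Require Import complex.
From mathcomp Require Import mpoly.
From mathcomp Require Import all_fingroup cyclic all_field ring zify.
From mathcomp Require boolp classical_sets.

(** Treat every [S_k] as a block of its own and write [t_i] for the monomial of
    block [i].  Since [A] has full rank, the relations say that [t_i = ell_i(y)]
    for pairwise non-proportional linear forms [ell_i] in new variables [y].
    Splitting exponents as [m = sum_i quo_i(m) t_i + red m] makes the quotient a
    free module over [Y = K[y]] on the reduced monomials; [NF e] is the
    coordinate at [e].

    Choose one variable in each block.  Inverting the others, the chosen variable
    of block [i] becomes a root of [ell_i(y)] times a monomial, so the quotient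
    maps to a Kummer extension of a rational function field.  The monomials in
    these roots are independent because the [ell_i] are pairwise non-associated
    primes; hence the map is injective and the quotient is a domain.  An element
    of the fraction field that is integral has, by taking traces, components with
    only monomial denominators in the variables that were not chosen; varying
    the choice, and cancelling one variable at a time in normal forms, gives
    normality.  The dimension is bounded above by the growth of the number of
    normal forms of bounded degree and below by going up from a system of
    parameters.

    A homogeneous element involves a single reduced monomial, so it is
    [h(y) X^e] with [h] multihomogeneous.  The variables, and the multihomogeneous
    primes of the factorial ring [Y] other than the [ell_i], are K-prime, while
    [ell_i(y)] is a monomial. *)

Set Implicit Arguments.
Unset Strict Implicit.
Unset Printing Implicit Defensive.
Import Order.TTheory GRing.Theory Num.Theory.
Local Open Scope ring_scope.


(** For one choice of variables the Kummer extension sees only the localisation in which the other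
    variables are invertible. There each radicand is [ell_i] times a unit, so the radicands are
    squarefree and pairwise coprime; this is why the localised ring is normal. The quotient is the
    intersection of these localisations: any given variable can be put among the chosen ones, so an
    integral fraction has a monomial denominator avoiding that variable, and a monomial avoiding a
    variable is a nonzerodivisor modulo it.

    The grading group gives the same degree to all [t_i] built from the [T_ij], but relates no [S_k]
    to anything. Degrees in [y] are therefore counted by colours, one colour for all blocks of
    [T_ij] and one for each [S_k]; multihomogeneous means homogeneous in every colour.

    Growth bounds the dimension because a chain of [d] strict inclusions of primes yields about
    [n^d] polynomials of degree [O(n)] that are independent modulo the ideal. *)

Lemma unitr_neq0 (D : unitRingType) (u : D) : u \is a GRing.unit -> u != 0.
Proof. by apply: contraTneq => ->; rewrite unitr0. Qed.

(** * Factorial domains *)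

Section Divisibility.
Variable D : idomainType.
Implicit Types a b p q : D.

Definition divides a b := exists c, b = c * a.

Definition prime_elt p :=
  [/\ p != 0, p \isn't a GRing.unit &
      forall a b, divides p (a * b) -> divides p a \/ divides p b].

Definition factorial_domain := forall a, a != 0 ->
  exists u (ps : seq D), [/\ u \is a GRing.unit, (forall p, p \in ps -> prime_elt p) &
                   a = u * \prod_(p <- ps) p].

Lemma dividesMl p a b : divides p b -> divides p (a * b).
Proof. by case=> c ->; exists (a * c); rewrite mulrA. Qed.

Lemma dividesMr p a b : divides p a -> divides p (a * b).
Proof. by rewrite mulrC; exact: dividesMl. Qed.

Lemma dividesD p a b : divides p a -> divides p b -> divides p (a + b).
Proof. by case=> c -> [d ->]; exists (c + d); rewrite mulrDl. Qed.

Lemma dividesB p a b : divides p a -> divides p b -> divides p (a - b).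
Proof. by case=> c -> [d ->]; exists (c - d); rewrite mulrBl. Qed.

Lemma dividesxx p : divides p p.
Proof. by exists 1; rewrite mul1r. Qed.

Lemma divides0 p : divides p 0.
Proof. by exists 0; rewrite mul0r. Qed.

Lemma divides_trans a b c : divides a b -> divides b c -> divides a c.
Proof. by case=> x -> [y ->]; exists (y * x); rewrite mulrA. Qed.

Lemma prime_not_div_unit p u : prime_elt p -> u \is a GRing.unit -> ~ divides p u.
Proof.
case=> _ /negP pU _ uU [c def_u]; apply: pU.
by move: uU; rewrite def_u unitrM => /andP[].
Qed.

Lemma prime_div_prod p (I : eqType) (s : seq I) (F : I -> D) : prime_elt p ->
  divides p (\prod_(i <- s) F i) -> exists2 i, i \in s & divides p (F i).
Proof.
move=> prp; elim: s => [|x s IHs].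
  by rewrite big_nil => /prime_not_div_unit-/(_ prp (unitr1 _)).
rewrite big_cons => pxs; have [_ _ /(_ _ _ pxs)] := prp.
case=> [px|/IHs[i si pi]]; first by exists x; rewrite ?mem_head.
by exists i; rewrite // inE si orbT.
Qed.

Lemma prime_div_exp p a n : prime_elt p -> divides p (a ^+ n) -> divides p a.
Proof.
move=> prp; elim: n => [|n IHn].
  by rewrite expr0 => /prime_not_div_unit-/(_ prp (unitr1 _)).
by rewrite exprS; case: prp => _ _ prp /prp[].
Qed.

Lemma prime_div_prime p q : prime_elt p -> prime_elt q -> divides p q ->
  exists2 u, u \is a GRing.unit & q = u * p.
Proof.
move=> [p0 pU prp] [q0 qU prq] [c def_q]; exists c => //.
have : divides q (c * p) by rewrite -def_q; exact: dividesxx.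
case/prq=> [[d def_c]|[d def_p]].
  have /eqP : q * (1 - d * p) = 0.
    by rewrite mulrBr mulr1 {1}def_q def_c; ring.
  rewrite mulf_eq0 (negPf q0) subr_eq0 /= => /eqP dp.
  by case/negP: pU; apply/unitrPr; exists d; rewrite mulrC -dp.
apply/unitrPr; exists d; apply: (mulIf q0).
by rewrite mul1r -mulrA -def_p.
Qed.

Lemma prime_pow_cancel p a b n : prime_elt p -> ~ divides p b ->
  divides (p ^+ n) (a * b) -> divides (p ^+ n) a.
Proof.
move=> prp nb; elim: n a => [|n IHn] a; first by exists a; rewrite expr0 mulr1.
have [p0 _ prp'] := prp.
case=> c def_ab.
have : divides p (a * b) by exists (c * p ^+ n); rewrite def_ab exprSr mulrA.
case/prp'=> // -[d def_a]; have [] := IHn d.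
  exists c; apply: (mulIf p0); rewrite -mulrA [b * p]mulrC mulrA -def_a def_ab.
  by rewrite exprSr mulrA.
by move=> e def_d; exists e; rewrite def_a def_d exprSr mulrA.
Qed.

Lemma prime_unitM u p : u \is a GRing.unit -> prime_elt p -> prime_elt (u * p).
Proof.
move=> uU [p0 pU prp]; split; first by rewrite mulf_neq0 // unitr_neq0.
  by rewrite unitrM (negPf pU) andbF.
have up a : divides p a -> divides (u * p) a.
  by case=> c ->; exists (c / u); rewrite mulrA divrK.
move=> a b [c def_ab]; have /prp[] : divides p (a * b).
  by exists (c * u); rewrite def_ab mulrA.
  by left; exact: up.
by right; exact: up.
Qed.

End Divisibility.

Section DivisibilityTransport.
Variables (D E : idomainType) (f : {rmorphism D -> E}) (g : {rmorphism E -> D}).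
Hypotheses (fK : cancel f g) (gK : cancel g f).

Lemma prime_elt_iso p : prime_elt p -> prime_elt (f p).
Proof.
have unitf x : (f x \is a GRing.unit) = (x \is a GRing.unit).
  apply/idP/idP=> [U|]; last exact: rmorph_unit.
  by rewrite -(fK x); exact: rmorph_unit.
have divf a b : divides (f a) b -> divides a (g b).
  by case=> c ->; exists (g c); rewrite rmorphM fK.
case=> p0 pU prp; split; last first.
- move=> a b /divf; rewrite rmorphM.
  case/prp=> [] [c /(congr1 f)]; rewrite gK rmorphM => def_a.
    by left; exists (f c).
  by right; exists (f c).
- by rewrite unitf.
by apply: contraNneq p0 => /(congr1 g); rewrite fK rmorph0 => ->.
Qed.

Lemma factorial_iso : factorial_domain D -> factorial_domain E.
Proof.
move=> ufd a a0; have ga0 : g a != 0.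
  by apply: contraNneq a0 => /(congr1 f); rewrite gK rmorph0 => ->.
have [u [ps [uU prps def_ga]]] := ufd _ ga0.
exists (f u), (map f ps); split; first exact: rmorph_unit.
  by move=> _ /mapP[p psp ->]; exact/prime_elt_iso/prps.
by rewrite big_map -rmorph_prod -rmorphM -def_ga gK.
Qed.

End DivisibilityTransport.

(** * Gauss's lemma and factoriality of polynomial rings in one variable *)

Section Gauss.
Variable D : idomainType.
Implicit Types (c p : D) (f g h : {poly D}).

(** If [p%:P] divides [f * g], then [p] divides the product of the leading coefficients, hence one
    of them; dropping that leading term changes the product by a multiple of [p], so induction on
    the sum of the sizes applies. *)
Lemma prime_polyC p : prime_elt p -> prime_elt p%:P.
Proof.
move=> [p0 pU prp]; split; rewrite ?polyC_eq0 //.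
  by rewrite poly_unitE coefC eqxx (negPf pU) andbF.
have leadp f : divides p%:P f -> divides p (lead_coef f).
  by case=> h ->; exists (lead_coef h); rewrite lead_coefM lead_coefC.
have polyp a n : divides p a -> divides p%:P (a *: 'X^n).
  by case=> c ->; exists (c *: 'X^n); rewrite -!mul_polyC polyCM; ring.
have cut f : divides p (lead_coef f) -> f != 0 ->
    exists2 f' : {poly D}, (size f' < size f)%N & divides p%:P (f - f').
  move=> pf f0; exists (f - lead_coef f *: 'X^((size f).-1)); last first.
    by rewrite opprB addrC subrK; exact: polyp.
  have sf : (0 < size f)%N by rewrite size_poly_gt0.
  rewrite -[X in (_ < X)%N](prednK sf) ltnS; apply/leq_sizeP => j.
  rewrite leq_eqVlt coefB coefZ coefXn => /orP[/eqP <-|].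
    by rewrite eqxx mulr1 subrr.
  move=> lj; rewrite gtn_eqF // mulr0 subr0 nth_default //.
  by rewrite -(prednK sf).
move=> f g; have [n] := ubnP (size f + size g)%N.
elim: n f g => // n IHn f g sfg pfg.
have [->|f0] := eqVneq f 0; first by left; exact: divides0.
have [->|g0] := eqVneq g 0; first by right; exact: divides0.
have: divides p (lead_coef f * lead_coef g) by rewrite -lead_coefM; exact: leadp.
case/prp=> /cut[] // k szk pk.
  have [||pk'|] := IHn k g.
  - by rewrite -ltnS; apply: leq_trans sfg; rewrite ltnS ltn_add2r.
  - rewrite (_ : k * g = f * g - (f - k) * g); last by ring.
    exact/dividesB/dividesMr.
  - by left; rewrite -(subrK k f); apply: dividesD.
  - by right.
have [||pk'|] := IHn f k.
- by rewrite -ltnS; apply: leq_trans sfg; rewrite ltnS ltn_add2l.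
- rewrite (_ : f * k = f * g - f * (g - k)); last by ring.
  exact/dividesB/dividesMl.
- by left.
- by right; rewrite -(subrK k g); apply: dividesD.
Qed.

Hypothesis ufd : factorial_domain D.

Definition primitive_poly f := forall p, prime_elt p -> ~ divides p%:P f.

(** Extracting a prime from [f] removes one prime from a factorisation of its leading coefficient,
    so the extraction stops. *)
Lemma content_split f : f != 0 -> exists (ps : seq D) f0,
  [/\ forall p, p \in ps -> prime_elt p, primitive_poly f0 &
      f = (\prod_(p <- ps) p)%:P * f0].
Proof.
move=> f0; have lf0 : lead_coef f != 0 by rewrite lead_coef_eq0.
have [u [qs [uU]]] := ufd lf0; have [n] := ubnP (size qs).
elim: n f u qs uU f0 {lf0} => // n IHn f u qs uU f0 szq prqs def_lf.
have [fp|nfp] := boolp.pselect (primitive_poly f).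
  by exists [::], f; split=> //; rewrite big_nil mul1r.
have [p [prp [f1 def_f]]] : exists p, prime_elt p /\ divides p%:P f.
  apply: boolp.contrapT => nop; apply: nfp => p prp pf.
  by apply: nop; exists p.
have [p0 pU prp'] := prp.
have f10 : f1 != 0 by apply: contraNneq f0 => f1z; rewrite def_f f1z mul0r.
have lf1 : lead_coef f = lead_coef f1 * p by rewrite def_f lead_coefM lead_coefC.
have : divides p (u * \prod_(q <- qs) q).
  by rewrite -def_lf lf1; exists (lead_coef f1).
case/prp'=> [/prime_not_div_unit|/(prime_div_prod prp)[q qqs]]; first by case/(_ prp uU).
case/(prime_div_prime prp (prqs _ qqs)) => v vU def_q.
have [|||||ps [h [prps hp def_f1]]] := IHn f1 (u * v) (rem q qs).
- by rewrite unitrM uU.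
- exact: f10.
- by rewrite size_rem //; case: (qs) qqs szq.
- by move=> r /mem_rem/prqs.
- apply: (mulIf p0); rewrite -lf1 def_lf (big_rem q) //= def_q; ring.
exists (p :: ps), h; split=> //.
  by move=> r; rewrite inE => /orP[/eqP ->|/prps].
by rewrite def_f def_f1 big_cons polyCM; ring.
Qed.

(** Brings a factorisation over the fraction field back to [D]: each prime of the cleared
    denominator [c] divides [g] or [h] and is cancelled there, which leaves the degrees
    unchanged. *)
Lemma gauss_strip c f g h : c != 0 -> c%:P * f = g * h ->
  exists g' h', [/\ f = g' * h', size g' = size g & size h' = size h].
Proof.
move=> c0; have [u [ps [uU prps ->]]] := ufd c0 => {c c0}.
elim: ps g h prps => [|p ps IHps] g h prps.
  rewrite big_nil mulr1 => def_uf; exists (u^-1%:P * g), h; split=> //.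
    by rewrite -mulrA -def_uf mulrA -polyCM mulVr // mul1r.
  by rewrite size_Cmul // unitr_neq0 // unitrV.
have prp : prime_elt p by apply: prps; rewrite mem_head.
have p0 : p != 0 by case: prp.
have {}IHps g' h' := IHps g' h' (fun q qps => prps q (@mem_behead _ (p :: ps) q qps)).
rewrite big_cons => def_gh.
have: divides p%:P (g * h).
  by rewrite -def_gh; exists ((u * \prod_(q <- ps) q)%:P * f); rewrite !polyCM; ring.
have [pp0 _ prpp] := prime_polyC prp.
have szM k : size (k * p%:P) = size k by rewrite mulrC size_Cmul.
case/prpp=> -[k def_k]; [have [|g' [h' []]] := IHps k h|have [|g' [h' []]] := IHps g k].
- apply: (mulfI pp0); rewrite [RHS]mulrA [p%:P * k]mulrC -def_k -def_gh.
  by rewrite !polyCM; ring.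
- by move=> def_f sg sh; exists g', h'; rewrite def_k szM.
- apply: (mulfI pp0); rewrite [RHS]mulrCA [p%:P * k]mulrC -def_k -def_gh.
  by rewrite !polyCM; ring.
- by move=> def_f sg sh; exists g', h'; rewrite def_k szM.
Qed.

(** No prime divides [g], so every prime of [c] is cancelled in the cofactor [h] and [g] itself
    survives. *)
Lemma gauss_strip_primitive c f g h : c != 0 -> primitive_poly g ->
  c%:P * f = h * g -> divides g f.
Proof.
move=> c0 gp; have [u [ps [uU prps ->]]] := ufd c0 => {c c0}.
elim: ps h prps => [|p ps IHps] h prps.
  rewrite big_nil mulr1 => def_uf; exists (u^-1%:P * h).
  by rewrite -mulrA -def_uf mulrA -polyCM mulVr // mul1r.
have prp : prime_elt p by apply: prps; rewrite mem_head.
rewrite big_cons => def_gh.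
have: divides p%:P (h * g).
  by rewrite -def_gh; exists ((u * \prod_(q <- ps) q)%:P * f); rewrite !polyCM; ring.
have [pp0 _ prpp] := prime_polyC prp.
case/prpp=> [[k def_k]|/gp[] //]; apply: (IHps k).
  by move=> q qps; apply: prps; rewrite inE qps orbT.
apply: (mulfI pp0); rewrite [RHS]mulrA [p%:P * k]mulrC -def_k -def_gh.
by rewrite !polyCM; ring.
Qed.

(** A splitting into factors of positive degree is handled by induction on the size. Otherwise [f]
    is a constant times a primitive [k]; if [k] is not constant, it stays irreducible over the
    fraction field, and Euclid's argument there, carried out with gcds up to scalars, shows that it
    is prime. *)
Lemma factorial_poly : factorial_domain {poly D}.
Proof.
move=> f; have [n] := ubnP (size f); elim: n f => // n IHn f szf f0.
have [[g [h [def_f g1 h1]]]|nfac] := boolp.pselect (exists g h,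
    [/\ f = g * h, (1 < size g)%N & (1 < size h)%N]).
  have g0 : g != 0 by rewrite -size_poly_gt0 ltnW.
  have h0 : h != 0 by rewrite -size_poly_gt0 ltnW.
  have szgh : (size g + size h = (size f).+1)%N.
    by rewrite def_f size_mul // prednK // addn_gt0 size_poly_gt0 g0.
  have [||u [ps [uU prps def_g]]] := IHn g => //.
    by rewrite -(ltn_add2r (size h)) szgh; lia.
  have [||v [qs [vU prqs def_h]]] := IHn h => //.
    by rewrite -(ltn_add2l (size g)) szgh; lia.
  exists (u * v), (ps ++ qs); split; first by rewrite unitrM uU.
    by move=> p; rewrite mem_cat => /orP[/prps|/prqs].
  by rewrite big_cat /= def_f def_g def_h; ring.
have [ps [k [prps kp def_f]]] := content_split f0.
have k0 : k != 0 by apply: contraNneq f0 => kz; rewrite def_f kz mulr0.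
have prps' : forall p : {poly D}, p \in map polyC ps -> prime_elt p.
  by move=> _ /mapP[p psp ->]; exact/prime_polyC/prps.
have def_ps : (\prod_(p <- ps) p)%:P = \prod_(p <- map polyC ps) p.
  by rewrite big_map rmorph_prod.
have [sk|sk] := leqP (size k) 1.
  have def_k := size1_polyC sk.
  have [|u [qs [uU prqs def_k0]]] := ufd (a := k`_0).
    by rewrite -polyC_eq0 -def_k.
  exists u%:P, (map polyC (ps ++ qs)); split.
  - by rewrite poly_unitE coefC /= size_polyC unitr_neq0.
  - move=> _ /mapP[p psp ->]; apply: prime_polyC.
    by move: psp; rewrite mem_cat => /orP[/prps|/prqs].
  rewrite def_f def_k def_k0 big_map big_cat /= polyCM !rmorph_prod /=; ring.
exists 1, (k :: map polyC ps); split; rewrite ?unitr1 //; last first.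
  by rewrite big_cons mul1r def_f def_ps mulrC.
move=> p; rewrite inE => /orP[/eqP ->|/prps' //]; split=> // [|a b].
  by rewrite poly_unitE; case: eqP sk => // ->.
have irr c g h : c != 0 -> c%:P * k = g * h -> (size g <= 1)%N \/ (size h <= 1)%N.
  move=> c0 /(gauss_strip c0)[g' [h' [def_k <- <-]]].
  have [|sg] := leqP (size g') 1; first by left.
  have [|sh] := leqP (size h') 1; first by right.
  case: nfac; exists ((\prod_(p <- ps) p)%:P * g'), h'; split=> //.
    by rewrite -mulrA -def_k.
  rewrite size_Cmul //; apply/negP => /eqP z.
  by move: f0; rewrite def_f z mul0r eqxx.
(* [%|] is divisibility up to a nonzero scalar; primitivity of [k] removes the scalar. *)
have dvdk a' : k %| a' -> divides k a'.
  case/Pdiv.Idomain.dvdpP=> -[c h] /= c0 def_a.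
  by apply: (gauss_strip_primitive c0 kp (h := h)); rewrite mul_polyC.
have [ga|ga] : coprimep k a \/ k %| a.
  have /Pdiv.Idomain.dvdpP[[c h] /= c0 def_k] := dvdp_gcdl k a.
  have := irr c h (gcdp k a) c0; rewrite mul_polyC => /(_ def_k)[sh|sg]; last first.
    left; rewrite /coprimep eqn_leq sg size_poly_gt0.
    by rewrite gcdp_eq0 negb_and k0.
  right; apply: dvdp_trans (dvdp_gcdr k a).
  have h0 : h != 0.
    apply: contraNneq k0 => hz; move/eqP: def_k.
    by rewrite hz mul0r -mul_polyC mulf_eq0 polyC_eq0 (negPf c0).
  have def_h := size1_polyC sh.
  have hh : h`_0 != 0 by rewrite -polyC_eq0 -def_h.
  by rewrite -(Pdiv.Idomain.dvdpZl _ _ c0) def_k def_h mul_polyC Pdiv.Idomain.dvdpZl.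
- case=> c def_ab; right; apply: dvdk.
  rewrite -(Gauss_dvdpr _ ga) def_ab; exact: dvdp_mulIr.
by left; exact: dvdk.
Qed.

End Gauss.

Lemma factorial_field (F : fieldType) : factorial_domain F.
Proof.
by move=> a a0; exists a, [::]; rewrite unitfE a0 big_nil mulr1; split.
Qed.

Lemma mpoly_morph_ext (k : nat) (C E : comNzRingType) (f g : {rmorphism {mpoly C[k]} -> E}) :
  (forall c, f c%:MP = g c%:MP) -> (forall i, f 'X_i = g 'X_i) -> f =1 g.
Proof.
move=> eqC eqX p; rewrite (mpolyE p) !rmorph_sum; apply: eq_bigr => m _.
rewrite -mul_mpolyC !rmorphM eqC; congr (_ * _).
rewrite mpolyXE_id !rmorph_prod; apply: eq_bigr => i _.
by rewrite !rmorphXn eqX.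
Qed.

Lemma ord_widen_or_max n (i : 'I_n.+1) :
  (exists j : 'I_n, i = widen_ord (leqnSn n) j) \/ i = ord_max.
Proof.
have [lt_in|ge_in] := ltnP i n; first by left; exists (Ordinal lt_in); apply: val_inj.
by right; apply: val_inj => /=; apply/eqP; rewrite eqn_leq ge_in -ltnS ltn_ord.
Qed.

(** * Polynomial rings in several variables, one variable at a time *)

Section MpolyFactorial.
Variable D : idomainType.

Lemma mpoly0_const (p : {mpoly D[0]}) : p = (p@_0)%:MP.
Proof.
apply/mpolyP => m; have -> : m = 0%MM by apply/mnmP => -[].
by rewrite mcoeffC eqxx mulr1.
Qed.

Lemma mpolyC0K : cancel (@mpolyC 0 D) (meval (fun=> 0)).
Proof. by move=> c; rewrite mevalC. Qed.

Lemma meval0K : cancel (meval (fun=> 0)) (@mpolyC 0 D).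
Proof. by move=> p; rewrite (mpoly0_const p) mevalC. Qed.

Section Succ.
Variable n : nat.

Definition unmuni : {poly {mpoly D[n]}} -> {mpoly D[n.+1]} :=
  horner_eval 'X_ord_max \o map_poly (@mwiden n D).

HB.instance Definition _ := GRing.RMorphism.copy unmuni
  (horner_eval 'X_ord_max \o map_poly (@mwiden n D)).

Lemma unmuniC c : unmuni c%:P = mwiden c.
Proof. by rewrite /unmuni /= map_polyC /= /horner_eval hornerC. Qed.

Lemma unmuniX : unmuni 'X = 'X_ord_max.
Proof. by rewrite /unmuni /= map_polyX /= /horner_eval hornerX. Qed.

Lemma muni_var (i : 'I_n.+1) : muni ('X_i : {mpoly D[n.+1]}) =
  'X_[[multinom (U_(i)%MM (widen_ord (leqnSn n) j)) | j < n]] *: 'X^((i == ord_max)).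
Proof.
by rewrite muniE msuppX big_seq1 mcoeffX eqxx scale1r mnm1E; congr ('X_[_] *: _).
Qed.

Lemma muniXwiden (i : 'I_n) :
  muni ('X_(widen_ord (leqnSn n) i) : {mpoly D[n.+1]}) = ('X_i)%:P.
Proof.
rewrite muni_var (_ : _ == _ = false) ?alg_polyC; last first.
  by rewrite -val_eqE /= ltn_eqF.
by congr ('X_[_])%:P; apply/mnmP => j; rewrite !mnmE -!val_eqE.
Qed.

Lemma muniXmax : muni ('X_ord_max : {mpoly D[n.+1]}) = 'X.
Proof.
rewrite muni_var eqxx (_ : [multinom _ | _ < _] = 0%MM) ?mpolyX0 ?scale1r //.
by apply/mnmP => j; rewrite !mnmE -val_eqE /= gtn_eqF.
Qed.

Lemma muniK : cancel (@muni n D) unmuni.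
Proof.
apply: (mpoly_morph_ext (f := unmuni \o @muni n D) (g := idfun)) => [c|i] /=.
  by rewrite muniC unmuniC mwidenC.
have [[j ->]|->] := ord_widen_or_max i; first by rewrite muniXwiden unmuniC /mwiden mmapX mmap1U.
by rewrite muniXmax unmuniX.
Qed.

Lemma unmuniK : cancel unmuni (@muni n D).
Proof.
move=> p; rewrite -{2}[p]coefK poly_def -[p in LHS]coefK poly_def !rmorph_sum.
apply: eq_bigr => i _; rewrite -mul_polyC !rmorphM !rmorphXn /= unmuniC unmuniX muniXmax.
congr (_ * _); apply: (mpoly_morph_ext (f := @muni n D \o @mwiden n D) (g := polyC)).
  by move=> c /=; rewrite mwidenC muniC.
by move=> j /=; rewrite /mwiden mmapX mmap1U muniXwiden.
Qed.

End Succ.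

Hypothesis ufd : factorial_domain D.

Lemma factorial_mpoly n : factorial_domain {mpoly D[n]}.
Proof.
elim: n => [|n IHn]; first exact: (factorial_iso (f := @mpolyC 0 D) (g := meval (fun=> 0)) mpolyC0K meval0K ufd).
exact: (@factorial_iso {poly {mpoly D[n]}} {mpoly D[n.+1]} (@unmuni n) (@muni n D) (@unmuniK n) (@muniK n)
  (factorial_poly IHn)).
Qed.

Lemma prime_mpolyC n (p : D) : prime_elt p -> prime_elt (p%:MP_[n]).
Proof.
move=> prp; elim: n => [|n IHn]; first exact: (prime_elt_iso (f := @mpolyC 0 D) (g := meval (fun=> 0)) mpolyC0K meval0K prp).
have := @prime_elt_iso {poly {mpoly D[n]}} {mpoly D[n.+1]} (@unmuni n) (@muni n D) (@unmuniK n) (@muniK n)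
  _ (prime_polyC IHn).
by rewrite /= unmuniC mwidenC.
Qed.

End MpolyFactorial.

(** * Radical extensions *)

Section RadicalExtension.
Variable Q : fieldType.

Lemma irreducible_factor (F : fieldType) (p : {poly F}) : (1 < size p)%N ->
  exists2 r, irreducible_poly r & r %| p.
Proof.
have [n] := ubnP (size p); elim: n p => // n IHn p szp p1.
have [irr|nirr] := boolp.pselect (irreducible_poly p); first by exists p.
have p0 : p != 0 by rewrite -size_poly_gt0 ltnW.
have [q [q1 qp nqp]] : exists q : {poly F}, [/\ size q != 1, q %| p & ~~ (q %= p)].
  apply: boolp.contrapT => noq; apply: nirr; split=> // q q1 qp.
  by apply/negPn/negP => nqp; apply: noq; exists q.
have q0 : q != 0 by apply: contraNneq p0 => qz; move: qp; rewrite qz dvd0p.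
have szq : (size q < size p)%N.
  by rewrite ltn_neqAle dvdp_size_eqp // nqp dvdp_leq.
have [||r irr rq] := IHn q.
- by apply: leq_trans szq _; rewrite -ltnS.
- by rewrite ltn_neqAle eq_sym q1 size_poly_gt0.
by exists r => //; exact: dvdp_trans rq qp.
Qed.

(** [X^n - c] may be reducible, so the root is adjoined along an irreducible factor; the resulting
    extension of [L] is then regarded as one of [Q]. *)
Lemma adjoin_root (L : fieldExtType Q) (n : nat) (c : L) : (0 < n)%N ->
  exists (L' : fieldExtType Q) (g : {rmorphism L -> L'}) (w : L'),
    (forall a : Q, g a%:A = a%:A) /\ w ^+ n = g c.
Proof.
move=> n0; have sz : (1 < size ('X^n - c%:P)%R)%N by rewrite size_XnsubC.
have [r irr rp] := irreducible_factor sz.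
have [K _ [x rx0 _]] := irredp_FAdjoin irr.
exists (baseFieldType K), (in_alg K : {rmorphism L -> K}), x; split.
  by move=> a /=; rewrite baseField_scaleE.
have : root (map_poly (in_alg K) ('X^n - c%:P)) x.
  by rewrite -(divpK rp) rmorphM rootM rx0 orbT.
rewrite rmorphB /= map_polyXn map_polyC /= rootE !hornerE.
by rewrite subr_eq0 => /eqP.
Qed.

Lemma adjoin_roots (s : seq (nat * Q)) : (forall x, x \in s -> (0 < x.1)%N) ->
  exists L : fieldExtType Q, forall x, x \in s -> exists w : L, w ^+ x.1 = (x.2)%:A.
Proof.
elim: s => [|x s IHs] sgt0; first by exists Q^o.
have [|L rootL] := IHs; first by move=> y ys; apply: sgt0; rewrite inE ys orbT.
have [|L' [g [w [gA def_w]]]] := @adjoin_root L x.1 (x.2)%:A.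
  by apply: sgt0; rewrite mem_head.
exists L' => y; rewrite inE => /orP[/eqP ->|/rootL[v def_v]].
  by exists w; rewrite def_w gA.
by exists (g v); rewrite -rmorphXn def_v gA.
Qed.

Variables (s : nat) (lam : 'I_s -> nat) (f : 'I_s -> Q).
Hypothesis lam_gt0 : forall i, (0 < lam i)%N.
Hypothesis f_neq0 : forall i, f i != 0.
Hypothesis prim_root : forall n, (0 < n)%N -> exists z : Q, n.-primitive_root z.

Lemma Xn_sub_split (L : fieldType) (n : nat) (z w : L) : n.-primitive_root z -> w != 0 ->
  'X^n - (w ^+ n)%:P = \prod_(y <- [seq z ^+ i * w | i <- iota 0 n]) ('X - y%:P).
Proof.
move=> prz w0; have n0 := prim_order_gt0 prz.
have mon : lead_coef ('X^n - (w ^+ n)%:P) = 1 by rewrite lead_coefXnsubC.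
rewrite [LHS](all_roots_prod_XsubC (rs := [seq z ^+ i * w | i <- iota 0 n])) ?mon ?scale1r //.
- by rewrite size_XnsubC // size_map size_iota.
- apply/allP => _ /mapP[i _ ->]; rewrite rootE !hornerE exprMn exprAC.
  by rewrite (prim_expr_order prz) expr1n mul1r subrr.
rewrite uniq_rootsE map_inj_in_uniq ?iota_uniq // => i j.
rewrite !mem_iota !add0n => /= ltin ltjn /(mulIf w0)/eqP.
by rewrite (eq_prim_root_expr prz) !modn_small // => /eqP.
Qed.

(** One root of each equation is enough: [Q] contains the roots of unity, so the field generated by
    these roots contains all other roots and is a splitting field of the product of the
    [X^(lam i) - f i]. *)
Lemma radical_extension : exists (L : splittingFieldType Q) (u : 'I_s -> L),
  forall i, u i ^+ lam i = (f i)%:A.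
Proof.
have [|L0 rootL] := @adjoin_roots [seq (lam i, f i) | i <- enum 'I_s].
  by move=> _ /mapP[i _ ->]; exact: lam_gt0.
have [v def_v] : exists v : 'I_s -> L0, forall i, v i ^+ lam i = (f i)%:A.
  suff /boolp.choice[v vP] : forall i, exists w : L0, w ^+ lam i = (f i)%:A.
    by exists v.
  move=> i.
  by apply: (rootL (lam i, f i)); apply: map_f; rewrite mem_enum.
pose E := <<1 & map v (enum 'I_s)>>%AS.
pose u i : subvs_of E := vsproj E (v i).
have vE i : v i \in E by apply/seqv_sub_adjoin/map_f; rewrite mem_enum.
have def_u i : u i ^+ lam i = (f i)%:A.
  apply: val_inj; rewrite /= rmorphXn /= vsprojK // def_v.
  by rewrite algid1.
have ax : SplittingField.axiom (subvs_of E).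
  have u0 i : u i != 0.
    apply: contraNneq (f_neq0 i) => ui0; move/eqP: (def_u i).
    by rewrite ui0 expr0n gtn_eqF // eq_sym scaler_eq0 oner_eq0 orbF.
  have [z prz] : exists z : 'I_s -> Q, forall i, (lam i).-primitive_root (z i).
    suff /boolp.choice[z zP] : forall i, exists z : Q, (lam i).-primitive_root z.
      by exists z.
    by move=> i; exact: prim_root.
  exists (\prod_i ('X^(lam i) - ((f i)%:A)%:P)).
    apply: rpred_prod => i _; rewrite rpredB ?rpredX ?polyOverX // polyOverC.
    exact: rpredZ (mem1v _).
  exists (flatten [seq [seq (z i)%:A ^+ k * u i | k <- iota 0 (lam i)] | i <- enum 'I_s]).
    rewrite big_flatten /= big_map big_enum /=.
    rewrite [X in X %= _](_ : _ = \prod_i \prod_(y <- [seq (z i)%:A ^+ k * u i | k <- iota 0 (lam i)]) ('X - y%:P)) ?eqpxx //.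
    apply: eq_bigr => i _.
    rewrite -def_u; apply: Xn_sub_split => //.
    by have := prz i; rewrite -(fmorph_primitive_root (in_alg (subvs_of E))).
  apply/vspaceP => y; rewrite memvf.
  pose toL := linfun (vsval : subvs_of E -> L0).
  set rs := flatten _; have : val y \in (toL @: <<1 & rs>>)%VS.
    rewrite aimg_adjoin_seq aimg1; apply: subvP (valP y) => /=.
    apply/Fadjoin_seqP; split=> [|_ /mapP[i _ ->]]; first exact: subv_adjoin_seq.
    apply: seqv_sub_adjoin; apply/mapP; exists (u i); last by rewrite lfunE /= vsprojK.
    apply/flatten_mapP; exists i; rewrite ?mem_enum //.
    apply/mapP; exists 0%N; last by rewrite expr0 mul1r.
    by rewrite mem_iota lam_gt0.
  by case/memv_imgP => x xrs; rewrite lfunE => /val_inj ->.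
pose L : splittingFieldType Q := HB.pack (subvs_of E)
  (FieldExt_isSplittingField.Build Q (subvs_of E) ax).
by exists L, u.
Qed.

End RadicalExtension.

(** * Kummer theory: traces and independence of radicals *)

Section Kummer.
Variables (Q : fieldType) (L : splittingFieldType Q).
Hypothesis pcharQ : [pchar Q] =i pred0.
Hypothesis prim_root : forall n, (0 < n)%N -> exists z : Q, n.-primitive_root z.

Let G := 'Gal({:L} / 1)%g.

Lemma galois_char0 : galois 1 {:L}.
Proof.
apply/and3P; split; first exact: subvf.
  by apply/separableP => y _; apply: pcharf0_separable => p; rewrite pchar_lalg pcharQ.
exact: normalFieldf.
Qed.

Lemma galois_card_neq0 : (#|G|%:R : L) != 0.
Proof.
have : (#|G|%:R : Q) != 0 by rewrite ((pcharf0P Q).1 pcharQ) -lt0n cardG_gt0.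
by rewrite -(fmorph_eq0 (in_alg L)) rmorph_nat.
Qed.

(** [g w / w] is an [n]-th root of unity, and all of these already lie in [Q]. *)
Lemma radical_twist n (w : L) (g : gal_of {:L}) : (0 < n)%N -> w != 0 -> w ^+ n \in 1%VS ->
  g \in G -> exists2 c : L, c \in 1%VS /\ c ^+ n = 1 & g w = c * w.
Proof.
move=> n0 w0 wn gG; have [z prz] := prim_root n0.
have prz' : n.-primitive_root (z%:A : L).
  by have := prz; rewrite -(fmorph_primitive_root (in_alg L)).
have : (g w / w) ^+ n = 1.
  rewrite exprMn -rmorphXn /= exprVn (fixed_gal _ gG wn) ?subvf // divff //.
  by rewrite expf_neq0.
case/(prim_rootP prz') => k def_k; exists (g w / w); last by rewrite divfK.
rewrite def_k; split; first by rewrite rpredX // rpredZ // mem1v.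
by rewrite exprAC (prim_expr_order prz') expr1n.
Qed.

(** Some [g] moves [w], that is, multiplies it by a root of unity [c != 1] of the base field. The
    trace is invariant under [g] and at the same time gets multiplied by [c]. *)
Lemma trace_radical n (w : L) : (0 < n)%N -> w ^+ n \in 1%VS -> w \notin 1%VS ->
  galTrace 1 {:L} w = 0.
Proof.
move=> n0 wn w1; have w0 : w != 0 by apply: contraNneq w1 => ->; rewrite mem0v.
have [g gG gw] : exists2 g, g \in G & g w != w.
  apply: boolp.contrapT => nog; case/negP: w1.
  rewrite -(galois_fixedField galois_char0).
  apply/fixedFieldP; first exact: memvf.
  by move=> g gG; apply/eqP/negPn/negP => gw; apply: nog; exists g.
have [c [c1 _] def_gw] := radical_twist n0 w0 wn gG.
have : galTrace 1 {:L} (g w) = c * galTrace 1 {:L} w.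
  rewrite def_gw /galTrace mulr_sumr; apply: eq_bigr => h hG.
  by rewrite rmorphM /= (fixed_gal _ hG c1) ?subvf.
rewrite galTrace_gal ?memvf // => /eqP.
rewrite -subr_eq0 -{1}[galTrace _ _ w]mul1r -mulrBl mulf_eq0 => /orP[|/eqP //].
rewrite subr_eq0 eq_sym => /eqP c11; by rewrite def_gw c11 mul1r eqxx in gw.
Qed.

Variables (I : finType) (w : I -> L) (n : nat).
Hypothesis n_gt0 : (0 < n)%N.
Hypothesis w_neq0 : forall i, w i != 0.
Hypothesis w_radical : forall i, w i ^+ n \in 1%VS.
Hypothesis w_indep : forall i j, w i / w j \in 1%VS -> i = j.

(** Division by [w j] turns every other term into a radical outside the base field, whose trace
    vanishes; so the trace reads off the coordinate at [j]. *)
Lemma trace_coord (c : I -> L) j : (forall i, c i \in 1%VS) ->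
  galTrace 1 {:L} ((\sum_i c i * w i) / w j) = c j *+ #|G|.
Proof.
move=> c1; rewrite mulr_suml raddf_sum /= (bigD1 j) //= big1 ?addr0 => [|i nij].
  rewrite mulfK // /galTrace -sumr_const; apply: eq_bigr => h hG.
  by rewrite (fixed_gal _ hG (c1 j)) ?subvf.
have -> : galTrace 1 {:L} (c i * w i / w j) = c i * galTrace 1 {:L} (w i / w j).
  rewrite /galTrace mulr_sumr; apply: eq_bigr => h hG.
  by rewrite -mulrA rmorphM /= (fixed_gal _ hG (c1 i)) ?subvf.
rewrite (trace_radical n_gt0) ?mulr0 //.
  by rewrite exprMn exprVn rpred_div.
by apply: contraNN nij => /w_indep ->.
Qed.

Lemma radical_free (c : I -> L) : (forall i, c i \in 1%VS) ->
  \sum_i c i * w i = 0 -> forall i, c i = 0.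
Proof.
move=> c1 cw i; have := trace_coord i c1; rewrite cw mul0r raddf0 => /esym/eqP.
by rewrite -mulr_natr mulf_eq0 (negPf galois_card_neq0) orbF => /eqP.
Qed.

(** The term [c j * w j] is [1 / #|G|] times the sum over [h] in [G] of [h x] times [w j / h (w j)].
    Conjugates of an integral element are integral and the second factors are roots of unity, so
    integrality passes from a sum to each of its terms. *)
Lemma radical_coord_integral (D : comNzRingType) (iota : {rmorphism D -> L}) (c : I -> L) :
  (forall d, iota d \in 1%VS) -> (exists d, iota d = (#|G|%:R)^-1) ->
  (forall i, c i \in 1%VS) ->
  integralOver iota (\sum_i c i * w i) -> forall i, integralOver iota (c i * w i).
Proof.
move=> iota1 [d def_d] c1; set x := \sum_i _ => intx j.
have -> : c j * w j = galTrace 1 {:L} (x / w j) * w j * iota d.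
  rewrite trace_coord // def_d -mulr_natr; field.
  by rewrite galois_card_neq0.
apply: integral_mul; last exact: integral_id.
rewrite /galTrace mulr_suml; apply: (big_ind (integralOver iota)).
- exact: integral0.
- exact: integral_add.
move=> h hG; rewrite rmorphM fmorphV /=.
have [k [_ kn] def_hw] := radical_twist n_gt0 (w_neq0 j) (w_radical j) hG.
have k0 : k != 0.
  apply: contraTneq (oner_neq0 L) => kz.
  by rewrite -kn kz expr0n gtn_eqF // eqxx.
have -> : h x / h (w j) * w j = h x * k^-1.
  by rewrite def_hw; field; rewrite k0 w_neq0.
apply: integral_mul.
  have [p mon rt] := intx; exists p => //.
  have -> : map_poly iota p = map_poly h (map_poly iota p).
    apply/polyP => i; rewrite !coef_map /= (fixed_gal _ hG) ?subvf //.
  by rewrite fmorph_root.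
exists ('X^n - 1); first exact: monicXnsubC.
rewrite rmorphB rmorph1 /= map_polyXn rootE !hornerE exprVn kn invr1 subrr //.
Qed.

End Kummer.

(** * Normal forms *)

Section MonomialFunctional.
Variables (n : nat) (R : comNzRingType) (V : lmodType R) (F : 'X_{1..n} -> V).

Definition mlin (p : {mpoly R[n]}) : V := \sum_(m <- msupp p) p@_m *: F m.

Lemma mlinE k p : (msize p <= k)%N -> mlin p = \sum_(m : 'X_{1..n < k}) p@_m *: F m.
Proof.
move=> le_pk; rewrite /mlin (ssrcomplements.big_mksub 'X_{1..n < k}) ?msupp_uniq //=; last first.
  by move=> m /msize_mdeg_lt /leq_trans; apply.
by rewrite big_rmcond //= => m /memN_msupp_eq0 ->; rewrite scale0r.
Qed.

Lemma mlin_linear : linear mlin.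
Proof.
move=> c p r; set k := maxn (msize (c *: p + r)) (maxn (msize p) (msize r)).
rewrite !(@mlinE k) ?leq_max ?leqnn ?orbT // scaler_sumr -big_split.
by apply: eq_bigr => m _; rewrite mcoeffD mcoeffZ scalerDl scalerA.
Qed.

HB.instance Definition _ := GRing.isLinear.Build R {mpoly R[n]} V *:%R mlin mlin_linear.

Lemma mlinX m : mlin 'X_[m] = F m.
Proof. by rewrite /mlin msuppX big_seq1 mcoeffX eqxx scale1r. Qed.

End MonomialFunctional.

Lemma ker_ideal (K : fieldType) N (T : pzRingType) (f : {rmorphism {mpoly K[N]} -> T}) :
  is_ideal (fun p => f p = 0).
Proof.
split=> [|a b fa fb|a b fb]; first exact: rmorph0.
  by rewrite rmorphD fa fb addr0.
by rewrite rmorphM fb mulr0.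
Qed.

Section GeneratedIdeal.
Variables (K : fieldType) (N : nat) (G : {mpoly K[N]} -> Prop).

Lemma gen_ideal_is_ideal : is_ideal (gen_ideal G).
Proof.
split; first by exists [::]; rewrite big_nil.
  move=> a b [s [sG ->]] [t [tG ->]]; exists (s ++ t); rewrite big_cat; split=> //.
  by move=> x; rewrite mem_cat => /orP[/sG|/tG].
move=> a b [s [sG ->]]; exists [seq (a * x.1, x.2) | x <- s]; split.
  by move=> _ /mapP[x xs ->] /=; exact: sG.
by rewrite big_map mulr_sumr; apply: eq_bigr => x _; rewrite mulrA.
Qed.

Lemma gen_ideal_gen g : G g -> gen_ideal G g.
Proof.
move=> Gg; exists [:: (1, g)]; rewrite big_seq1 mul1r; split=> //.
by move=> x; rewrite inE => /eqP ->.
Qed.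

Lemma gen_ideal_sub (J : {mpoly K[N]} -> Prop) :
  is_ideal J -> (forall g, G g -> J g) -> forall p, gen_ideal G p -> J p.
Proof.
case=> J0 JD JM GJ p [s [sG ->]]; elim: s sG => [|x s IHs] sG; first by rewrite big_nil.
rewrite big_cons; apply: JD; first by apply/JM/GJ/sG; rewrite mem_head.
by apply: IHs => y ys; apply: sG; rewrite inE ys orbT.
Qed.

End GeneratedIdeal.

Section IdealTheory.
Variables (K : fieldType) (N : nat) (J : {mpoly K[N]} -> Prop).
Hypothesis JI : is_ideal J.

Lemma ideal0 : J 0. Proof. by case: JI. Qed.
Lemma idealD a b : J a -> J b -> J (a + b). Proof. by case: JI => _ + _; apply. Qed.
Lemma ideal_mull (a b : {mpoly K[N]}) : J b -> J (a * b). Proof. by case: JI => _ _; apply. Qed.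
Lemma ideal_mulr (a b : {mpoly K[N]}) : J a -> J (a * b). Proof. by rewrite mulrC; exact: ideal_mull. Qed.
Lemma idealN a : J a -> J (- a). Proof. by rewrite -mulN1r; exact: ideal_mull. Qed.
Lemma idealB a b : J a -> J b -> J (a - b).
Proof. by move=> Ja Jb; apply/idealD/idealN. Qed.
Lemma idealZ c a : J a -> J (c *: a).
Proof. by rewrite -mul_mpolyC; exact: ideal_mull. Qed.
Lemma ideal_sum (T : Type) (r : seq T) (P : pred T) (F : T -> {mpoly K[N]}) :
  (forall i, P i -> J (F i)) -> J (\sum_(i <- r | P i) F i).
Proof. by move=> JF; apply: big_ind => //; [exact: ideal0 | exact: idealD]. Qed.
Lemma ideal_trans b a c : J (a - b) -> J (b - c) -> J (a - c).
Proof. by move=> Jab Jbc; rewrite -(subrKA b); exact: idealD. Qed.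
Lemma ideal_sym a b : J (a - b) -> J (b - a).
Proof. by move=> /idealN; rewrite opprB. Qed.
Lemma ideal_eqr a b : J (a - b) -> J b -> J a.
Proof. by move=> /idealD Jab /Jab; rewrite subrK. Qed.
Lemma ideal_mul (a b c d : {mpoly K[N]}) : J (a - b) -> J (c - d) -> J (a * c - b * d).
Proof.
move=> Jab Jcd; rewrite (_ : _ - _ = (a - b) * c + b * (c - d)); last by ring.
by apply: idealD; [exact: ideal_mulr | exact: ideal_mull].
Qed.
Lemma ideal_exp a b n : J (a - b) -> J (a ^+ n - b ^+ n).
Proof.
move=> Jab; elim: n => [|n IHn]; first by rewrite !expr0 subrr; exact: ideal0.
by rewrite !exprS; exact: ideal_mul.
Qed.
Lemma ideal_prod (T : Type) (r : seq T) (P : pred T) (F H : T -> {mpoly K[N]}) :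
  (forall i, P i -> J (F i - H i)) ->
  J (\prod_(i <- r | P i) F i - \prod_(i <- r | P i) H i).
Proof.
move=> JFH; apply: (big_ind2 (fun a b => J (a - b))) => //.
  by rewrite subrr; exact: ideal0.
by move=> a b c d; exact: ideal_mul.
Qed.

End IdealTheory.

(* Column [i] of [cmx] holds the coefficients of the linear form [ell_i], and [wexp j]
   is the exponent of the variable [j] in the monomial of its block [blk j]. *)
Record block_data (K : fieldType) (N s q : nat) := BlockData {
  blk : 'I_N -> 'I_s;
  wexp : 'I_N -> nat;
  cmx : 'M[K]_(q, s);
  cinv : 'M[K]_(s, q);
  wexp_gt0 : forall j, (0 < wexp j)%N;
  blk_surj : forall i, exists j, blk j = i;
  cmx_inv : cmx *m cinv = 1%:M;
  cmx_neq0 : forall i, col i cmx != 0;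
  cmx_indep : forall i k (a b : K), i != k ->
    a *: col i cmx + b *: col k cmx = 0 -> a = 0 /\ b = 0 }.

Section Blocks.
Variables (K : fieldType) (N s q : nat) (B : block_data K N s q).

Local Notation bet := (blk B).
Local Notation lam := (wexp B).
Local Notation A := (cmx B).
Local Notation M := (cinv B).
Local Notation S := {mpoly K[N]}.
Local Notation Y := {mpoly K[q]}.
Implicit Types (m e : 'X_{1..N}) (i : 'I_s) (j : 'I_N) (c : 'I_s -> nat).

Section BlockSection.
Variable tau : 'I_s -> 'I_N.
Hypothesis tauK : forall i, bet (tau i) = i.

Lemma card_distinguished : #|[pred j | j == tau (bet j)]| = s.
Proof.
have tau_inj : injective tau by move=> i k eq_t; rewrite -(tauK i) eq_t tauK.
rewrite -[RHS](card_ord s) -(card_image tau_inj predT); apply: eq_card => j.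
rewrite inE; apply/eqP/imageP => [def_j|[i _ ->]]; last by rewrite tauK.
by exists (bet j).
Qed.

Lemma card_off : #|[pred j | j != tau (bet j)]| = (N - s)%N.
Proof.
have cN := cardC [pred j | j == tau (bet j)]; rewrite card_ord card_distinguished in cN.
have -> : #|[pred j | j != tau (bet j)]| = #|[predC [pred j | j == tau (bet j)]]| by exact: eq_card.
apply: (@addnI s); apply: etrans (cN) _; rewrite subnKC //.
by apply: leq_trans (leq_addr _ _) (eq_leq cN).
Qed.

End BlockSection.

(** Exponent vector of the product of the [t_i ^ c i]; in particular [tm i] is that of [t_i]. *)
Definition tsum c : 'X_{1..N} := [multinom (c (bet j) * lam j)%N | j < N].

Definition tm i : 'X_{1..N} := tsum (fun i' => (i' == i) : nat).

(** The largest [k] such that [t_i ^ k] divides the monomial [m]. Blocks are nonempty and the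
    [lam j] positive, so [k] cannot exceed [mdeg m]. *)
Definition quo m i : nat :=
  \max_(k < (mdeg m).+1 | [forall j, (bet j == i) ==> (k * lam j <= m j)%N]) k.

Definition red m : 'X_{1..N} := [multinom (m j - quo m (bet j) * lam j)%N | j < N].

Lemma quo_le m j : (quo m (bet j) * lam j <= m j)%N.
Proof.
rewrite /quo; have [|k kP ->] := @eq_bigmax_cond _
  [pred k : 'I_(mdeg m).+1 | [forall j', (bet j' == bet j) ==> (k * lam j' <= m j')%N]]
  (fun k => k : nat).
- by apply/card_gt0P; exists ord0; rewrite inE; apply/forallP => j'; rewrite mul0n leq0n implybT.
- by move: kP; rewrite inE => /forallP/(_ j); rewrite eqxx.
Qed.

Lemma mnm_le_mdeg m j : (m j <= mdeg m)%N.
Proof. by rewrite mdegE (bigD1 j) //= leq_addr. Qed.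

Lemma quo_max m i k : (forall j, bet j = i -> (k * lam j <= m j)%N) -> (k <= quo m i)%N.
Proof.
move=> kP; have [j def_i] := blk_surj B i.
have lt_k : (k < (mdeg m).+1)%N.
  rewrite ltnS; apply: leq_trans (mnm_le_mdeg m j); apply: leq_trans (kP _ def_i).
  by rewrite leq_pmulr ?wexp_gt0.
rewrite /quo (bigD1 (Ordinal lt_k)) /= ?leq_maxl //.
by apply/forallP => j'; apply/implyP => /eqP; exact: kP.
Qed.

Lemma quo_uniq m i k : (forall j, bet j = i -> (k * lam j <= m j)%N) ->
  (exists2 j, bet j = i & (m j < k.+1 * lam j)%N) -> quo m i = k.
Proof.
move=> kP [j def_i lt_m]; apply/eqP; rewrite eqn_leq quo_max // andbT.
rewrite leqNgt; apply/negP => lt_k; have := quo_le m j; rewrite def_i leqNgt => /negP[].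
by apply: leq_trans lt_m _; rewrite leq_mul2r lt_k orbT.
Qed.

Lemma quo_tight m i : exists2 j, bet j = i & (m j < (quo m i).+1 * lam j)%N.
Proof.
apply: boolp.contrapT => tight; have := ltnn (quo m i); suff -> : (quo m i < quo m i)%N by [].
apply: quo_max => j def_i; rewrite leqNgt; apply/negP => lt_m.
by apply: tight; exists j.
Qed.

Lemma red_quo m : m = (red m + tsum (quo m))%MM.
Proof. by apply/mnmP => j; rewrite mnmDE !mnmE subnK // quo_le. Qed.

Lemma quo_tsum m c i : quo (m + tsum c)%MM i = (quo m i + c i)%N.
Proof.
apply: quo_uniq => [j def_i|].
  by rewrite mnmDE mnmE mulnDl def_i leq_add2r -def_i quo_le.
have [j def_i lt_m] := quo_tight m i; exists j => //.
rewrite mnmDE mnmE def_i.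
by rewrite [X in (_ < X)%N](_ : _ = (quo m i).+1 * lam j + c i * lam j)%N ?ltn_add2r // -mulnDl addSn.
Qed.

Lemma red_tsum m c : red (m + tsum c)%MM = red m.
Proof.
by apply/mnmP => j; rewrite [LHS]mnmE [RHS]mnmE quo_tsum mnmDE mulnDl mnmE subnDr.
Qed.

Lemma red_red m : red (red m) = red m.
Proof. by rewrite -(red_tsum (red m) (quo m)) -red_quo. Qed.

Lemma quo_red m i : quo (red m) i = 0%N.
Proof.
have := quo_tsum (red m) (quo m) i; rewrite -red_quo => /eqP.
by rewrite -{1}[quo m i]add0n eqn_add2r => /eqP <-.
Qed.

Lemma redD m0 m : red (m0 + red m)%MM = red (m0 + m)%MM.
Proof. by rewrite {2}(red_quo m) addmA red_tsum. Qed.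

Lemma quoD m0 m i : quo (m0 + m)%MM i = (quo (m0 + red m)%MM i + quo m i)%N.
Proof. by rewrite {1}(red_quo m) addmA quo_tsum. Qed.

(** Equal reductions of [m0 + m] and [m0 + m'] mean that [m] and [m'] agree after adding exponents
    of powers of the [t_i], which [red] ignores. Hence multiplication by a monomial never merges two
    coordinates of a normal form. *)
Lemma redD_inj m0 m m' : red (m0 + m)%MM = red (m0 + m')%MM -> red m = red m'.
Proof.
move=> eq_red; have := red_quo (m0 + m')%MM; rewrite -eq_red => def_m'.
have def_m := red_quo (m0 + m)%MM.
rewrite -(red_tsum m (quo (m0 + m')%MM)) -(red_tsum m' (quo (m0 + m)%MM)).
congr red; apply: (@addmI _ m0); rewrite !addmA {1}def_m {2}def_m' -!addmA.
by congr (_ + _)%MM; rewrite addmC.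
Qed.

Definition ell i : Y := \sum_b A b i *: 'X_b.

Definition mval m : Y := \prod_i ell i ^+ quo m i.

Definition NF e : S -> Y := mlin (fun m => if red m == e then mval m else 0).

HB.instance Definition _ e := GRing.Linear.copy (NF e)
  (mlin (fun m => if red m == e then mval m else 0)).

Arguments NF : simpl never.

Lemma NFX e m : NF e 'X_[m] = if red m == e then mval m else 0.
Proof. exact: mlinX. Qed.

Lemma mvalD m0 m : mval (m0 + m)%MM = mval (m0 + red m)%MM * mval m.
Proof.
by rewrite /mval -big_split; apply: eq_bigr => i _; rewrite quoD exprD.
Qed.

(** By [redD_inj] only the coordinate [e] of [p] reaches [red (m0 + e)]; the [t_i] completed on the
    way are recorded by [mval]. *)
Lemma NF_mulX e m0 p : red e = e ->
  NF (red (m0 + e)%MM) ('X_[m0] * p) = mval (m0 + e)%MM * NF e p.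
Proof.
move=> red_e; rewrite (mpolyE p) mulr_sumr !linear_sum mulr_sumr; apply: eq_bigr => m _.
rewrite -scalerAr !linearZ /= -scalerAr -mpolyXD !NFX; congr (_ *: _).
have [def_e|ne] := eqVneq (red m) e; last first.
  by rewrite mulr0 ifN //; apply: contraNneq ne => /redD_inj ->; rewrite red_e.
by rewrite -def_e redD eqxx mvalD.
Qed.

Lemma NF_mulX0 e m0 p : (forall e', red e' = e' -> e <> red (m0 + e')%MM) ->
  NF e ('X_[m0] * p) = 0.
Proof.
move=> noe; rewrite (mpolyE p) mulr_sumr linear_sum big1 // => m _.
rewrite -scalerAr linearZ /= -mpolyXD NFX ifN ?scaler0 //.
by apply/eqP => def_e; apply: (noe (red m)); rewrite ?red_red ?redD.
Qed.

Definition blockI : S -> Prop := gen_ideal (fun g => exists v : 'cV[K]_s,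
  A *m v = 0 /\ g = \sum_i v i 0 *: 'X_[tm i]).

Lemma blockI_ideal : is_ideal blockI. Proof. exact: gen_ideal_is_ideal. Qed.

Lemma red_tm m i : red (tm i + m)%MM = red m.
Proof. by rewrite addmC red_tsum. Qed.

Lemma mval_tm m i : mval (tm i + m)%MM = ell i * mval m.
Proof.
rewrite /mval [RHS]mulrC (bigD1 i) //= [in RHS](bigD1 i) //= mulrAC; congr (_ * _).
  by rewrite addmC quo_tsum eqxx addn1 exprSr.
by apply: eq_bigr => k nki; rewrite addmC quo_tsum (negPf nki) addn0.
Qed.

Lemma var_ell b : 'X_b = \sum_i M i b *: ell i :> Y.
Proof.
rewrite /ell; under eq_bigr do rewrite scaler_sumr.
rewrite exchange_big (bigD1 b) //= [X in _ + X]big1 ?addr0 => [|b' nb].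
  under eq_bigr do rewrite scalerA mulrC; rewrite -scaler_suml.
  by have /matrixP/(_ b b) := cmx_inv B; rewrite !mxE eqxx => ->; rewrite scale1r.
under eq_bigr do rewrite scalerA mulrC; rewrite -scaler_suml.
by have /matrixP/(_ b' b) := cmx_inv B; rewrite !mxE (negPf nb) => ->; rewrite scale0r.
Qed.


Lemma ell_relation (v : 'cV[K]_s) : A *m v = 0 -> \sum_i v i 0 *: ell i = 0.
Proof.
move=> Av0; rewrite /ell; under eq_bigr do rewrite scaler_sumr.
rewrite exchange_big big1 //= => b _.
under eq_bigr do rewrite scalerA; rewrite -scaler_suml.
have /matrixP/(_ b 0) := Av0; rewrite !mxE => sum0.
by under eq_bigr do rewrite mulrC; rewrite sum0 scale0r.
Qed.

Lemma NF_blockI p : blockI p -> forall e, NF e p = 0.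
Proof.
move: p; apply: (gen_ideal_sub (J := fun p => forall e, NF e p = 0)); last first.
  move=> g [v [Av0 ->]] e.
  rewrite linear_sum /=.
  rewrite (eq_bigr (fun i => if red 0%MM == e then v i 0 *: ell i * mval 0%MM else 0)) => [|i _].
    case: eqP => _; last by rewrite big1.
    rewrite -mulr_suml; apply/eqP; rewrite mulf_eq0; apply/orP; left; apply/eqP.
    exact: ell_relation.
  rewrite linearZ /= NFX -[tm i]addm0 red_tm mval_tm.
  by case: eqP => _; rewrite ?scaler0 // scalerAl.
split=> [|a b Na Nb|a b Nb] e.
- by rewrite linear0.
- by rewrite linearD /= Na Nb addr0.
(* Each coordinate of a monomial times [b] is zero or a multiple of a single coordinate of [b]. *)
suff NF0 m : NF e ('X_[m] * b) = 0.
  rewrite (mpolyE a) mulr_suml linear_sum big1 // => m _ /=.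
  by rewrite -scalerAl linearZ /= NF0 scaler0.
have [[e' [red_e' ->]]|noe] := boolp.pselect (exists e', red e' = e' /\ e = red (m + e')%MM).
  by rewrite NF_mulX // Nb mulr0.
by apply: NF_mulX0 => e' red_e' def_e; apply: noe; exists e'.
Qed.

(** [cinv] expresses the variables of [Y] through the forms [ell_i]; replacing [ell_i] by [t_i]
    gives the element of [S] that represents [y_b] in the quotient. *)
Definition yhat (b : 'I_q) : S := \sum_i M i b *: 'X_[tm i].

Definition ysub : Y -> S := mmap (@mpolyC N K) yhat.

HB.instance Definition _ := GRing.RMorphism.copy ysub (mmap (@mpolyC N K) yhat).

Arguments ysub : simpl never.

Lemma ysubC (a : K) : ysub a%:MP = a%:MP. Proof. exact: mmapC. Qed.

Lemma ysubX b : ysub 'X_b = yhat b.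
Proof. by rewrite /ysub mmapX mmap1U. Qed.

Lemma ysubZ (a : K) h : ysub (a *: h) = a *: ysub h.
Proof. by rewrite -mul_mpolyC rmorphM /= ysubC mul_mpolyC. Qed.

Lemma blockI_tm i : blockI ('X_[tm i] - ysub (ell i)).
Proof.
(* The witness is column [i] of [1 - M A], which [A] kills because [A M = 1]. *)
apply: gen_ideal_gen; exists (\col_k ((k == i)%:R - (M *m A) k i)); split.
  have -> : \col_k ((k == i)%:R - (M *m A) k i) = col i (1%:M - M *m A).
    by apply/colP => k; rewrite !mxE.
  by rewrite colE mulmxA mulmxBr mulmx1 mulmxA cmx_inv mul1mx subrr mul0mx.
rewrite /ell rmorph_sum /=.
under [in RHS]eq_bigr do rewrite mxE scalerBl.
rewrite sumrB; congr (_ - _).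
  by rewrite (bigD1 i) //= eqxx scale1r big1 ?addr0 // => k /negPf ->; rewrite scale0r.
under eq_bigr do rewrite ysubZ ysubX /yhat scaler_sumr.
rewrite exchange_big; apply: eq_bigr => k _ /=.
rewrite mxE scaler_suml; apply: eq_bigr => b _.
by rewrite scalerA mulrC.
Qed.

Lemma tsum_prod c : 'X_[tsum c] = \prod_i 'X_[K, tm i] ^+ c i.
Proof.
rewrite mprodXnE; congr 'X_[_]; apply/mnmP => j; rewrite mnm_sumE (bigD1 (bet j)) //=.
rewrite big1 ?addn0 => [|i nij]; rewrite mulmnE !mnmE ?eqxx ?mul1n 1?mulnC //.
by rewrite eq_sym (negPf nij) mul0n muln0.
Qed.

Lemma blockI_mval m : blockI ('X_[m] - ysub (mval m) * 'X_[red m]).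
Proof.
rewrite {1}(red_quo m) mpolyXD mulrC -mulrBl; apply: ideal_mulr; first exact: blockI_ideal.
rewrite tsum_prod rmorph_prod; apply: (ideal_prod blockI_ideal) => i _.
by rewrite rmorphXn; apply: (ideal_exp blockI_ideal); exact: blockI_tm.
Qed.

Lemma blockI_normal p :
  blockI (p - \sum_(e <- undup [seq red m | m <- msupp p]) ysub (NF e p) * 'X_[e]).
Proof.
have -> : \sum_(e <- undup [seq red m | m <- msupp p]) ysub (NF e p) * 'X_[e] =
          \sum_(m <- msupp p) p@_m *: (ysub (mval m) * 'X_[red m]).
  rewrite /NF /mlin; under eq_bigr do rewrite rmorph_sum mulr_suml.
  rewrite exchange_big big_seq [RHS]big_seq; apply: eq_bigr => m mp /=.
  rewrite (bigD1_seq (red m)) ?undup_uniq ?mem_undup ?map_f //= eqxx ysubZ.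
  rewrite big1 ?addr0 ?scalerAl // => e /negPf ne.
  by rewrite eq_sym ne scaler0 rmorph0 mul0r.
rewrite [X in X - _](mpolyE p) -sumrB; apply: (ideal_sum blockI_ideal) => m _.
by rewrite -scalerBr; apply: (idealZ blockI_ideal); exact: blockI_mval.
Qed.

Lemma blockIP p : blockI p <-> forall e, NF e p = 0.
Proof.
split=> [|NF0]; first exact: NF_blockI.
apply: (ideal_eqr blockI_ideal (blockI_normal p)).
by rewrite big1 => [|e _]; rewrite ?NF0 ?rmorph0 ?mul0r //; exact: ideal0 blockI_ideal.
Qed.

Lemma NF_ysub h e (p : S) : NF e (ysub h * p) = h * NF e p.
Proof.
suff NFyh b (r : S) : NF e (yhat b * r) = 'X_b * NF e r.
  have NFym (m : 'X_{1..q}) (r : S) : NF e (ysub 'X_[m] * r) = 'X_[m] * NF e r.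
    rewrite mpolyXE_id rmorph_prod; elim/big_rec2: _ r => [|b x y _ IH] r; first by rewrite !mul1r.
    rewrite -!mulrA -IH rmorphXn /= ysubX; elim: (m b) (y * r) => [|k IHk] u.
      by rewrite !expr0 !mul1r.
    by rewrite !exprS -!mulrA NFyh IHk.
  have [sp [k ->]] : exists sp (k : 'X_{1..q} -> K), h = \sum_(m <- sp) k m *: 'X_[m].
    by exists (msupp h), (fun m : 'X_{1..q} => h@_m); exact: mpolyE.
  rewrite rmorph_sum /= !mulr_suml linear_sum; apply: eq_bigr => m _.
  by rewrite /= ysubZ -scalerAl linearZ /= NFym scalerAl.
have NFtm i : NF e ('X_[tm i] * r) = ell i * NF e r.
  rewrite (mpolyE r) mulr_sumr !linear_sum mulr_sumr; apply: eq_bigr => m _.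
  rewrite -scalerAr !linearZ /= -mpolyXD !NFX red_tm mval_tm -scalerAr.
  by case: eqP => _; rewrite ?mulr0.
rewrite /yhat mulr_suml linear_sum /=.
under eq_bigr do rewrite -scalerAl linearZ /= NFtm scalerAl.
rewrite -mulr_suml; congr (_ * _).
rewrite /ell; under eq_bigr do rewrite scaler_sumr.
rewrite exchange_big (bigD1 b) //= [X in _ + X]big1 ?addr0 => [|b' nb].
  under eq_bigr do rewrite scalerA mulrC; rewrite -scaler_suml.
  by have /matrixP/(_ b b) := cmx_inv B; rewrite !mxE eqxx => ->; rewrite scale1r.
under eq_bigr do rewrite scalerA mulrC; rewrite -scaler_suml.
by have /matrixP/(_ b' b) := cmx_inv B; rewrite !mxE (negPf nb) => ->; rewrite scale0r.
Qed.

End Blocks.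

(** * Multiplicity of a prime in a factorial domain *)

Section Valuation.
Variable D : idomainType.
Hypothesis ufd : factorial_domain D.

Lemma prime_split (p x : D) : prime_elt p -> x != 0 ->
  exists k y, x = p ^+ k * y /\ ~ divides p y.
Proof.
move=> prp x0; have [u [ps [uU prps ->]]] := ufd x0 => {x x0}.
elim: ps prps => [|r ps IHps] prps.
  exists 0%N, u; rewrite big_nil expr0 mulr1 mul1r; split=> //.
  by move/(prime_not_div_unit prp); apply.
have [|k [y [def_y npy]]] := IHps; first by move=> t tps; apply: prps; rewrite inE tps orbT.
have prr : prime_elt r by apply: prps; rewrite mem_head.
rewrite big_cons mulrCA def_y; have [pr|npr] := boolp.pselect (divides p r).
  have [v vU ->] := prime_div_prime prp prr pr.
  exists k.+1, (v * y); split; first by rewrite exprS; ring.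
  have [_ _ prp' [c def_vy]] := prp; apply: npy; exists (v^-1 * c).
  by rewrite -mulrA -def_vy mulKr.
exists k, (r * y); split; first by ring.
by case: prp => _ _ /[apply]-[].
Qed.

Lemma prime_exp_inj (p y z : D) k l : prime_elt p -> ~ divides p y -> ~ divides p z ->
  p ^+ k * y = p ^+ l * z -> k = l.
Proof.
move=> [p0 _ _] ny nz; elim: k l => [|k IHk] [|l] //.
- by rewrite expr0 mul1r => def_y; case: ny; exists (p ^+ l * z); rewrite def_y exprS; ring.
- by rewrite expr0 mul1r => def_z; case: nz; exists (p ^+ k * y); rewrite -def_z exprS; ring.
by rewrite !exprS -!mulrA => /(mulfI p0)/IHk ->.
Qed.

Lemma prime_ndivM (p x y : D) : prime_elt p -> ~ divides p x -> ~ divides p y ->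
  ~ divides p (x * y).
Proof. by case=> _ _ prp nx ny /prp[]. Qed.

End Valuation.

(** * Linear forms as prime elements *)

Section LinearForms.
Variables (K : fieldType) (q : nat).
Local Notation Y := {mpoly K[q]}.
Implicit Types (a : 'I_q -> K).

Lemma factorial_Y : factorial_domain Y.
Proof. exact/factorial_mpoly/factorial_field. Qed.

Definition lform a : Y := \sum_b a b *: 'X_b.

Lemma lform_coef a b : (lform a)@_U_(b) = a b.
Proof.
rewrite raddf_sum (bigD1 b) //= mcoeffZ mcoeffX eqxx mulr1 big1 ?addr0 // => c nc.
rewrite mcoeffZ mcoeffX -[_ == _]/(U_(c)%MM == U_(b)%MM) (_ : _ == _ = false) ?mulr0 //.
by apply: contraNF nc => /eqP/mnmP/(_ b); rewrite !mnm1E eqxx; case: eqP => // ->.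
Qed.

Lemma msize_lform a : lform a != 0 -> msize (lform a) = 2%N.
Proof.
move=> a0; have supp m : m \in msupp (lform a) -> exists b, m = U_(b)%MM.
  move=> mp; apply: boolp.contrapT => nob; move: mp; rewrite mcoeff_msupp => /eqP[].
  rewrite raddf_sum big1 // => b _ /=; rewrite mcoeffZ mcoeffX (_ : _ == _ = false) ?mulr0 //.
  by apply/eqP => def_m; apply: nob; exists b.
have le2 : (msize (lform a) <= 2)%N.
  by rewrite msizeE; apply/bigmax_leqP_seq => m /supp[b ->] _; rewrite mdeg1.
apply/eqP; rewrite eqn_leq le2 ltnNge; apply: contraNN a0 => /msize1_polyC def_a.
have a0 b : a b = 0.
  rewrite -lform_coef def_a mcoeffC (_ : _ == _ = false) ?mulr0 //.
  by apply/eqP => /mnmP/(_ b); rewrite mnm1E eqxx mnm0E.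
by rewrite /lform big1 // => b _; rewrite a0 scale0r.
Qed.

Lemma unit_msize (h : Y) : h \is a GRing.unit = (msize h == 1%N).
Proof.
apply/idP/idP => [/andP[/eqP def_h]|/msize_poly1P[c c0 ->]].
  by rewrite unitfE def_h msizeC => h0; rewrite mcoeffC eqxx mulr1 in h0; rewrite h0.
by apply/andP; rewrite mcoeffC eqxx mulr1 eqxx unitfE.
Qed.

(** A nonzero linear form has degree one, [msize] being the degree plus one. Prime factors have
    positive degree and degrees add up, so its factorisation contains exactly one prime. *)
Lemma prime_lform a : lform a != 0 -> prime_elt (lform a).
Proof.
move=> a0; have [u [ps [uU prps def_a]]] := factorial_Y a0.
have := msize_lform a0; have u0 := unitr_neq0 uU.
have szu : msize u = 1%N by apply/eqP; rewrite -unit_msize.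
have sz2 (p : Y) : prime_elt p -> (1 < msize p)%N.
  case=> p0; rewrite unit_msize => /negP p1 _; move: p0; rewrite -msize_poly_eq0.
  by case: (msize p) p1 => [|[|k]].
have mnz : \prod_(p <- ps) p != 0.
  by apply: contraNneq a0 => pz; rewrite def_a pz mulr0.
rewrite {1}def_a msizeM // szu add1n /=.
case: ps prps mnz def_a => [|p ps] prps mnz def_a; first by rewrite big_nil msize1.
have prp : prime_elt p by apply: prps; rewrite mem_head.
case: ps prps mnz def_a => [|r ps] prps mnz def_a.
  by move=> _; rewrite def_a big_seq1; exact: prime_unitM.
have prr : prime_elt r by apply: prps; rewrite !inE eqxx orbT.
move: mnz; rewrite !big_cons !mulf_eq0 !negb_or => /and3P[p0 r0 ps0].
rewrite !msizeM ?mulf_neq0 //; move: (sz2 p prp) (sz2 r prr).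
move: ps0; rewrite -msize_poly_eq0 -lt0n.
move: (mmeasure _ _) (mmeasure _ p) (mmeasure _ r) => x y z h1 h2 h3 h4; exfalso; lia.
Qed.

Lemma lform_divides a b : lform a != 0 -> lform b != 0 -> divides (lform a) (lform b) ->
  exists c, forall k, b k = c * a k.
Proof.
move=> a0 b0 [h def_b]; have h0 : h != 0 by apply: contraNneq b0 => hz; rewrite def_b hz mul0r.
have := msize_lform b0; rewrite def_b msizeM // msize_lform // addn2 /= => -[szh].
exists h@_0 => k; rewrite -lform_coef def_b (msize1_polyC (p := h)) ?szh //.
by rewrite mul_mpolyC mcoeffZ lform_coef mcoeffC eqxx mulr1.
Qed.

End LinearForms.

Section BlockForms.
Variables (K : fieldType) (N s q : nat) (B : block_data K N s q).

Lemma ellE i : ell B i = lform (fun b => cmx B b i). Proof. by []. Qed.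

Lemma ell_neq0 i : ell B i != 0.
Proof.
apply: contraNneq (cmx_neq0 B i) => ell0; apply/eqP/colP => b.
by rewrite !mxE -[LHS](lform_coef (fun b => cmx B b i)) -ellE ell0 mcoeff0.
Qed.

Lemma prime_ell i : prime_elt (ell B i).
Proof. by rewrite ellE; apply: prime_lform; rewrite -ellE ell_neq0. Qed.

Lemma ell_ndiv i k : i != k -> ~ divides (ell B i) (ell B k).
Proof.
move=> nik; rewrite !ellE => /lform_divides[||c def_k]; try by rewrite -ellE ell_neq0.
have [|_ /eqP] := @cmx_indep _ _ _ _ B i k c (-1) nik; last by rewrite oppr_eq0 oner_eq0.
by apply/colP => b; rewrite !mxE def_k; ring.
Qed.

End BlockForms.

Local Notation "x %:F" := (FracField.tofrac x).

(** * The embedding into a Kummer extension *)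

Section Fractions.
Variable R : idomainType.

Lemma frac_quotient (x : {fraction R}) : exists n, exists2 d : R, d != 0 & x = n%:F / d%:F.
Proof.
elim/quotW: x => x; exists x.1, x.2; first exact: denom_ratioP.
apply: (canRL (mulfK _)); first by rewrite tofrac_eq0 denom_ratioP.
unlock FracField.tofrac; rewrite -[LHS]FracField.pi_mul; apply/eqmodP.
rewrite /= /FracField.mulf /= !numden_Ratio ?oner_eq0 ?mulr1 ?denom_ratioP //.
by rewrite FracField.equivfE !numden_Ratio ?oner_eq0 ?denom_ratioP // mulr1 mulrC.
Qed.

End Fractions.

Section PrimRoots.
Variable K : numClosedFieldType.

Lemma closed_prim_root n : (0 < n)%N -> exists z : K, n.-primitive_root z.
Proof.
move=> n0; pose p : {poly K} := 'X^n - 1.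
have [rs def_p] := closed_field_poly_normal p.
have p_mon : lead_coef p = 1 by rewrite lead_coefXnsubC.
rewrite p_mon scale1r in def_p.
have sz : size rs = n.
  by have := size_XnsubC (1 : K) n0; rewrite -/p def_p size_prod_XsubC => -[].
have : has n.-primitive_root rs.
  apply: has_prim_root => //; last by rewrite sz.
    apply/allP => z zrs; rewrite -root_prod_XsubC -def_p in zrs.
    by move: zrs; rewrite rootE !hornerE subr_eq0 unity_rootE.
  rewrite -separable_prod_XsubC -def_p; apply: separable_Xn_sub_1.
  by rewrite pnatr_eq0 -lt0n.
by case/hasP => z _ prz; exists z.
Qed.

End PrimRoots.


Section KummerExponents.
Variables (D : idomainType) (s : nat) (p c : 'I_s -> D).
Hypothesis factD : factorial_domain D.
Hypothesis prp : forall i, prime_elt (p i).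
Hypothesis p_ndiv_c : forall i k, ~ divides (p i) (c k).
Hypothesis p_ndiv_p : forall i k, i != k -> ~ divides (p i) (p k).

Let f i := p i * c i.

(** Compare multiplicities of [p i]: it occurs once in [f i] and in no other [f k], while [g ^+ n]
    contributes a multiple of [n]. *)
Lemma kummer_exponents n (g : {fraction D}) (a b : 'I_s -> nat) : (0 < n)%N ->
  g ^+ n * \prod_i (f i)%:F ^+ b i = \prod_i (f i)%:F ^+ a i ->
  forall i, a i = b i %[mod n].
Proof.
have f0 i : f i != 0.
  rewrite mulf_neq0 //; first by case: (prp i).
  by apply/eqP => ci0; apply: (@p_ndiv_c i i); rewrite ci0; exact: divides0.
move=> n0 eq_g i; have prl := prp i.
have [x [y y0 def_g]] := frac_quotient g.
have def_xy : x ^+ n * \prod_k f k ^+ b k = y ^+ n * \prod_k f k ^+ a k.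
  apply/eqP; rewrite -tofrac_eq !rmorphM !rmorphXn !rmorph_prod /=.
  under eq_bigr do rewrite rmorphXn.
  under [X in _ == _ * X]eq_bigr do rewrite rmorphXn.
  rewrite -eq_g def_g exprMn exprVn mulrA [X in _ == X * _]mulrC divfK //.
  by rewrite expf_neq0 // tofrac_eq0.
have prod0 (e : 'I_s -> nat) : \prod_k f k ^+ e k != 0.
  by apply/prodf_neq0 => k _; rewrite expf_neq0.
have x0 : x != 0.
  apply: contraNneq (prod0 a) => xz; move/eqP: def_xy.
  by rewrite xz expr0n gtn_eqF // mul0r eq_sym mulf_eq0 expf_eq0 (negPf y0) andbF.
have [k [x' [def_x nx]]] := prime_split factD prl x0.
have [l [y' [def_y ny]]] := prime_split factD prl y0.
have nexp (z : D) e : ~ divides (p i) z -> ~ divides (p i) (z ^+ e).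
  by move=> nz /(prime_div_exp prl).
have split_prod (e : 'I_s -> nat) :
    exists2 z, \prod_k f k ^+ e k = p i ^+ e i * z & ~ divides (p i) z.
  exists (c i ^+ e i * \prod_(k | k != i) f k ^+ e k).
    by rewrite (bigD1 i) //= {1}/f exprMn mulrA.
  apply: (prime_ndivM prl); first exact/nexp/p_ndiv_c.
  rewrite -big_filter => /(prime_div_prod prl)[k'].
  rewrite mem_filter => /andP[nk _]; apply/nexp/(prime_ndivM prl) => //.
  by apply: p_ndiv_p; rewrite eq_sym.
have [za def_a nza] := split_prod a; have [zb def_b nzb] := split_prod b.
have : p i ^+ (k * n + b i) * (x' ^+ n * zb) = p i ^+ (l * n + a i) * (y' ^+ n * za).
  move: def_xy; rewrite def_x def_y def_a def_b !exprMn -!exprM !exprD => eq_xy.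
  by rewrite mulrACA eq_xy mulrACA.
move/(prime_exp_inj prl (prime_ndivM prl (nexp _ _ nx) nzb) (prime_ndivM prl (nexp _ _ ny) nza)).
by move/(congr1 (modn^~ n)); rewrite !modnMDl.
Qed.

End KummerExponents.

(* [mx_dom] stands for the polynomial ring over [K[y]] in the variables [x_j] with [P j];
   [mx_mon] ignores the exponents at the other indices. *)
Record mono_ext (K : fieldType) (N q : nat) (P : pred 'I_N) := MonoExt {
  mx_dom : idomainType;
  mx_cst : {rmorphism {mpoly K[q]} -> mx_dom};
  mx_mon : 'X_{1..N} -> mx_dom;
  mx_factorial : factorial_domain mx_dom;
  mx_prime : forall h, prime_elt h -> prime_elt (mx_cst h);
  mx_divides : forall g h, divides (mx_cst g) (mx_cst h) -> divides g h;
  mx_ndiv_mon : forall h m, prime_elt h -> ~ divides (mx_cst h) (mx_mon m);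
  mx_mon0 : mx_mon 0%MM = 1;
  mx_monD : forall m1 m2, mx_mon (m1 + m2)%MM = mx_mon m1 * mx_mon m2;
  mx_mon_ext : forall m1 m2 : 'X_{1..N}, (forall j, P j -> m1 j = m2 j) -> mx_mon m1 = mx_mon m2;
  mx_free : forall (T : eqType) (r : seq T) (h : T -> {mpoly K[q]}) (mu : T -> 'X_{1..N}),
    uniq r -> {in r &, forall e e', (forall j, P j -> mu e j = mu e' j) -> e = e'} ->
    \sum_(e <- r) mx_cst (h e) * mx_mon (mu e) = 0 ->
    forall e, e \in r -> h e = 0;
  mx_span : forall d, exists r : seq ({mpoly K[q]} * 'X_{1..N}),
    (forall x, x \in r -> forall j, ~~ P j -> x.2 j = 0%N) /\
    d = \sum_(x <- r) mx_cst x.1 * mx_mon x.2 }.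

Section Embedding.
Variables (K : numClosedFieldType) (N s q : nat) (B : block_data K N s q).
Variable tau : 'I_s -> 'I_N.
Hypothesis tauK : forall i, blk B (tau i) = i.
Variable X : mono_ext K q (fun j => j != tau (blk B j)).

Local Notation bet := (blk B).
Local Notation lam := (wexp B).
Local Notation S := {mpoly K[N]}.
Local Notation Y := {mpoly K[q]}.
Local Notation D := (mx_dom X).
Local Notation Q := {fraction D}.
Local Notation cst := (mx_cst X).
Local Notation mon := (mx_mon X).

Local Notation off j := (j != tau (bet j)).
Local Notation ord_ i := (lam (tau i)).

Definition offmon (m : 'X_{1..N}) : 'X_{1..N} := [multinom (off j * m j)%N | j < N].

Lemma mon_neq0 m : mon m != 0.
Proof.
apply/eqP => m0; have /eqP := oner_neq0 Y; apply.
apply: (@mx_free _ _ _ _ X _ [:: tt] (fun=> 1) (fun=> m) _ _ _ tt) => //; first by move=> [] [].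
by rewrite big_seq1 m0 mulr0.
Qed.

Lemma cst_eq0 h : (cst h == 0) = (h == 0).
Proof.
apply/eqP/eqP => [h0|->]; last exact: rmorph0.
apply: (@mx_free _ _ _ _ X _ [:: tt] (fun=> h) (fun=> 0%MM) _ _ _ tt) => //; first by move=> [] [].
by rewrite big_seq1 h0 mul0r.
Qed.

Lemma mx_monMn m k : mon (m *+ k)%MM = mon m ^+ k.
Proof.
by elim: k => [|k IHk]; rewrite ?mulm0n ?mx_mon0 // mulmS mx_monD IHk exprS.
Qed.

Lemma mx_monE m : mon m = \prod_j mon U_(j)%MM ^+ m j.
Proof.
rewrite [in LHS](multinomUE_id m) (big_morph mon (@mx_monD _ _ _ _ X) (mx_mon0 X)).
by apply: eq_bigr => j _; rewrite mx_monMn.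
Qed.

(** Once the variables off the section are sent to the inverses of the [x_j], the relation
    [t_i = ell_i(y)] forces this value for the power of the chosen variable of block [i]. *)
Definition frad (i : 'I_s) : D := cst (ell B i) * mon (offmon (tm B i)).

Lemma frad_neq0 i : frad i != 0.
Proof. by rewrite mulf_neq0 ?cst_eq0 ?ell_neq0 ?mon_neq0. Qed.

Lemma frad_kummer n (g : Q) (a b : 'I_s -> nat) : (0 < n)%N ->
  g ^+ n * \prod_i (frad i)%:F ^+ b i = \prod_i (frad i)%:F ^+ a i ->
  forall i, a i = b i %[mod n].
Proof.
apply: kummer_exponents => [|i|i k|i k nik].
- exact: mx_factorial.
- exact/mx_prime/prime_ell.
- exact/mx_ndiv_mon/prime_ell.
by move/mx_divides; exact: ell_ndiv.
Qed.

Definition const_frac : K -> Q := @FracField.tofrac D \o cst \o @mpolyC q K.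

HB.instance Definition _ := GRing.RMorphism.copy const_frac
  (@FracField.tofrac D \o cst \o @mpolyC q K).

Lemma Q_prim_root n : (0 < n)%N -> exists z : Q, n.-primitive_root z.
Proof.
case/(@closed_prim_root K) => z prz; exists (const_frac z).
by rewrite fmorph_primitive_root.
Qed.

Lemma Q_pchar : [pchar Q] =i pred0.
Proof. by move=> p; rewrite (fmorph_pchar const_frac) pchar_num. Qed.

Lemma frad_roots : exists (L : splittingFieldType Q) (u : 'I_s -> L),
  forall i, u i ^+ ord_ i = (frad i)%:F%:A.
Proof.
apply: radical_extension => [i|i|]; first exact: wexp_gt0.
  by rewrite tofrac_eq0 frad_neq0.
exact: Q_prim_root.
Qed.

End Embedding.

(** The section [ke_tau] is part of the data because normality compares embeddings for different
    sections. The field is normal over the fraction field and contains the roots, but may be larger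
    than what they generate. *)
Record kummer_ext (K : numClosedFieldType) (N s q : nat) (B : block_data K N s q) := KummerExt {
  ke_tau : 'I_s -> 'I_N;
  ke_tauK : forall i, blk B (ke_tau i) = i;
  ke_ext : mono_ext K q (fun j => j != ke_tau (blk B j));
  ke_field : splittingFieldType {fraction (mx_dom ke_ext)};
  ke_root : 'I_s -> ke_field;
  ke_rootE : forall i, ke_root i ^+ wexp B (ke_tau i) = (frad ke_ext i)%:F%:A }.

Section KummerEmbedding.
Variables (K : numClosedFieldType) (N s q : nat) (B : block_data K N s q).
Variable E : kummer_ext B.

Local Notation bet := (blk B).
Local Notation lam := (wexp B).
Local Notation S := {mpoly K[N]}.
Local Notation Y := {mpoly K[q]}.
Local Notation X := (ke_ext E).
Local Notation D := (mx_dom X).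
Local Notation Q := {fraction D}.
Local Notation cst := (mx_cst X).
Local Notation mon := (mx_mon X).
Local Notation tau := (ke_tau E).
Local Notation tauK := (ke_tauK E).
Local Notation L := (ke_field E).
Local Notation u := (ke_root E).
Local Notation uE := (ke_rootE E).
Local Notation off j := (j != tau (bet j)).
Local Notation ord_ i := (lam (tau i)).
Local Notation offmon := (offmon B tau).
Local Notation frad := (frad X).

Definition base_emb : D -> L := in_alg L \o @FracField.tofrac D.

HB.instance Definition _ := GRing.RMorphism.copy base_emb (in_alg L \o @FracField.tofrac D).

Lemma base_emb_eq0 x : (base_emb x == 0) = (x == 0).
Proof. by rewrite /base_emb /= scaler_eq0 oner_eq0 orbF tofrac_eq0. Qed.

Lemma root_base i : u i ^+ ord_ i = base_emb (frad i).
Proof. exact: uE. Qed.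

(* Sending [X_j] to [1 / x_j] lets the root of block [i] absorb the variables that were not chosen. *)
Definition Phi_var j : L := if off j then (base_emb (mon U_(j)%MM))^-1 else ke_root E (bet j).

Definition Phi : S -> L := mmap (base_emb \o cst \o @mpolyC q K) Phi_var.

HB.instance Definition _ := GRing.RMorphism.copy Phi
  (mmap (base_emb \o cst \o @mpolyC q K) Phi_var).

Arguments Phi : simpl never.

Lemma PhiC a : Phi a%:MP = base_emb (cst a%:MP).
Proof. exact: mmapC. Qed.

Lemma PhiZ a p : Phi (a *: p) = base_emb (cst a%:MP) * Phi p.
Proof. by rewrite -mul_mpolyC rmorphM /= PhiC. Qed.

Lemma PhiX m : Phi 'X_[m] = (base_emb (mon (offmon m)))^-1 * \prod_i u i ^+ m (tau i).
Proof.
rewrite /Phi mmapX /mmap1 (bigID (fun j => off j)) /=; congr (_ * _).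
  rewrite [in RHS]mx_monE rmorph_prod -prodfV [RHS](bigID (fun j => off j)) /=.
  rewrite [X in _ = _ * X]big1 ?mulr1 => [|j /negPf nj]; last first.
    by rewrite mnmE nj mul0n expr0 rmorph1 invr1.
  by apply: eq_bigr => j oj; rewrite /Phi_var oj mnmE oj mul1n exprVn rmorphXn.
rewrite (reindex_onto tau bet) => [|j /negPn/eqP <- //].
apply: eq_big => [i|i _]; first by rewrite tauK !eqxx.
by rewrite /Phi_var tauK eqxx.
Qed.

Lemma Phi_tm i : Phi 'X_[tm B i] = base_emb (cst (ell B i)).
Proof.
rewrite PhiX (bigD1 i) //= big1 ?mulr1 => [|k nki]; last first.
  by rewrite !mnmE tauK (negPf nki) expr0.
rewrite !mnmE tauK eqxx mul1n root_base /frad rmorphM /= mulrC mulfK //.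
by rewrite base_emb_eq0 mon_neq0.
Qed.

Lemma Phi_ysub h : Phi (ysub B h) = base_emb (cst h).
Proof.
have := @mpoly_morph_ext q K L (Phi \o ysub B) (base_emb \o cst); apply=> [a|b] /=.
  by rewrite ysubC PhiC.
rewrite ysubX /yhat rmorph_sum /=.
rewrite [in RHS](var_ell B b) !rmorph_sum /=; apply: eq_bigr => i _.
by rewrite PhiZ Phi_tm -!rmorphM /= -mul_mpolyC rmorphM.
Qed.

Lemma Phi_blockI p : blockI B p -> Phi p = 0.
Proof.
move: p; apply: gen_ideal_sub => [|_ [v [Av0 ->]]]; first exact: ker_ideal.
rewrite rmorph_sum /=; under eq_bigr do rewrite PhiZ Phi_tm -rmorphM /= -rmorphM /= mul_mpolyC.
by rewrite -!rmorph_sum /= (ell_relation Av0) !rmorph0.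
Qed.

End KummerEmbedding.

Section KummerBasis.
Variables (K : numClosedFieldType) (N s q : nat) (B : block_data K N s q).
Variable E : kummer_ext B.

Local Notation bet := (blk B).
Local Notation lam := (wexp B).
Local Notation S := {mpoly K[N]}.
Local Notation Y := {mpoly K[q]}.
Local Notation X := (ke_ext E).
Local Notation D := (mx_dom X).
Local Notation Q := {fraction D}.
Local Notation cst := (mx_cst X).
Local Notation mon := (mx_mon X).
Local Notation tau := (ke_tau E).
Local Notation tauK := (ke_tauK E).
Local Notation L := (ke_field E).
Local Notation u := (ke_root E).
Local Notation uE := (ke_rootE E).
Local Notation off j := (j != tau (bet j)).
Local Notation ord_ i := (lam (tau i)).
Local Notation offmon := (offmon B tau).
Local Notation frad := (frad X).
Local Notation iota := (@base_emb _ _ _ _ _ E).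
Local Notation Phi := (Phi E).

Definition expo := {dffun forall i : 'I_s, 'I_(ord_ i)}.

Definition kmon (a : expo) : L := \prod_i u i ^+ a i.

Definition emod (m : 'I_s -> nat) : expo :=
  [ffun i => Ordinal (ltn_pmod (m i) (wexp_gt0 B (tau i)))].

Definition ediv (m : 'I_s -> nat) (i : 'I_s) : nat := (m i %/ ord_ i)%N.

(** A common exponent that carries every Kummer monomial into the base field. *)
Definition rad_exp := (\prod_i ord_ i)%N.

Lemma rad_exp_gt0 : (0 < rad_exp)%N.
Proof. by apply: prodn_gt0 => i; exact: wexp_gt0. Qed.

Lemma ord_dvd i : (ord_ i %| rad_exp)%N.
Proof. by rewrite /rad_exp (bigD1 i) //= dvdn_mulr. Qed.

Lemma root_monomial (m : 'I_s -> nat) :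
  \prod_i u i ^+ m i = iota (\prod_i frad i ^+ ediv m i) * kmon (emod m).
Proof.
rewrite rmorph_prod -big_split; apply: eq_bigr => i _ /=.
by rewrite rmorphXn /= -root_base -exprM ffunE /= -exprD mulnC -divn_eq.
Qed.

Lemma root_neq0 i : u i != 0.
Proof.
have : u i ^+ ord_ i != 0 by rewrite root_base base_emb_eq0 frad_neq0.
by rewrite expf_eq0 wexp_gt0.
Qed.

Lemma kmon_neq0 a : kmon a != 0.
Proof. by apply/prodf_neq0 => i _; rewrite expf_neq0 // root_neq0. Qed.

Lemma iota_base x : iota x \in 1%VS.
Proof. by rewrite /base_emb /= rpredZ // mem1v. Qed.

Lemma kmonX a : kmon a ^+ rad_exp = iota (\prod_i frad i ^+ (a i * (rad_exp %/ ord_ i))).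
Proof.
rewrite /kmon -prodrXl rmorph_prod; apply: eq_bigr => i _ /=.
by rewrite rmorphXn /= -root_base -!exprM; congr (_ ^+ _); rewrite mulnCA mulnC [in RHS]muln_divA ?ord_dvd // mulnC mulKn ?wexp_gt0.
Qed.

(** If the ratio is [c] in [Q], its [rad_exp]-th power is an identity between monomials in the
    radicands, so the scaled exponents agree modulo [rad_exp]; the bounds [a i < ord_ i] turn the
    congruence into equality. *)
Lemma kmon_indep a b : kmon a / kmon b \in 1%VS -> a = b.
Proof.
case/vlineP => c def_c; have def_a : kmon a = c%:A * kmon b by rewrite -def_c divfK // kmon_neq0.
have toF (e : 'I_s -> nat) : \prod_i (frad i)%:F ^+ e i = (\prod_i frad i ^+ e i)%:F.
  by rewrite rmorph_prod; apply: eq_bigr => i _; rewrite rmorphXn.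
have eq_exp : c ^+ rad_exp * \prod_i (frad i)%:F ^+ (b i * (rad_exp %/ ord_ i)) =
    \prod_i (frad i)%:F ^+ (a i * (rad_exp %/ ord_ i)).
  apply: (fmorph_inj (in_alg L)); rewrite rmorphM rmorphXn !toF.
  by have := kmonX a; rewrite def_a exprMn kmonX => ->.
have := frad_kummer rad_exp_gt0 eq_exp => eq_mod.
apply/ffunP => i; apply: val_inj; apply/eqP => /=.
have d_gt0 : (0 < rad_exp %/ ord_ i)%N by rewrite divn_gt0 ?wexp_gt0 // dvdn_leq ?rad_exp_gt0 ?ord_dvd.
rewrite -(eqn_pmul2r d_gt0); have := eq_mod i.
have lt_n (e : expo) : (e i * (rad_exp %/ ord_ i) < rad_exp)%N.
  by rewrite -[X in (_ < X)%N](divnK (ord_dvd i)) mulnC ltn_pmul2l.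
by rewrite !modn_small ?lt_n // => ->.
Qed.

Lemma kmon_radical a : kmon a ^+ rad_exp \in 1%VS.
Proof. by rewrite kmonX iota_base. Qed.

Lemma kmon_free (c : expo -> L) : (forall a, c a \in 1%VS) ->
  \sum_a c a * kmon a = 0 -> forall a, c a = 0.
Proof.
apply: (radical_free (Q_pchar X) (Q_prim_root X) rad_exp_gt0 kmon_neq0 kmon_radical kmon_indep).
Qed.

(** A common denominator: [Phi 'X_[e]] contains [x_j] to the power [- e j] for [j] off the section,
    and multiplying by [x_j ^ k] for all these [j] leaves the monomial [cofm k e] when no [e j]
    exceeds [k]. *)
Definition bigm (k : nat) : 'X_{1..N} := [multinom (off j * k)%N | j < N].

Definition cofm (k : nat) (e : 'X_{1..N}) : 'X_{1..N} := [multinom (off j * (k - e j))%N | j < N].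

Lemma frad_prod (c : 'I_s -> nat) :
  \prod_i frad i ^+ c i = cst (\prod_i ell B i ^+ c i) * mon (offmon (tsum B c)).
Proof.
rewrite (_ : offmon (tsum B c) = (\sum_i offmon (tm B i) *+ c i)%MM); last first.
  apply/mnmP => j; rewrite mnm_sumE (bigD1 (bet j)) //= big1 ?addn0 => [|i ni].
    by rewrite mulmnE !mnmE eqxx; lia.
  by rewrite mulmnE !mnmE [bet j == i]eq_sym (negPf ni) mul0n muln0 mul0n.
rewrite (big_morph mon (@mx_monD _ _ _ _ X) (mx_mon0 X)) rmorph_prod -big_split.
by apply: eq_bigr => i _ /=; rewrite exprMn mx_monMn rmorphXn.
Qed.

Lemma Phi_reduced k (e : 'X_{1..N}) : (forall j, (e j <= k)%N) ->
  iota (mon (bigm k)) * Phi 'X_[e] =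
  iota (cst (\prod_i ell B i ^+ ediv (fun i => e (tau i)) i) *
        mon (cofm k e + offmon (tsum B (ediv (fun i => e (tau i)))))%MM) *
  kmon (emod (fun i => e (tau i))).
Proof.
move=> le_k; rewrite PhiX root_monomial frad_prod mx_monD !rmorphM.
rewrite (_ : bigm k = cofm k e + offmon e)%MM; last first.
  by apply/mnmP => j; rewrite mnmDE !mnmE -mulnDr subnK.
rewrite mx_monD rmorphM /= [LHS]mulrA mulfK ?base_emb_eq0 ?mon_neq0 //.
by rewrite !mulrA; congr (_ * _ * _); rewrite mulrC.
Qed.

(** Off the section the hypothesis compares [e j] and [e' j] up to multiples of [lam j]; at the
    chosen variables equal remainders do the same. Together, [e] and [e'] agree after adding powers
    of the [t_i], so their reductions coincide. *)
Lemma cofm_inj k (e e' : 'X_{1..N}) : red B e = e -> red B e' = e' ->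
  (forall j, (e j <= k)%N) -> (forall j, (e' j <= k)%N) ->
  emod (fun i => e (tau i)) = emod (fun i => e' (tau i)) ->
  (forall j, off j ->
    (cofm k e + offmon (tsum B (ediv (fun i => e (tau i)))))%MM j =
    (cofm k e' + offmon (tsum B (ediv (fun i => e' (tau i)))))%MM j) -> e = e'.
Proof.
move=> red_e red_e' le_e le_e' eq_mod eq_off.
set a := ediv _ in eq_off; set a' := ediv (fun i => e' _) in eq_off.
suff eq_t : (e + tsum B a' = e' + tsum B a)%MM.
  by rewrite -red_e -red_e' -(red_tsum B e a') eq_t red_tsum.
apply/mnmP => j; rewrite !mnmDE !mnmE; have [oj|/negPn/eqP def_j] := boolP (off j).
  have := eq_off j oj; rewrite !mnmDE !mnmE oj !mul1n.
  by move: (le_e j) (le_e' j); lia.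
have := congr1 (fun f : expo => f (bet j) : nat) eq_mod; rewrite !ffunE /= => eq_m.
rewrite /a /a' /ediv -def_j in eq_m *.
have := divn_eq (e j) (lam j); have := divn_eq (e' j) (lam j); lia.
Qed.

(** After clearing denominators the sum is sorted by Kummer monomials. Each coefficient vanishes by
    [kmon_free], and within one coefficient the monomials in the [x_j] are distinct by
    [cofm_inj]. *)
Lemma Phi_reduced_free (r : seq 'X_{1..N}) (h : 'X_{1..N} -> Y) : uniq r ->
  (forall e, e \in r -> red B e = e) ->
  \sum_(e <- r) iota (cst (h e)) * Phi 'X_[e] = 0 -> forall e, e \in r -> h e = 0.
Proof.
move=> Ur red_r sum0; pose k := (\sum_(e <- r) mdeg e)%N.
have le_k e : e \in r -> forall j, (e j <= k)%N.
  move=> er j; apply: leq_trans (mnm_le_mdeg e j) _.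
  by rewrite /k (big_rem e) //= leq_addr.
pose al (e : 'X_{1..N}) := emod (fun i => e (tau i)).
pose dv (e : 'X_{1..N}) := ediv (fun i => e (tau i)).
pose mu (e : 'X_{1..N}) := (cofm k e + offmon (tsum B (dv e)))%MM.
pose H (e : 'X_{1..N}) := h e * \prod_i ell B i ^+ dv e i.
pose C (a : expo) := iota (\sum_(e <- r | al e == a) cst (H e) * mon (mu e)).
have C0 : \sum_a C a * kmon a = 0.
  transitivity (iota (mon (bigm k)) * \sum_(e <- r) iota (cst (h e)) * Phi 'X_[e]).
    rewrite mulr_sumr (partition_big al predT) //=; apply: eq_bigr => a _.
    rewrite /C rmorph_sum mulr_suml big_seq_cond [RHS]big_seq_cond.
    apply: eq_bigr => e /andP[er /eqP def_a].
    rewrite mulrCA Phi_reduced; last exact: le_k.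
    by rewrite -/(al e) def_a /H !rmorphM /= !mulrA.
  by rewrite sum0 mulr0.
move=> e er; have := kmon_free (fun a => iota_base _) C0 (al e) => /eqP.
rewrite /C base_emb_eq0 -big_filter => /eqP/(@mx_free _ _ _ _ X) sumF.
have : H e = 0.
  apply: sumF; [exact: filter_uniq| |by rewrite mem_filter eqxx].
  move=> e1 e2; rewrite !mem_filter => /andP[/eqP a1 r1] /andP[/eqP a2 r2] eq_mu.
  apply: (cofm_inj (k := k)); rewrite ?red_r //; first [exact: le_k | by [] | idtac].
  by rewrite -/(al e1) -/(al e2) a1 a2.
move/eqP; rewrite mulf_eq0 => /orP[/eqP //|].
suff /negPf -> : \prod_i ell B i ^+ dv e i != 0 by [].
by apply/prodf_neq0 => i _; rewrite expf_neq0 // ell_neq0.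
Qed.

Lemma Phi_kernel p : Phi p = 0 -> blockI B p.
Proof.
move=> Phi0; have := Phi_blockI E (blockI_normal B p); rewrite rmorphB /= Phi0 sub0r.
move/eqP; rewrite oppr_eq0 rmorph_sum /= => /eqP sum0.
set r := undup _ in sum0; apply/blockIP => e.
have NF0 := @Phi_reduced_free r (fun e => NF B e p) (undup_uniq _).
have [er|ner] := boolP (e \in r).
  apply: NF0 => //.
    by move=> e'; rewrite mem_undup => /mapP[m _ ->]; exact: red_red.
  by rewrite -[RHS]sum0; apply: eq_bigr => e' _; rewrite rmorphM /= Phi_ysub.
rewrite /NF /mlin big_seq big1 // => m mp; rewrite ifN ?scaler0 //.
by apply: contraNneq ner => <-; rewrite mem_undup map_f.
Qed.

Lemma blockI_prime : prime_ideal (blockI B).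
Proof.
split; first exact: blockI_ideal.
  by move/Phi_blockI => /(_ E)/eqP; rewrite rmorph1 oner_eq0.
move=> a b /Phi_blockI => /(_ E)/eqP; rewrite rmorphM /= mulf_eq0.
by case/orP => /eqP/Phi_kernel; [left|right].
Qed.

End KummerBasis.


(** * Normality *)

Section IntegrallyClosed.
Variable D : idomainType.
Hypothesis factD : factorial_domain D.

(** Multiplying the monic equation of [n / d] by [d ^ k] leaves [n ^ k] as the only term without a
    factor [d]. *)
Lemma integral_denominator (n d : D) : d != 0 ->
  integralOver (@FracField.tofrac D) (n%:F / d%:F) -> exists k, divides d (n ^+ k).
Proof.
move=> d0 [p pmon rootp]; exists (size p).-1; set k := (size p).-1.
have szp : size p = k.+1 by rewrite prednK // size_poly_gt0 monic_neq0.
have : (\sum_(i < k.+1) p`_i * n ^+ i * d ^+ (k - i))%:F = 0.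
  have := rootp; rewrite rootE horner_coef size_map_inj_poly ?rmorph0 //; last first.
    by move=> x y /eqP; rewrite tofrac_eq => /eqP.
  rewrite szp => /eqP /(congr1 (fun x => x * d%:F ^+ k)); rewrite mul0r mulr_suml => <-.
  rewrite rmorph_sum; apply: eq_bigr => -[i /= lt_i] _.
  rewrite coef_map !rmorphM !rmorphXn /= -!mulrA; congr (_ * _).
  rewrite exprMn -!mulrA; congr (_ * _).
  by rewrite -{2}(subnKC (leq_trans lt_i (leqnn _) : (i <= k)%N)) exprD exprVn mulKf // expf_neq0 // tofrac_eq0.
move/eqP; rewrite tofrac_eq0 big_ord_recr /= subnn expr0 mulr1.
have -> : p`_k = 1 by have /monicP := pmon; rewrite lead_coefE.
rewrite mul1r addrC addr_eq0 => /eqP ->; rewrite -mulN1r; apply: dividesMl.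
apply: (big_ind (divides d)) => [||[i /= lt_i] _]; [exact: divides0|exact: dividesD|].
by apply: dividesMl; rewrite -(subnSK lt_i) exprSr; exact/dividesMl/dividesxx.
Qed.

Lemma factorial_integrally_closed (x : {fraction D}) :
  integralOver (@FracField.tofrac D) x -> exists y, x = y%:F.
Proof.
have [n [d d0 ->]] := frac_quotient x; have [v [ps [vU prps ->]]] := factD d0.
elim: ps n prps => [|p ps IHps] n prps.
  rewrite big_nil mulr1 => _; exists (n / v).
  by rewrite rmorphM /= rmorphV.
have prp : prime_elt p by apply: prps; rewrite mem_head.
have p0 : p != 0 by case: prp.
have ps0 : \prod_(r <- ps) r != 0.
  rewrite prodf_seq_neq0; apply/allP => r rps; apply/implyP => _.
  by have [] : prime_elt r by apply: prps; rewrite inE rps orbT.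
have v0 : v != 0 by exact: unitr_neq0.
rewrite big_cons => int_x; have [|k] := integral_denominator _ int_x; first by rewrite !mulf_neq0.
move=> dvd_n; have [m def_n] : divides p n.
  apply: (prime_div_exp (n := k) prp); apply: divides_trans dvd_n.
  by exists (v * \prod_(r <- ps) r); ring.
have cancel_p : n%:F / (v * (p * \prod_(r <- ps) r))%:F = m%:F / (v * \prod_(r <- ps) r)%:F.
  rewrite def_n mulrCA [in LHS]rmorphM [X in _ / X]rmorphM /= [X in _ / X]mulrC.
  by rewrite -mulf_div divff ?mulr1 // tofrac_eq0.
rewrite cancel_p; apply: IHps; last by rewrite -cancel_p.
by move=> r rps; apply: prps; rewrite inE rps orbT.
Qed.

Variable T : D -> Prop.
Hypothesis T1 : T 1.
Hypothesis TM : forall x y, T x -> T y -> T (x * y).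

(** [c ^+ n * F] is integral, hence lies in [D]. A prime that remains in the denominator of [c]
    occurs there to the power [n], so its [n]-th power divides [F]; this is excluded unless the
    prime divides an element of [T], and then that element clears it. *)
Lemma radical_denominator n (F : D) (c : {fraction D}) : (0 < n)%N ->
  (forall p, prime_elt p -> (forall m, T m -> ~ divides p m) -> ~ divides (p ^+ n) F) ->
  integralOver (@FracField.tofrac D) (c ^+ n * F%:F) ->
  exists m y, T m /\ c * m%:F = y%:F.
Proof.
move=> n0 F_free; have [x [d d0 ->]] := frac_quotient c; have [v [ps [vU prps ->]]] := factD d0.
elim: ps x prps => [|p ps IHps] x prps.
  rewrite big_nil mulr1 => _; exists 1, (x / v); split=> //.
  by rewrite rmorph1 mulr1 rmorphM /= rmorphV.
have prp : prime_elt p by apply: prps; rewrite mem_head.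
have p0 : p != 0 by case: prp.
have {}IHps := IHps _ (fun r rps => prps r (@mem_behead _ (p :: ps) r rps)).
have ps0 : \prod_(r <- ps) r != 0.
  rewrite prodf_seq_neq0; apply/allP => r rps; apply/implyP => _.
  by have [] : prime_elt r by apply: prps; rewrite inE rps orbT.
have v0 : v != 0 by exact: unitr_neq0.
set e := v * \prod_(r <- ps) r in IHps *.
have e0 : e != 0 by rewrite mulf_neq0.
rewrite big_cons (_ : v * _ = e * p); last by rewrite /e; ring.
have cancel_p y : (y * p)%:F / (e * p)%:F = y%:F / e%:F.
  by rewrite !rmorphM /= -mulf_div divff ?mulr1 // tofrac_eq0.
have [[m1 [Tm1 [k def_m1]]]|nT] := boolp.pselect (exists m, T m /\ divides p m).
  move=> int_x; have def_xk : x%:F / (e * p)%:F * m1%:F = (x * k)%:F / e%:F.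
    by rewrite -cancel_p def_m1 mulrAC -rmorphM /= mulrA.
  have int_m1 : integralOver (@FracField.tofrac D) (m1%:F ^+ n).
    by have := integral_id (@FracField.tofrac D) (m1 ^+ n); rewrite rmorphXn.
  have [|m [y [Tm def_y]]] := IHps (x * k).
    rewrite -def_xk exprMn -mulrA [_ ^+ n * F%:F]mulrC mulrA.
    exact: integral_mul int_x int_m1.
  exists (m1 * m), y; split; first exact: TM.
  by rewrite (tofracM m1 m) mulrA def_xk.
move=> int_x; have [y def_y] := factorial_integrally_closed int_x.
have def_xF : x ^+ n * F = y * (e * p) ^+ n.
  apply/eqP; rewrite -tofrac_eq (tofracM y) -def_y (tofracM (x ^+ n)) !tofracXn.
  rewrite exprMn exprVn [X in _ == X]mulrAC divfK //.
  by rewrite expf_neq0 // tofrac_eq0 mulf_neq0.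
have [k def_x] : divides p x.
  apply: boolp.contrapT => npx; apply: (F_free p prp).
    by move=> m Tm pm; apply: nT; exists m.
  apply: (prime_pow_cancel (b := x ^+ n) prp).
    by move/(prime_div_exp prp).
  by exists (y * e ^+ n); rewrite mulrC def_xF exprMn mulrA.
by rewrite def_x cancel_p in int_x *; exact: IHps.
Qed.

End IntegrallyClosed.

Section LocalNormality.
Variables (K : numClosedFieldType) (N s q : nat) (B : block_data K N s q).
Variable E : kummer_ext B.

Local Notation bet := (blk B).
Local Notation lam := (wexp B).
Local Notation S := {mpoly K[N]}.
Local Notation Y := {mpoly K[q]}.
Local Notation X := (ke_ext E).
Local Notation D := (mx_dom X).
Local Notation Q := {fraction D}.
Local Notation cst := (mx_cst X).
Local Notation mon := (mx_mon X).
Local Notation tau := (ke_tau E).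
Local Notation tauK := (ke_tauK E).
Local Notation L := (ke_field E).
Local Notation u := (ke_root E).
Local Notation uE := (ke_rootE E).
Local Notation off j := (j != tau (bet j)).
Local Notation ord_ i := (lam (tau i)).
Local Notation offmon := (offmon B tau).
Local Notation frad := (frad X).
Local Notation iota := (@base_emb _ _ _ _ _ E).
Local Notation Phi := (Phi E).

Local Notation km := (@kmon _ _ _ _ _ E).

(** The span of the Kummer monomials over the base field. As [L] may be larger, each element to be
    expanded in these monomials must be shown to lie here; closure under products and inverses makes
    the span a subfield. *)
Definition spanned (x : L) := exists c : expo E -> L,
  (forall a, c a \in 1%VS) /\ x = \sum_a c a * km a.

Lemma spannedD x y : spanned x -> spanned y -> spanned (x + y).
Proof.
case=> c [c1 ->] [d [d1 ->]]; exists (fun a => c a + d a); split=> [a|].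
  exact: rpredD.
by rewrite -big_split; apply: eq_bigr => a _; rewrite mulrDl.
Qed.

Lemma spanned0 : spanned 0.
Proof.
by exists (fun=> 0); split=> [a|]; rewrite ?rpred0 // big1 // => a _; rewrite mul0r.
Qed.

Lemma spanned_sum (I : Type) (r : seq I) (P : pred I) (F : I -> L) :
  (forall i, P i -> spanned (F i)) -> spanned (\sum_(i <- r | P i) F i).
Proof. by move=> spF; apply: big_ind => //; [exact: spanned0|exact: spannedD]. Qed.

Lemma spannedZ k x : k \in 1%VS -> spanned x -> spanned (k * x).
Proof.
move=> k1 [c [c1 ->]]; exists (fun a => k * c a); split=> [a|]; first exact: rpredM.
by rewrite mulr_sumr; apply: eq_bigr => a _; rewrite mulrA.
Qed.

Lemma spanned_kmon a : spanned (km a).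
Proof.
exists (fun b => (b == a)%:R); split=> [b|]; first by rewrite rpred_nat.
by rewrite (bigD1 a) //= eqxx mul1r big1 ?addr0 // => b /negPf ->; rewrite mul0r.
Qed.

Lemma spanned_root (m : 'I_s -> nat) : spanned (\prod_i u i ^+ m i).
Proof. by rewrite root_monomial; apply/spannedZ/spanned_kmon/iota_base. Qed.

Lemma spannedM x y : spanned x -> spanned y -> spanned (x * y).
Proof.
case=> c [c1 ->] [d [d1 ->]]; rewrite mulr_suml; apply: spanned_sum => a _.
rewrite mulr_sumr; apply: spanned_sum => b _; rewrite mulrACA.
apply: spannedZ; first exact: rpredM.
rewrite /kmon -big_split /=; under eq_bigr do rewrite -exprD.
exact: spanned_root.
Qed.

Lemma spanned1 : spanned 1.
Proof. by have := spanned_root (fun=> 0%N); rewrite big1. Qed.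

Lemma spanned_Phi p : spanned (Phi p).
Proof.
rewrite (mpolyE p) rmorph_sum; apply: spanned_sum => m _ /=.
rewrite PhiZ PhiX mulrA; apply/spannedZ/spanned_root.
by rewrite rpredM ?iota_base // rpredV iota_base.
Qed.

Lemma spanned_gal (g : gal_of {:L}) x : g \in 'Gal({:L} / 1)%g -> spanned x -> spanned (g x).
Proof.
move=> gG [c [c1 ->]]; rewrite rmorph_sum; apply: spanned_sum => a _ /=.
rewrite rmorphM /= (fixed_gal _ gG (c1 a)) ?subvf //.
have [k [k1 _] ->] := radical_twist (Q_prim_root X) (rad_exp_gt0 E) (kmon_neq0 a) (kmon_radical a) gG.
by apply/spannedZ/spannedZ/spanned_kmon.
Qed.

(** The norm of [x] lies in the base field and is [x] times its other conjugates, which stay in the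
    span. *)
Lemma spannedV x : x != 0 -> spanned x -> spanned x^-1.
Proof.
move=> x0 spx; pose y := galNorm 1 {:L} x.
have y0 : y != 0 by rewrite galNorm_eq0.
have y1 : y \in 1%VS by apply: mem_galNorm (memvf _); exact: galois_char0 (Q_pchar X).
have def_y : y = x * \prod_(g in 'Gal({:L} / 1)%g | g != 1%g) g x.
  by rewrite /y /galNorm (bigD1 1%g) ?group1 //= gal_id.
have -> : x^-1 = y^-1 * \prod_(g in 'Gal({:L} / 1)%g | g != 1%g) g x.
  apply: (mulfI y0); rewrite mulrA divff // mul1r def_y mulrAC divff ?mul1r //.
apply: spannedZ; first by rewrite rpredV.
apply: big_ind => [||g /andP[gG _]]; [exact: spanned1|exact: spannedM|exact: spanned_gal].
Qed.

Local Notation integral := (integralOver (base_emb (E := E))).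

Lemma integral_root i : integral (u i).
Proof.
exists ('X^(ord_ i) - (frad i)%:P); first by apply: monicXnsubC; exact: wexp_gt0.
by rewrite rmorphB /= map_polyXn map_polyC /= rootE !hornerE root_base subrr.
Qed.

Lemma integralX x n : integral x -> integral (x ^+ n).
Proof.
move=> intx; elim: n => [|n IHn]; first by rewrite expr0; exact: integral1.
by rewrite exprS; exact: integral_mul.
Qed.

Lemma integral_kmon a : integral (km a).
Proof.
apply: (big_ind integral) => [||i _]; [exact: integral1|exact: integral_mul|].
exact/integralX/integral_root.
Qed.

Lemma integral_Phi p : exists k0, forall k, (k0 <= k)%N -> integral (iota (mon (bigm E k)) * Phi p).
Proof.
exists (\sum_(m <- msupp p) mdeg m)%N => k le_k.
rewrite (mpolyE p) rmorph_sum mulr_sumr big_seq.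
apply: (big_ind integral) => [||m mp]; [exact: integral0|exact: integral_add|].
rewrite /= PhiZ mulrCA Phi_reduced => [|j].
  by do 2!(apply: integral_mul; first exact: integral_id); exact: integral_kmon.
apply: leq_trans (mnm_le_mdeg m j) (leq_trans _ le_k).
by rewrite (big_rem m) //= leq_addr.
Qed.

(** Up to a monomial the product is that of the [ell_i ^ a i]. A prime dividing no monomial is
    associated with at most one [ell_i], and then occurs only [a i < n] times. *)
Lemma frad_free n (a : 'I_s -> nat) p : (0 < n)%N -> (forall i, (a i < n)%N) -> prime_elt p ->
  (forall m, ~ divides p (mon m)) -> ~ divides (p ^+ n) (\prod_i frad i ^+ a i).
Proof.
move=> n0 lt_a prp np; rewrite frad_prod => /(prime_pow_cancel prp (np _)).
have pE k : prime_elt (cst (ell B k)) by apply/mx_prime/prime_ell.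
rewrite rmorph_prod; under eq_bigr do rewrite rmorphXn /=.
move=> pn; have : divides p (\prod_i cst (ell B i) ^+ a i).
  by apply: divides_trans pn; rewrite -(prednK n0) exprSr; exact/dividesMl/dividesxx.
case/(prime_div_prod prp) => i _ /(prime_div_exp prp)/(prime_div_prime prp (pE i))[v vU def_i].
have np' : ~ divides p (v ^+ a i * \prod_(k | k != i) cst (ell B k) ^+ a k).
  apply: (prime_ndivM prp); first by apply: prime_not_div_unit; rewrite ?unitrX.
  rewrite -big_filter => /(prime_div_prod prp)[k]; rewrite mem_filter => /andP[nk _].
  move=> /(prime_div_exp prp)/(prime_div_prime prp (pE k))[w wU def_k].
  have : divides (cst (ell B i)) (cst (ell B k)).
    by exists (w / v); rewrite def_k def_i mulrA divrK.
  by move/mx_divides; apply: ell_ndiv; rewrite eq_sym.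
move: pn; rewrite (bigD1 i) //= def_i exprMn -mulrA mulrCA => /(prime_pow_cancel prp np')[w].
have [p0 pU _] := prp.
rewrite -{1}[p ^+ a i]mul1r -(subnK (ltnW (lt_a i))) exprD mulrA => /(mulIf (expf_neq0 _ p0)) def1.
case/negP: pU; apply/unitrPr; exists (w * p ^+ (n - a i).-1).
by rewrite mulrCA -exprS prednK ?subn_gt0.
Qed.

(** Traces make each term [c a * km a] integral. Its [rad_exp]-th power is an integral element of
    [Q], a power of the coordinate times a monomial in the radicands, so [radical_denominator]
    applies with [T] the set of monomials. *)
Lemma spanned_integral_denominator x : spanned x -> integral x ->
  exists m (d : expo E -> D), x * iota (mon m) = \sum_a iota (d a) * km a.
Proof.
case=> c [c1 def_x] int_x.
have int_c : forall a, integral (c a * km a).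
  apply: (radical_coord_integral (Q_pchar X) (Q_prim_root X) (rad_exp_gt0 E)
    (@kmon_neq0 _ _ _ _ _ E) (@kmon_radical _ _ _ _ _ E) (@kmon_indep _ _ _ _ _ E)
    (iota := base_emb (E := E)) (@iota_base _ _ _ _ _ E)) => //.
    (* The order of the Galois group is already invertible in the constants. *)
    exists (cst ((#|'Gal({:L} / 1)%g|%:R)^-1)%:MP).
    have G0 : (#|'Gal({:L} / 1)%g|%:R : K) != 0 by rewrite pnatr_eq0 -lt0n cardG_gt0.
    have := divff G0 => /(congr1 (fun a => iota (cst a%:MP))).
    rewrite !rmorphM !rmorph1 /= !rmorph_nat => GV.
    apply: (mulfI (galois_card_neq0 L (Q_pchar X))); rewrite GV divff //.
    exact: galois_card_neq0 L (Q_pchar X).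
  by rewrite -def_x.
have den a : exists md : 'X_{1..N} * D, c a * iota (mon md.1) = iota md.2.
  have /vlineP[ca def_ca] := c1 a.
  pose F := \prod_i frad i ^+ (a i * (rad_exp E %/ ord_ i)).
  pose T (x : D) := exists m, x = mon m.
  have [||||z [y [[m ->] def_y]]] := @radical_denominator D (@mx_factorial _ _ _ _ X) T _ _ (rad_exp E) F ca (rad_exp_gt0 E).
  - by exists 0%MM; rewrite mx_mon0.
  - by move=> _ _ [m1 ->] [m2 ->]; exists (m1 + m2)%MM; rewrite mx_monD.
  - move=> p prp npT; apply: frad_free => // [|i|m]; first exact: rad_exp_gt0.
      by rewrite -[X in (_ < X)%N](divnK (ord_dvd E i)) mulnC ltn_pmul2l // divn_gt0 ?wexp_gt0 // dvdn_leq ?rad_exp_gt0 ?ord_dvd.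
    by apply: npT; exists m.
  - have := integralX (rad_exp E) (int_c a); rewrite exprMn kmonX def_ca.
    case=> p mon_p; rewrite (_ : map_poly _ p = map_poly (in_alg L) (map_poly (@FracField.tofrac D) p)); last first.
      by apply/polyP => i; rewrite !coef_map.
    rewrite -[X in root _ X](_ : in_alg L (ca ^+ rad_exp E * F%:F) = _) ?fmorph_root; last first.
      by rewrite rmorphM rmorphXn.
    by exists p.
  exists (m, y); rewrite def_ca /base_emb /= -def_y.
  by rewrite -!/(in_alg L _) rmorphM.
have [md mdP] := boolp.choice den.
pose m := (\sum_a (md a).1)%MM.
exists m, (fun a => (md a).2 * mon (m - (md a).1)%MM).
rewrite def_x mulr_suml; apply: eq_bigr => a _; rewrite mulrAC; congr (_ * _).
rewrite rmorphM /= -mdP -mulrA -rmorphM -mx_monD; congr (_ * iota (mon _)).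
by rewrite addmC submK //; apply/mnm_lepP => j; rewrite /m mnm_sumE (bigD1 a) //= leq_addr.
Qed.

Lemma Phi_off m : Phi 'X_[offmon m] * iota (mon m) = 1.
Proof.
have off_off : offmon (offmon m) = offmon m.
  by apply/mnmP => j; rewrite !mnmE mulnA mulnb andbb.
rewrite PhiX off_off big1 ?mulr1 => [|i _]; last by rewrite mnmE tauK eqxx expr0.
rewrite (@mx_mon_ext _ _ _ _ X (offmon m) m) => [|j oj]; last by rewrite mnmE oj mul1n.
by rewrite mulVf // base_emb_eq0 mon_neq0.
Qed.

Lemma off_tau m i : offmon m (tau i) = 0%N.
Proof. by rewrite mnmE tauK eqxx. Qed.

(** [Phi] sends [X_j] to [1 / x_j], so dividing [d] by a large monomial leaves only nonpositive
    powers of the [x_j], and these are images. *)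
Lemma domain_image (d : D) : exists (mg : 'X_{1..N} * S),
  Phi 'X_[offmon mg.1] * iota d = Phi mg.2.
Proof.
have [r [_ ->]] := mx_span d; pose m := (\sum_(x <- r) x.2)%MM.
exists (m, \sum_(x <- r) ysub B x.1 * 'X_[offmon (m - x.2)]) => /=.
rewrite !rmorph_sum mulr_sumr big_seq [RHS]big_seq; apply: eq_bigr => x xr.
rewrite !rmorphM /= Phi_ysub.
have -> : offmon m = (offmon (m - x.2) + offmon x.2)%MM.
  apply/mnmP => j; rewrite mnmDE !mnmE -mulnDr subnK //.
  by rewrite /m mnm_sumE (big_rem x) //= leq_addr.
rewrite mpolyXD rmorphM /= [RHS]mulrC -[RHS]mulr1 -(Phi_off x.2) -!mulrA; congr (_ * _).
by rewrite mulrCA.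
Qed.

Lemma kmon_image a : exists g, km a = Phi g.
Proof.
exists (\prod_i 'X_(tau i) ^+ a i); rewrite rmorph_prod; apply: eq_bigr => i _.
rewrite rmorphXn /=; congr (_ ^+ _).
by rewrite [RHS]mmapX mmap1U /Phi_var tauK eqxx.
Qed.

(** A monomial multiple of the fraction is integral over [D], so its coordinates have monomial
    denominators; all these monomials are off the section and pull back to monomials of [S]. *)
Lemma integral_local_fraction (a b : S) : ~ blockI B b -> integralOver Phi (Phi a / Phi b) ->
  exists m g, blockI B ('X_[offmon m] * a - g * b).
Proof.
move=> nb [p pmon rootp]; have Phib : Phi b != 0 by apply/eqP => /Phi_kernel.
set x := Phi a / Phi b in rootp; pose n := (size p).-1.
have szp : size p = n.+1 by rewrite prednK // size_poly_gt0 monic_neq0.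
have [k kP] : exists k, forall i, integral (iota (mon (bigm E k)) * Phi p`_i).
  have /boolp.choice[f fP] := fun i => integral_Phi p`_i.
  exists (\sum_(i < n.+1) f i)%N => i; have [lt_i|ge_i] := ltnP i n.+1.
    by apply: fP; rewrite (bigD1 (Ordinal lt_i)) //= leq_addr.
  by rewrite nth_default ?szp // rmorph0 mulr0; exact: integral0.
pose M := iota (mon (bigm E k)); pose z := M * x.
have spx : spanned x by apply: spannedM; [exact: spanned_Phi|apply: spannedV; [|exact: spanned_Phi]].
have spz : spanned z by apply: spannedZ => //; exact: iota_base.
have int_z : integral z.
  (* The monic equation of [M * x]: the coefficient of index [i] in that of [x] is scaled by
     [M ^+ (n - i)]. *)
  pose r := \poly_(i < n.+1) (Phi p`_i * M ^+ (n - i)).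
  have pn : p`_n = 1 by have /monicP := pmon; rewrite lead_coefE.
  apply: (@integral_root_monic _ _ _ _ r).
  - rewrite monicE lead_coefE size_poly_eq ?coef_poly /= ?ltnSn ?subnn ?expr0 ?pn ?rmorph1 ?mulr1 //.
    by rewrite oner_eq0.
  - rewrite rootE horner_poly; apply/eqP.
    have := rootp; rewrite rootE (horner_coef_wide _ (n := n.+1)); last first.
      by rewrite -szp size_poly.
    move/eqP/(congr1 (fun y => M ^+ n * y)); rewrite mulr0 mulr_sumr => eq0; rewrite -[RHS]eq0.
    apply: eq_bigr => -[i /= lt_i] _; rewrite coef_map /z exprMn.
    by rewrite -[X in M ^+ X * _](subnKC (lt_i : (i <= n)%N)) exprD; ring.
  apply/integral_poly => i; rewrite coef_poly; case: ltnP => [|_]; last exact: integral0.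
  rewrite ltnS leq_eqVlt => /orP[/eqP ->|lt_i].
    by rewrite subnn expr0 mulr1 pn rmorph1; exact: integral1.
  rewrite -(subnSK lt_i) exprS mulrA [Phi _ * _]mulrC; apply: integral_mul; first exact: kP.
  exact/integralX/integral_id.
have [m1 [d def_d]] := spanned_integral_denominator spz int_z.
have /boolp.choice[mg mgP] := fun e => domain_image (d e).
have /boolp.choice[kg kgP] := kmon_image.
(* [m2] pulls the coefficients [d e] back from [D]; [m3] undoes the two monomials by which [x] was
   multiplied. *)
pose m2 := (\sum_e (mg e).1)%MM; pose m3 := (bigm E k + m1)%MM.
exists m2, ((\sum_e 'X_[offmon (m2 - (mg e).1)] * (mg e).2 * kg e) * 'X_[offmon m3]).
apply: (Phi_kernel (E := E)); apply/eqP; rewrite rmorphB subr_eq0 !rmorphM rmorph_sum /=; apply/eqP.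
have -> : Phi a = x * Phi b by rewrite /x divfK.
rewrite mulrA; congr (_ * _).
have <- : Phi 'X_[offmon m2] * (z * iota (mon m1)) =
    \sum_e Phi ('X_[offmon (m2 - (mg e).1)] * (mg e).2 * kg e).
  rewrite def_d mulr_sumr; apply: eq_bigr => e _; rewrite !rmorphM /= -mgP -kgP.
  rewrite mulrA; congr (_ * _); rewrite mulrA; congr (_ * _).
  rewrite -rmorphM /= -mpolyXD; congr (Phi 'X_[_]).
  apply/mnmP => j; rewrite mnmDE !mnmE -mulnDr subnK //.
  by rewrite /m2 mnm_sumE (bigD1 e) //= leq_addr.
rewrite -mulrA; congr (_ * _); rewrite [RHS]mulrC /z /M.
rewrite [iota _ * x]mulrC -[X in _ = _ * X]mulrA -rmorphM /= -mx_monD mulrCA Phi_off mulr1 //.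
Qed.

End LocalNormality.

Definition mpolyC_domain (Y : idomainType) n : {rmorphism Y -> ({mpoly Y[n]} : idomainType)} :=
  @mpolyC n Y.

Section MonomialExtension.
Variables (Y : idomainType) (N : nat) (P : pred 'I_N).
Hypothesis factY : factorial_domain Y.

Local Notation n := #|P|.
Local Notation D := {mpoly Y[n]}.
Implicit Types (g h : Y) (m : 'X_{1..N}).

Definition rmnm m : 'X_{1..n} := [multinom m (enum_val i) | i < n].

Definition xmnm (m : 'X_{1..n}) : 'X_{1..N} :=
  [multinom (\sum_(i < n | enum_val i == j) m i)%N | j < N].

Lemma xmnmK : cancel xmnm rmnm.
Proof.
move=> m; apply/mnmP => i; rewrite !mnmE (bigD1 i) //= big1 ?addn0 // => k /andP[/eqP eq_k].
by rewrite (enum_val_inj eq_k) eqxx.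
Qed.

Lemma mon_divides g h : divides (g%:MP : D) h%:MP -> divides g h.
Proof.
case=> k /(congr1 (mcoeff 0%MM)); rewrite mulrC mul_mpolyC mcoeffZ mcoeffC eqxx mulr1 => ->.
by exists k@_0%MM; rewrite mulrC.
Qed.

Lemma mon_ndiv h m : prime_elt h -> ~ divides (h%:MP : D) 'X_[rmnm m].
Proof.
move=> prh [k /(congr1 (mcoeff (rmnm m)))]; rewrite mulrC mul_mpolyC mcoeffZ mcoeffX eqxx => def1.
by apply: (prime_not_div_unit prh (unitr1 _)); exists k@_(rmnm m); rewrite mulrC.
Qed.

Lemma mon_free (T : eqType) (r : seq T) (h : T -> Y) (mu : T -> 'X_{1..N}) :
  uniq r -> {in r &, forall e e', (forall j, P j -> mu e j = mu e' j) -> e = e'} ->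
  \sum_(e <- r) (h e)%:MP * 'X_[rmnm (mu e)] = 0 :> D -> forall e, e \in r -> h e = 0.
Proof.
move=> Ur mu_inj sum0 e er; have := congr1 (mcoeff (rmnm (mu e))) sum0.
rewrite mcoeff0 raddf_sum (bigD1_seq e) //= mul_mpolyC mcoeffZ mcoeffX eqxx mulr1.
rewrite big_seq_cond big1 ?addr0 // => e' /andP[er' ne].
rewrite mul_mpolyC mcoeffZ mcoeffX (_ : _ == _ = false) ?mulr0 //.
apply: contraNF ne => /eqP eq_mu; apply/eqP/(mu_inj _ _ er' er) => j Pj.
have := congr1 (fun m : 'X_{1..n} => m (enum_rank_in Pj j)) eq_mu.
by rewrite !mnmE enum_rankK_in.
Qed.

Lemma mon_span (d : D) : exists r : seq (Y * 'X_{1..N}),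
  (forall x, x \in r -> forall j, ~~ P j -> x.2 j = 0%N) /\
  d = \sum_(x <- r) (x.1)%:MP * 'X_[rmnm x.2].
Proof.
exists [seq (d@_m, xmnm m) | m : 'X_{1..n} <- msupp d]; split.
  move=> _ /mapP[m _ ->] j nPj /=; rewrite mnmE big1 // => i /eqP def_j.
  by have := enum_valP i; rewrite def_j unfold_in (negPf nPj).
rewrite big_map {1}(mpolyE d); apply: eq_bigr => m _ /=.
by rewrite xmnmK mul_mpolyC.
Qed.

Lemma rmnmD m1 m2 : 'X_[rmnm (m1 + m2)%MM] = 'X_[rmnm m1] * 'X_[rmnm m2] :> D.
Proof. by rewrite -mpolyXD; congr 'X_[_]; apply/mnmP => i; rewrite !(mnmDE, mnmE). Qed.

Lemma rmnm0 : 'X_[rmnm 0%MM] = 1 :> D.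
Proof. by rewrite -mpolyX0; congr 'X_[_]; apply/mnmP => i; rewrite mnmE !mnm0E. Qed.

Lemma rmnm_ext m1 m2 : (forall j, P j -> m1 j = m2 j) -> 'X_[rmnm m1] = 'X_[rmnm m2] :> D.
Proof.
by move=> eqP12; congr 'X_[_]; apply/mnmP => i; rewrite !mnmE; apply/eqP12/(enum_valP i).
Qed.

End MonomialExtension.

Definition std_mono_ext (K : fieldType) (N q : nat) (P : pred 'I_N) : mono_ext K q P.
Proof.
pose D : idomainType := {mpoly {mpoly K[q]}[#|P|]}.
refine (@MonoExt K N q P D (mpolyC_domain {mpoly K[q]} #|P|) (fun m => 'X_[rmnm P m]) _ _ _ _ _ _ _ _ _).
- exact/factorial_mpoly/factorial_Y.
- by move=> h; exact: prime_mpolyC.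
- exact: mon_divides.
- exact: mon_ndiv.
- exact: rmnm0.
- exact: rmnmD.
- exact: rmnm_ext.
- exact: mon_free.
- exact: mon_span.
Qed.

Section Existence.
Variables (K : numClosedFieldType) (N s q : nat) (B : block_data K N s q).

Lemma kummer_ext_exists tau : (forall i, blk B (tau i) = i) ->
  exists E : kummer_ext B, ke_tau E = tau.
Proof.
move=> tauK; pose X := std_mono_ext K q (fun j => j != tau (blk B j)).
have [L [u uE]] := frad_roots X.
by exists (KummerExt tauK uE).
Qed.

Lemma section_through j : exists2 tau : 'I_s -> 'I_N,
  (forall i, blk B (tau i) = i) & tau (blk B j) = j.
Proof.
have /boolp.choice[f fK] := blk_surj B.
exists (fun i => if i == blk B j then j else f i) => [i|]; last by rewrite eqxx.
by case: eqP => [->|_].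
Qed.

Lemma block_prime : prime_ideal (blockI B).
Proof.
have /boolp.choice[tau tauK] := blk_surj B.
by have [E _] := kummer_ext_exists tauK; exact: blockI_prime E.
Qed.

Lemma mval_neq0 (m : 'X_{1..N}) : mval B m != 0.
Proof. by apply/prodf_neq0 => i _; rewrite expf_neq0 // ell_neq0. Qed.

Lemma mon_notin (m : 'X_{1..N}) : ~ blockI B 'X_[m].
Proof. by move/blockIP/(_ (red B m)) => /eqP; rewrite NFX eqxx (negPf (mval_neq0 m)). Qed.

(** For a section through [j] the variable [X_j] is not inverted, so it is absent from the
    denominator. *)
Lemma local_fraction j (a b : {mpoly K[N]}) : ~ blockI B b ->
  (exists (k : nat) (cs : seq {mpoly K[N]}), (0 < k)%N /\ size cs = k /\
    blockI B (a ^+ k + \sum_(t < k) cs`_t * a ^+ (k - t.+1) * b ^+ t.+1)) ->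
  exists (m : 'X_{1..N}) g, m j = 0%N /\ blockI B ('X_[m] * a - g * b).
Proof.
move=> nb [k [cs [k0 [szk rel]]]].
have [tau tauK def_j] := section_through j; have [E def_tau] := kummer_ext_exists tauK.
have [|m [g mg]] := @integral_local_fraction _ _ _ _ _ E a b nb; last first.
  exists (offmon B (ke_tau E) m), g; split=> //.
  by rewrite -def_j -def_tau off_tau.
have b0 : Phi E b != 0 by apply/eqP => /Phi_kernel.
(* [cs] lists the coefficients from the top degree downwards, hence the reversed index. *)
exists ('X^k + \poly_(i < k) cs`_(k - i.+1)).
  by rewrite monicE lead_coefDl ?lead_coefXn // size_polyXn ltnS size_poly.
rewrite rmorphD /= map_polyXn rootE hornerD hornerXn.
rewrite (_ : map_poly _ _ = \poly_(i < k) Phi E cs`_(k - i.+1)); last first.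
  by apply/polyP => i; rewrite coef_map !coef_poly /=; case: ltnP => // _; exact: rmorph0.
rewrite horner_poly (reindex_inj rev_ord_inj) /=.
have := Phi_blockI E rel; rewrite rmorphD rmorphXn rmorph_sum /=.
move=> /(congr1 (fun x => x / Phi E b ^+ k)); rewrite mul0r => eq0.
apply/eqP; rewrite -[RHS]eq0 mulrDl exprMn exprVn; congr (_ + _); rewrite [RHS]mulr_suml; apply: eq_bigr => -[t /= lt_t] _.
rewrite !rmorphM !rmorphXn /= subnSK // subKn ?(ltnW lt_t) // -!mulrA; congr (_ * _).
rewrite exprMn exprVn; congr (_ * _).
rewrite -{2}(subnK lt_t) addnC exprD invfM mulrA divff ?mul1r // expf_neq0 //.
Qed.

End Existence.

Section Normality.
Variables (K : numClosedFieldType) (N s q : nat) (B : block_data K N s q).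
Local Notation S := {mpoly K[N]}.
Local Notation II := (blockI B).
Let IIi := blockI_ideal B.
Implicit Types (e m : 'X_{1..N}) (p g h : S) (j : 'I_N).

Lemma red_le m j : (red B m j <= m j)%N.
Proof. by rewrite mnmE leq_subr. Qed.

(** A multiple of [X_j] reaches a coordinate with [e j = 0] only if [X_j] is absorbed into a
    completed [t_i] of its block, and a completed [t_i] leaves a factor [ell_i]. *)
Lemma var_divides_NF j g e : e j = 0%N -> divides (ell B (blk B j)) (NF B e ('X_j * g)).
Proof.
move=> ej; have [[e' [red_e' def_e]]|noe] :=
    boolp.pselect (exists e', red B e' = e' /\ e = red B (U_(j) + e')%MM); last first.
  rewrite NF_mulX0; first exact: divides0.
  by move=> e' red_e' def_e; apply: noe; exists e'.
rewrite {1}def_e NF_mulX //; apply: dividesMr.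
rewrite /mval (bigD1 (blk B j)) //=; apply: dividesMr.
set k := quo _ _ _; have : (0 < k)%N.
  rewrite lt0n; apply/eqP => k0; have := red_quo B (U_(j) + e')%MM.
  move/mnmP/(_ j); rewrite -def_e !mnmDE mnm1E eqxx ej mnmE -/k k0 mul0n; lia.
by case: k => // k _; rewrite exprSr; exact/dividesMl/dividesxx.
Qed.

(** Coordinates with [e j > 0] contain [X_j] visibly; in the others the factor [ell_i] stands for
    [t_i], of which [X_j] is a factor. *)
Lemma var_divides_of_NF j p : (forall e, red B e = e -> e j = 0%N ->
  divides (ell B (blk B j)) (NF B e p)) -> exists g, II (p - 'X_j * g).
Proof.
move=> dvd_p; set r := undup [seq red B m | m <- msupp p].
suff /boolp.choice[g gP] : forall e, exists g, e \in r -> II (ysub B (NF B e p) * 'X_[e] - 'X_j * g).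
  exists (\sum_(e <- r) g e); apply: (ideal_trans IIi (blockI_normal B p)).
  rewrite mulr_sumr -sumrB big_seq; exact: (ideal_sum IIi).
move=> e; have [er|ner] := boolP (e \in r); last by exists 0.
have red_e : red B e = e by move: er; rewrite mem_undup => /mapP[m _ ->]; rewrite red_red.
have [ej|ej] := posnP (e j); last first.
  exists (ysub B (NF B e p) * 'X_[(e - U_(j))%MM]) => _.
  rewrite [X in _ - X]mulrCA -mpolyXD addmC submK ?subrr; first exact: ideal0 IIi.
  by apply/mnm_lepP => k; rewrite mnm1E; case: eqP => // <-.
have [c ->] := dvd_p e red_e ej; pose t := tm B (blk B j).
exists (ysub B c * 'X_[(t - U_(j))%MM] * 'X_[e]) => _; rewrite rmorphM /=.
have -> : 'X_j * (ysub B c * 'X_[(t - U_(j))%MM] * 'X_[e]) = ysub B c * 'X_[t] * 'X_[e].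
  have -> : 'X_[t] = 'X_j * 'X_[(t - U_(j))%MM] :> S; last by ring.
  rewrite -mpolyXD addmC submK //.
  by apply/mnm_lepP => k; rewrite mnm1E; case: eqP => // <-; rewrite mnmE eqxx mul1n wexp_gt0.
rewrite -!mulrA -mulrBr; apply: (ideal_mull IIi); rewrite -mulrBl mulrC; apply: (ideal_mull IIi).
by apply: (ideal_sym IIi); exact: blockI_tm.
Qed.

(** A monomial without [X_j] cannot complete the block of [j] on an [e] with [e j = 0], so the
    factor [mval] it produces is prime to [ell_i]; divisibility of the coordinates of [X^m g]
    therefore passes to those of [g]. *)
Lemma var_divides_cancel j m g h : m j = 0%N -> II ('X_j * h - 'X_[m] * g) ->
  exists k, II (g - 'X_j * k).
Proof.
move=> mj eq_hg; apply: var_divides_of_NF => e red_e ej.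
have pr := prime_ell B (blk B j).
have ndiv : ~ divides (ell B (blk B j)) (mval B (m + e)%MM).
  case/(prime_div_prod pr) => i _; have [<-|ni] := eqVneq (blk B j) i; last first.
    by move/(prime_div_exp pr); exact: ell_ndiv.
  have := quo_le B (m + e)%MM j; rewrite mnmDE mj ej leqn0 muln_eq0.
  case/orP => /eqP => [->|lam0]; last by have := wexp_gt0 B j; rewrite lam0.
  by rewrite expr0 => /(prime_not_div_unit pr); apply; exact: unitr1.
have : divides (ell B (blk B j)) (mval B (m + e)%MM * NF B e g).
  rewrite -NF_mulX //; have /blockIP/(_ (red B (m + e)%MM)) := eq_hg.
  rewrite linearB /= => /eqP; rewrite subr_eq0 => /eqP <-.
  apply: var_divides_NF; apply/eqP; rewrite -leqn0; apply: leq_trans (red_le _ _) _.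
  by rewrite mnmDE mj ej.
by have [_ _ pr'] := pr; case/pr'.
Qed.

(** Induction on the degree of a monomial denominator [m]. For [j] in [m] there is a second
    denominator [m'] without [X_j]; comparing the two expressions of [a / b] shows that [X_j]
    divides [X^m' g], hence [g], and it cancels against [X^m]. *)
Lemma block_normal (j0 : 'I_N) (a b : S) : ~ II b ->
  (exists (k : nat) (cs : seq S), (0 < k)%N /\ size cs = k /\
    II (a ^+ k + \sum_(t < k) cs`_t * a ^+ (k - t.+1) * b ^+ t.+1)) ->
  exists c, II (a - c * b).
Proof.
move=> nb rel; have [_ _ primeI] := block_prime B.
have [m [g [_ eq_m]]] := local_fraction j0 nb rel.
have [n] := ubnP (mdeg m); elim: n m g eq_m => // n IHn m g eq_m.
rewrite ltnS => le_m; have [m0|m0] := eqVneq m 0%MM.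
  by exists g; move: eq_m; rewrite m0 mpolyX0 mul1r.
have [j mj] : exists j, (0 < m j)%N.
  apply: boolp.contrapT => noj; case/eqP: m0; apply/mnmP => j; rewrite mnm0E.
  by apply/eqP; rewrite -leqn0 leqNgt; apply/negP => mj; apply: noj; exists j.
have [m' [g' [m'j eq_m']]] := local_fraction j nb rel.
have def_m : 'X_[m] = 'X_j * 'X_[(m - U_(j))%MM] :> S.
  rewrite -mpolyXD addmC submK //; apply/mnm_lepP => k.
  by rewrite mnm1E; case: eqP => // <-.
have [k eq_g] : exists k, II (g - 'X_j * k).
  apply: (var_divides_cancel (m := m') (h := 'X_[(m - U_(j))%MM] * g')) => //.
  have : II (b * ('X_j * ('X_[(m - U_(j))%MM] * g') - 'X_[m'] * g)).
    have -> : b * ('X_j * ('X_[(m - U_(j))%MM] * g') - 'X_[m'] * g) =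
        'X_[m'] * ('X_[m] * a - g * b) - 'X_[m] * ('X_[m'] * a - g' * b).
      by rewrite def_m; ring.
    by apply: (idealB IIi); exact: (ideal_mull IIi).
  by case/primeI.
apply: (IHn (m - U_(j))%MM k); last first.
  apply: leq_trans le_m; have <- : (m - U_(j) + U_(j))%MM = m.
    by rewrite submK //; apply/mnm_lepP => i; rewrite mnm1E; case: eqP => // <-.
  by rewrite mdegD mdeg1 addn1 addmK.
have : II ('X_j * ('X_[(m - U_(j))%MM] * a - k * b)).
  have -> : 'X_j * ('X_[(m - U_(j))%MM] * a - k * b) =
      ('X_[m] * a - g * b) + b * (g - 'X_j * k) by rewrite def_m; ring.
  by apply: (idealD IIi) => //; exact: (ideal_mull IIi).
by case/primeI => // /mon_notin.
Qed.

End Normality.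

(** * Units *)

Section Units.
Variables (K : numClosedFieldType) (N s q : nat) (B : block_data K N s q).
Variables (wt : 'I_N -> nat) (W : nat).
Hypothesis wt_gt0 : forall j, (0 < wt j)%N.
Hypothesis wt_block : forall i, (\sum_j wt j * tm B i j)%N = W.

(** [Th] is [Phi] with a grading variable: [X_j] gets weight [wt j] and every [t_i] weight [W], so
    the relations still vanish. Units of a polynomial ring over a field are constant, so [Th p] is
    its coefficient of index 0; as all weights are positive, this comes from the constant term of
    [p]. *)
Lemma block_units p : quot_unit (blockI B) p ->
  exists a : K, a != 0 /\ blockI B (p - a%:MP).
Proof.
have /boolp.choice[tau tauK] := blk_surj B; have [E _] := kummer_ext_exists tauK.
case=> v uv1; exists p@_0%MM.
pose h j : {poly ke_field E} := (Phi_var E j)%:P * 'X^(wt j).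
pose cK : {rmorphism K -> {poly ke_field E}} :=
  @polyC (ke_field E) \o (base_emb (E := E) \o mx_cst (ke_ext E) \o @mpolyC q K).
pose Th : {rmorphism {mpoly K[N]} -> {poly ke_field E}} := mmap cK h.
have ThX m : Th 'X_[m] = (Phi E 'X_[m])%:P * 'X^(\sum_j wt j * m j).
  rewrite [LHS]mmapX [Phi E _]mmapX /mmap1 rmorph_prod -prodrXr -big_split /=.
  rewrite (eq_bigr (fun j => (Phi_var E j ^+ m j)%:P * 'X^(wt j * m j))) // => j _.
  by rewrite /h exprMn exprM rmorphXn.
have ThZ a r : Th (a *: r) = cK a * Th r by rewrite -mul_mpolyC rmorphM /= [Th _%:MP]mmapC.
have Th0 r : blockI B r -> Th r = 0.
  move: r; apply: gen_ideal_sub => [|_ [w [Aw0 ->]]]; first exact: ker_ideal.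
  transitivity ((Phi E (\sum_i w i 0 *: 'X_[tm B i]))%:P * 'X^W).
    rewrite [LHS]rmorph_sum [Phi E _]rmorph_sum [X in X * _]rmorph_sum mulr_suml.
    apply: eq_bigr => i _ /=; by rewrite ThZ ThX wt_block PhiZ polyCM mulrA.
  rewrite Phi_blockI ?mul0r //; apply: gen_ideal_gen; by exists w.
have Th1 : Th p * Th v = 1.
  by apply/eqP; rewrite -subr_eq0 -rmorphM -(rmorph1 Th) -rmorphB /= Th0.
have szTh : (size (Th p) <= 1)%N.
  have := congr1 (fun r : {poly _} => size r) Th1; rewrite size_poly1.
  have nz : Th p * Th v != 0 by rewrite Th1 oner_eq0.
  move: nz; rewrite mulf_eq0 negb_or => /andP[p0 v0]; rewrite size_mul //.
  move: p0 v0; rewrite -!size_poly_gt0.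
  by move: (size (Th p)) (size (Th v)) => x y; lia.
have Thp : Th p = \sum_(m <- msupp p) (Phi E (p@_m *: 'X_[m]))%:P * 'X^(\sum_j wt j * m j).
  rewrite {1}(mpolyE p) rmorph_sum; apply: eq_bigr => m _ /=.
  by rewrite ThZ ThX PhiZ polyCM mulrA.
have Phi_p : (Th p).[1] = Phi E p.
  rewrite Thp horner_sum [in RHS](mpolyE p) rmorph_sum; apply: eq_bigr => m _ /=.
  by rewrite !hornerE expr1n mulr1.
have coef0 : (Th p)`_0 = Phi E (p@_0%MM)%:MP.
  have coefT m : ((Phi E (p@_m *: 'X_[m]))%:P * 'X^(\sum_j wt j * m j))`_0 =
      if m == 0%MM then Phi E (p@_0%MM)%:MP else 0.
    rewrite coefMXn; case: eqP => [->|nm].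
      rewrite big1 ?coefC ?mpolyX0 ?alg_mpolyC // => j _.
      by rewrite mnm0E muln0.
    case: posnP => // wt0; case: nm; apply/mnmP => j; rewrite mnm0E.
    move/eqP: wt0; rewrite sum_nat_eq0 => /forallP/(_ j).
    by rewrite muln_eq0 gtn_eqF //= => /eqP.
  rewrite Thp coef_sum (eq_bigr _ (fun m _ => coefT m)).
  have [p0|p0] := boolP (0%MM \in msupp p).
    by rewrite (bigD1_seq 0%MM) //= eqxx big1 ?addr0 // => m /negPf ->.
  rewrite (memN_msupp_eq0 p0) mpolyC0 rmorph0; apply: big1_seq => m /andP[_ mp].
  by case: eqP => // m0; rewrite m0 (negPf p0) in mp.
have eq_p : blockI B (p - (p@_0%MM)%:MP).
  apply: (Phi_kernel (E := E)); apply/eqP; rewrite rmorphB subr_eq0 /= -coef0 -Phi_p.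
  by rewrite (size1_polyC szTh) hornerC coefC.
split=> //; apply/eqP => p0; rewrite p0 mpolyC0 subr0 in eq_p.
have [IIi n1 _] := block_prime B; apply: n1.
rewrite (_ : 1 = p * v - (p * v - 1)); last by ring.
apply: (idealB IIi) => //; exact: (ideal_mulr IIi).
Qed.

End Units.

(** * Dimension *)

Section Growth.
Variables (K : fieldType) (N : nat).
Local Notation S := {mpoly K[N]}.

(** Growth is recorded by families of [M] polynomials of degree at most [n], independent modulo [J],
    which needs no dimension of a quotient space. *)
Definition indep_mod (J : S -> Prop) (n M : nat) := exists (T : finType) (f : T -> S),
  [/\ #|T| = M, forall t, (msize (f t) <= n.+1)%N &
      forall c : T -> K, J (\sum_t c t *: f t) -> forall t, c t = 0].

Lemma indep_mod_sub (J J' : S -> Prop) n M : (forall p, J p -> J' p) -> indep_mod J' n M -> indep_mod J n M.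
Proof. by move=> sJ [T [f [cT szf free]]]; exists T, f; split=> // c /sJ; exact: free. Qed.

Lemma msize_mulX (f g : S) a b : (msize f <= a.+1)%N -> (msize g <= b.+1)%N ->
  (msize (f * g) <= (a + b).+1)%N.
Proof.
move=> fa gb; have [->|f0] := eqVneq f 0; first by rewrite mul0r msize0.
have [->|g0] := eqVneq g 0; first by rewrite mulr0 msize0.
by rewrite msizeM //; move: (msize f) (msize g) fa gb; lia.
Qed.

Lemma msize_exp (f : S) a i : (msize f <= a.+1)%N -> (msize (f ^+ i) <= (a * i).+1)%N.
Proof.
move=> fa; elim: i => [|i IHi]; first by rewrite expr0 msize1.
by rewrite exprS mulnS; exact: msize_mulX.
Qed.

(** The products [f ^+ i * g t] with [i <= k] are independent modulo [P]: modulo [Q] only [i = 0]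
    survives, so these coefficients vanish; then one factor [f] cancels because [P] is prime and
    does not contain it. *)
Lemma indep_mod_step (P Q : S -> Prop) f n M d k : prime_ideal P -> is_ideal Q -> (forall p, P p -> Q p) ->
  Q f -> ~ P f -> (msize f <= d.+1)%N -> indep_mod Q n M ->
  indep_mod P (n + d * k) (k.+1 * M).
Proof.
move=> [Pi _ primeP] Qi sPQ Qf nPf szf [T [g [cT szg free]]].
exists ('I_k.+1 * T)%type, (fun x : 'I_k.+1 * T => f ^+ x.1 * g x.2); split.
- by rewrite card_prod card_ord cT.
- move=> [i t] /=; rewrite addnC; apply: msize_mulX => //.
  apply: leq_trans (msize_exp i szf) _; rewrite ltnS leq_mul2l -ltnS ltn_ord orbT //.
have main l (c : 'I_l -> T -> K) : P (\sum_(i < l) f ^+ i * \sum_t c i t *: g t) ->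
    forall i t, c i t = 0.
  elim: l c => [|l IHl] c; first by move=> _ [].
  rewrite big_ord_recl expr0 mul1r; 
  rewrite [X in _ + X](_ : _ = f * \sum_(i < l) f ^+ i * \sum_t c (lift ord0 i) t *: g t); last first.
    by rewrite mulr_sumr; apply: eq_bigr => i _; rewrite mulrA -exprS.
  move=> Psum.
  have c0 : forall t, c ord0 t = 0.
    apply: free; have := sPQ _ Psum; set x := \sum_t _; set y := f * _ => Qxy.
    rewrite -(addrK y x); by apply: (idealB Qi) => //; rewrite /y mulrC; exact: (ideal_mull Qi).
  rewrite big1 ?add0r in Psum; last by move=> t _; rewrite c0 scale0r.
  case: (primeP _ _ Psum) => // /(IHl (fun i => c (lift ord0 i))) cS i t.
  by case: (unliftP ord0 i) => [i' ->|->].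
move=> c Pc [i t]; apply: (main _ (fun i t => c (i, t))).
rewrite (_ : \sum_(i0 < k.+1) _ = \sum_x c x *: (f ^+ x.1 * g x.2)) //.
under eq_bigr do rewrite mulr_sumr; rewrite pair_bigA /=.
by apply: eq_bigr => -[i' t'] _ /=; rewrite scalerAr.
Qed.

(** Going down the chain with [k = n] in [indep_mod_step], each strict inclusion multiplies the
    number of polynomials by [n.+1] and raises the degree bound by a multiple of [n]. *)
Lemma prime_chain_growth (I : S -> Prop) d P : prime_chain I d P ->
  exists C, forall n, indep_mod I (C * n) (n.+1 ^ d).
Proof.
case=> primes strict.
suff [C CP] : exists C, forall n, indep_mod (P 0%N) (C * n) (n.+1 ^ d).
  by exists C => n; apply: indep_mod_sub (CP n); case: (primes 0%N).
suff : forall t, (t <= d)%N -> exists C, forall n, indep_mod (P (d - t)%N) (C * n) (n.+1 ^ t).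
  by move/(_ d (leqnn d)); rewrite subnn.
elim=> [|t IHt] lt_t.
  exists 0%N => n; rewrite subn0 expn0 mul0n; exists unit, (fun=> 1).
  have [[Pi P1 _] _] := primes d (leqnn d).
  split; rewrite ?card_unit ?msize1 // => c; rewrite (bigD1 tt) //= big1 ?addr0; last by case.
  move=> Pc []; apply/eqP/negPn/negP => c0; apply: P1.
  by rewrite -[1]scale1r -(mulVf c0) -scalerA; exact: (idealZ Pi).
have [C CP] := IHt (ltnW lt_t).
have lt_d : (d - t.+1 < d)%N by lia.
have [sP [f [Qf nPf]]] := strict _ lt_d; rewrite subnSK // in sP Qf.
have [primeP _] := primes _ (ltnW lt_d); have [[Qi _ _] _] := primes _ (leq_subr t d).
exists (C + msize f)%N => n; rewrite expnS mulnDl.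
by apply: (indep_mod_step (Q := P (d - t)%N) (f := f)).
Qed.

Lemma growth_bound (I : S -> Prop) d d' C P : (forall n M, indep_mod I n M -> (M <= C * n.+1 ^ d)%N) ->
  prime_chain I d' P -> (d' <= d)%N.
Proof.
move=> bound /prime_chain_growth[D DP]; rewrite leqNgt; apply/negP => lt_d.
(* For this [n] the number [(n+1)^(d+1)] exceeds [C (D+1)^d (n+1)^d], which is at least the assumed
   bound at degree [D n]. *)
pose n := (C * D.+1 ^ d)%N; have := bound _ _ (DP n); apply/negP; rewrite -ltnNge.
apply: (@leq_trans (n.+1 ^ d.+1)); last by rewrite leq_pexp2l.
rewrite expnS; apply: (@leq_ltn_trans (C * (D.+1 * n.+1) ^ d)).
  rewrite leq_mul2l; apply/orP; right.
  have le_n : ((D * n).+1 <= D.+1 * n.+1)%N by lia.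
  by elim: (d) => // e IHe; rewrite !expnS leq_mul.
by rewrite expnMn mulnA ltn_pmul2r ?expn_gt0 // -/n.
Qed.

End Growth.

Section BlockGrowth.
Variables (K : fieldType) (N s q : nat) (B : block_data K N s q).
Local Notation S := {mpoly K[N]}.
Local Notation bet := (blk B).
Local Notation lam := (wexp B).
Implicit Types (m e : 'X_{1..N}).

Lemma msize_ell i : msize (ell B i) = 2%N.
Proof. by rewrite ellE msize_lform // -ellE ell_neq0. Qed.

Lemma msize_mval m : msize (mval B m) = (\sum_i quo B m i).+1.
Proof.
suff [] : msize (mval B m) = (\sum_i quo B m i).+1 /\ mval B m != 0 by [].
rewrite /mval; apply: (big_rec2 (fun (h : {mpoly K[q]}) k => msize h = k.+1 /\ h != 0)).
  by rewrite msize1 oner_neq0.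
move=> i k h _ [szh h0].
have [sze e0] : msize (ell B i ^+ quo B m i) = (quo B m i).+1 /\ ell B i ^+ quo B m i != 0.
  split; last by rewrite expf_neq0 ?ell_neq0.
  elim: (quo B m i) => [|l IHl]; first by rewrite expr0 msize1.
  by rewrite exprS msizeM ?expf_neq0 ?ell_neq0 // msize_ell IHl.
by rewrite mulf_neq0 // msizeM // sze szh addSn addnS.
Qed.

Lemma quo_mdeg m : (\sum_i quo B m i <= mdeg m)%N.
Proof.
rewrite mdegE (partition_big bet predT) //=; apply: leq_sum => i _.
have [j def_i] := blk_surj B i; rewrite (bigD1 j) ?def_i //=.
apply: leq_trans (leq_addr _ _); apply: leq_trans (quo_le B m j).
by rewrite def_i leq_pmulr ?wexp_gt0.
Qed.

Lemma NF_support n (p : S) e (y : 'X_{1..q}) : (msize p <= n.+1)%N -> (NF B e p)@_y != 0 ->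
  [/\ forall j, (e j <= n)%N, forall b, (y b <= n)%N & red B e = e].
Proof.
move=> szp NFy.
have [m [mp red_m my]] : exists m, [/\ m \in msupp p, red B m = e & (mval B m)@_y != 0].
  apply: boolp.contrapT => nom; case/eqP: NFy; rewrite /NF /mlin raddf_sum big1_seq // => m /andP[_ mp].
  rewrite /= mcoeffZ; case: eqP => [red_m|_]; last by rewrite mcoeff0 mulr0.
  have [->|my] := eqVneq ((mval B m)@_y) 0; first by rewrite mulr0.
  by case: nom; exists m.
have le_m : (mdeg m <= n)%N by rewrite -ltnS (leq_trans (msize_mdeg_lt mp)).
split=> [j|b|].
- rewrite -red_m; apply: leq_trans le_m; apply: leq_trans (mnm_le_mdeg m j).
  by rewrite mnmE leq_subr.
- apply: leq_trans (mnm_le_mdeg y b) _; apply: leq_trans le_m; apply: leq_trans (quo_mdeg m).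
  by rewrite -ltnS -msize_mval msize_mdeg_lt // mcoeff_msupp.
- by rewrite -red_m red_red.
Qed.

(** A reduced exponent has in every block a variable [j] with [e j < lam j]; [t] records one per
    block. For fixed [t] only [N - s] exponents can grow with [n]. *)
Definition reduced_at n (t : {ffun 'I_s -> 'I_N}) : {set {ffun 'I_N -> 'I_n.+1}} :=
  [set e : {ffun 'I_N -> 'I_n.+1} | [forall i, (e (t i) < lam (t i))%N]].

Definition lam_sum := (\sum_j lam j)%N.

Lemma card_ord_lt n l : (#|[pred x : 'I_n.+1 | (x < l)%N]| <= l)%N.
Proof.
case: l => [|l]; first by rewrite leqn0; apply/eqP/eq_card0.
rewrite -[X in (_ <= X)%N]card_ord -(card_in_image (f := fun x : 'I_n.+1 => inord x : 'I_l.+1)).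
  exact: max_card.
move=> x y; rewrite !inE => lx ly /(congr1 val); rewrite /= !inordK // => eq_xy.
exact: val_inj.
Qed.

Lemma card_reduced_at n (t : {ffun 'I_s -> 'I_N}) : (forall i, bet (t i) = i) ->
  (#|reduced_at n t| <= lam_sum ^ s * n.+1 ^ (N - s))%N.
Proof.
move=> tK; pose F j := [pred x : 'I_n.+1 | (j == t (bet j)) ==> (x < lam j)%N].
have cF j : (#|F j| <= if j == t (bet j) then lam_sum else n.+1)%N.
  rewrite /F; case: eqP => _ /=; last by rewrite -[X in (_ <= X)%N](card_ord n.+1) max_card.
  by apply: leq_trans (card_ord_lt _ _) _; rewrite /lam_sum (bigD1 j) //= leq_addr.
apply: (@leq_trans #|family F|).
  apply/subset_leq_card/subsetP => e; rewrite inE => /forallP e_lt.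
  apply/familyP => j; rewrite inE; apply/implyP => /eqP def_j.
  by rewrite {2}def_j {1}def_j; exact: e_lt.
rewrite card_family (_ : foldr _ _ _ = \prod_j #|F j|)%N; last first.
  by rewrite foldrE big_map big_enum.
apply: leq_trans (leq_prod (fun j _ => cF j)) _.
rewrite (bigID (fun j => j == t (bet j))) /=.
rewrite (eq_bigr (fun=> lam_sum)) => [|j ->] //.
rewrite [X in (_ * X)%N](eq_bigr (fun=> n.+1)) => [|j /negPf ->] //.
by rewrite !prod_nat_const (card_distinguished tK) (card_off tK).
Qed.

Definition growth_const := (#|{ffun 'I_s -> 'I_N}| * lam_sum ^ s)%N.

Definition reduced_exps n : {set {ffun 'I_N -> 'I_n.+1}} :=
  \bigcup_(t : {ffun 'I_s -> 'I_N} | [forall i, bet (t i) == i]) reduced_at n t.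

Lemma card_reduced_exps n : (#|reduced_exps n| <= growth_const * n.+1 ^ (N - s))%N.
Proof.
rewrite /growth_const -mulnA -sum_nat_const /reduced_exps big_mkcond /=.
elim/big_rec2: _ => [|t k A _ IH]; first by rewrite cards0.
apply: leq_trans (leq_card_setU _ _).1 _; apply: leq_add IH.
case: ifP => [/forallP tK|_]; last by rewrite cards0.
by apply: card_reduced_at => i; exact/eqP.
Qed.

Lemma reduced_expsP n e : red B e = e -> (forall j, (e j <= n)%N) ->
  [ffun j => inord (e j)] \in reduced_exps n.
Proof.
move=> red_e le_e.
have /boolp.choice[t tK] : forall i, exists j, bet j = i /\ (e j < lam j)%N.
  move=> i; have [j def_i] := quo_tight B e i.
  by rewrite -{2}red_e quo_red mul1n => lt_j; exists j.
apply/bigcupP; exists (finfun t).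
  by apply/forallP => i; rewrite ffunE; case: (tK i) => ->.
rewrite inE; apply/forallP => i; rewrite !ffunE inordK ?ltnS //.
by case: (tK i).
Qed.

(** A polynomial of degree at most [n] is determined modulo the ideal by the coefficients of its
    normal form at the positions in [V], so more than [#|V|] of them are dependent. *)
Lemma block_growth n M : indep_mod (blockI B) n M ->
  (M <= growth_const * n.+1 ^ (N - s + q))%N.
Proof.
case=> T [f [cT szf free]].
pose V := [set x : {ffun 'I_N -> 'I_n.+1} * {ffun 'I_q -> 'I_n.+1} | x.1 \in reduced_exps n].
have cV : (#|V| <= growth_const * n.+1 ^ (N - s + q))%N.
  have -> : V = setX (reduced_exps n) setT by apply/setP => x; rewrite !inE andbT.
  rewrite cardsX cardsT card_ffun !card_ord expnD mulnA leq_mul2r card_reduced_exps orbT //.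
apply: leq_trans cV; rewrite leqNgt; apply/negP => lt_V.
pose mn k (x : {ffun 'I_k -> 'I_n.+1}) : 'X_{1..k} := [multinom x j : nat | j < k].
pose A : 'M[K]_(#|T|, #|V|) := \matrix_(t, v)
  (NF B (mn N (enum_val v).1) (f (enum_val t)))@_(mn q (enum_val v).2).
have [c cA c0] : exists2 c : 'rV[K]_#|T|, c *m A = 0 & c != 0.
  have : kermx A != 0.
    rewrite kermx_eq0 /row_free; apply/eqP => rkA.
    by have := rank_leq_col A; rewrite rkA cT leqNgt lt_V.
  by case/rowV0Pn => c /sub_kermxP cA c0; exists c.
pose p := \sum_t c 0 (enum_rank t) *: f t.
have szp : (msize p <= n.+1)%N.
  rewrite /p; elim/big_ind: _ => [|x y sx sy|t _]; first by rewrite msize0.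
    by apply: leq_trans (msizeD_le _ _) _; rewrite geq_max sx.
  by apply: leq_trans (msizeZ_le _ _) _.
have Ip : blockI B p.
  apply/blockIP => e; apply/mpolyP => y; rewrite mcoeff0; apply/eqP/negPn/negP => NFy.
  have [le_e le_y red_e] := NF_support szp NFy; case/negP: NFy; apply/eqP.
  have Vx : ([ffun j => inord (e j)], [ffun b => inord (y b)]) \in V.
    by rewrite inE reduced_expsP.
  pose v := enum_rank_in Vx ([ffun j => inord (e j)], [ffun b => inord (y b)]).
  have vE : enum_val v = ([ffun j => inord (e j)], [ffun b => inord (y b)]) by exact: enum_rankK_in.
  have mnE : mn N (enum_val v).1 = e by rewrite vE; apply/mnmP => j; rewrite mnmE ffunE inordK ?ltnS.
  have mnY : mn q (enum_val v).2 = y by rewrite vE; apply/mnmP => b; rewrite mnmE ffunE inordK ?ltnS.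
  have := congr1 (fun A : 'rV_#|V| => A 0 v) cA; rewrite !mxE => sum0.
  rewrite -[RHS]sum0 /p (raddf_sum (NF B e)) (raddf_sum (mcoeff y)) (reindex_onto enum_val enum_rank) /=; last first.
    by move=> t _; rewrite enum_rankK.
  apply: eq_big => [i|i _]; first by rewrite enum_valK eqxx.
  by rewrite linearZ /= mcoeffZ enum_valK mxE mnE mnY.
have /eqP := c0; apply; apply/rowP => i; rewrite !mxE.
by have := free (fun t => c 0 (enum_rank t)) Ip (enum_val i); rewrite enum_valK.
Qed.

End BlockGrowth.

(** * Going up from a polynomial ring of parameters *)

Section GoingUp.
Variables (K : fieldType) (N d : nat) (w : 'I_d -> {mpoly K[N]}) (I : {mpoly K[N]} -> Prop).
Local Notation S := {mpoly K[N]}.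
Local Notation A0 := {mpoly K[d]}.

Definition param : A0 -> S := mmap (@mpolyC N K) w.
HB.instance Definition _ := GRing.RMorphism.copy param (mmap (@mpolyC N K) w).
Arguments param : simpl never.

Lemma paramX i : param 'X_i = w i.
Proof. by rewrite /param mmapX mmap1U. Qed.

Lemma paramC a : param a%:MP = a%:MP.
Proof. exact: mmapC. Qed.

(** Reduction modulo the first [t] parameters, realised as an endomorphism of [A0], so that its
    values stay in a domain. *)
Definition kill (t : nat) : A0 -> A0 := mmap (@mpolyC d K) (fun i => if (i < t)%N then 0 else 'X_i).
HB.instance Definition _ t := GRing.RMorphism.copy (kill t)
  (mmap (@mpolyC d K) (fun i => if (i < t)%N then 0 else 'X_i)).
Arguments kill : simpl never.

Lemma killX t i : kill t 'X_i = if (i < t)%N then 0 else 'X_i.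
Proof. by rewrite /kill mmapX mmap1U. Qed.

Lemma kill_kill t f : kill t.+1 (kill t f) = kill t.+1 f.
Proof.
have := @mpoly_morph_ext d K A0 (kill t.+1 \o kill t) (kill t.+1); apply=> [a|i] /=.
  by rewrite /kill !mmapC.
rewrite (killX t); case: ifP => // lt_i; rewrite rmorph0 killX.
by rewrite (leqW lt_i).
Qed.

Hypothesis I_ideal : is_ideal I.
Hypothesis param_integral : forall x : S, exists2 p : {poly A0}, p \is monic &
  I (\sum_(i < size p) param p`_i * x ^+ i).

(* [over t P]: the trace of [P] on the parameters lies in the ideal of the first [t] of them. *)
Definition over t (P : S -> Prop) := forall f, P (param f) -> kill t f = 0.

Definition cone t (P J : S -> Prop) := [/\ is_ideal J, forall x, P x -> J x & over t J].

(** If [param f = p + w r], an integral equation of [r] multiplied by [w ^+ n] becomes the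
    polynomial [g] below, whose image lies in [P]. Killing the parameter [w] as well leaves only the
    term [f ^+ n] of [g], so [f] is killed. *)
Lemma cone_start t (lt_td : (t < d)%N) P : prime_ideal P -> (forall x, I x -> P x) -> over t P ->
  cone t.+1 P (fun x => exists p r, P p /\ x = p + w (Ordinal lt_td) * r).
Proof.
move=> [Pi P1 primeP] sIP overP; set W := w _; split.
- split; first by exists 0, 0; rewrite mulr0 addr0; split=> //; exact: ideal0 Pi.
    move=> _ _ [p [r [Pp ->]]] [p' [r' [Pp' ->]]]; exists (p + p'), (r + r').
    by split; [exact: (idealD Pi)|ring].
  move=> a _ [p [r [Pp ->]]]; exists (a * p), (a * r).
  by split; [exact: (ideal_mull Pi)|ring].
- by move=> x Px; exists x, 0; rewrite mulr0 addr0.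
move=> f [p [r [Pp def_f]]]; have [h mon_h Ih] := param_integral r.
pose n := (size h).-1; have szh : size h = n.+1 by rewrite prednK // size_poly_gt0 monic_neq0.
have hn : h`_n = 1 by have /monicP := mon_h.
pose g := \sum_(i < n.+1) h`_i * 'X_(Ordinal lt_td) ^+ (n - i) * f ^+ i.
have Pg : P (param g).
  rewrite rmorph_sum; apply: (ideal_eqr Pi (b := \sum_(i < n.+1) W ^+ n * (param h`_i * r ^+ i))).
    rewrite -sumrB; apply: (ideal_sum Pi) => -[i /= lt_i] _.
    rewrite !rmorphM !rmorphXn /= paramX -/W def_f.
    have -> : W ^+ n * (param h`_i * r ^+ i) = param h`_i * W ^+ (n - i) * (W * r) ^+ i.
      by rewrite exprMn -{1}(subnK (lt_i : (i <= n)%N)) exprD; ring.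
    rewrite -mulrBr; apply: (ideal_mull Pi); apply: (ideal_exp Pi).
    by rewrite addrK.
  by rewrite -mulr_sumr; apply: (ideal_mull Pi); apply: sIP; rewrite szh in Ih.
have := overP _ Pg => /(congr1 (kill t.+1)); rewrite kill_kill rmorph0 rmorph_sum.
rewrite big_ord_recr big1 => [|[i lt_i] _] /=; last first.
  by rewrite !rmorphM !rmorphXn /= killX /= ltnSn expr0n subn_eq0 leqNgt lt_i mulr0 mul0r.
rewrite add0r subnn expr0 mulr1 hn mul1r rmorphXn /= => /eqP.
by rewrite expf_eq0 => /andP[_ /eqP].
Qed.

(** Enlarging the maximal [J] by [a] or by [b] yields parameter polynomials [f] and [g] that are not
    killed; if [J] contained [a * b], it would contain the image of [f * g], and [kill] is
    multiplicative into a domain. *)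
Lemma cone_prime t P J : cone t P J -> (forall J', (forall x, J x -> J' x) -> cone t P J' ->
  forall x, J' x -> J x) -> prime_ideal J.
Proof.
move=> [Ji sPJ overJ] maxJ; split=> // [J1|a b Jab].
  have /overJ/eqP : J (param 1) by rewrite rmorph1.
  by rewrite rmorph1 oner_eq0.
apply: boolp.contrapT => /boolp.not_orP[nJa nJb].
have ext c : ~ J c -> exists f x r, [/\ J x, param f = x + c * r & kill t f != 0].
  move=> nJc; apply: boolp.contrapT => nof; apply: nJc.
  apply: (maxJ (fun y => exists x r, J x /\ y = x + c * r)); last first.
  - by exists 0, 1; rewrite mulr1 add0r; split=> //; exact: ideal0 Ji.
  - split.
    + split; first by exists 0, 0; rewrite mulr0 addr0; split=> //; exact: ideal0 Ji.
        move=> _ _ [p [r [Pp ->]]] [p' [r' [Pp' ->]]]; exists (p + p'), (r + r').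
        by split; [exact: (idealD Ji)|ring].
      move=> e _ [p [r [Pp ->]]]; exists (e * p), (e * r).
      by split; [exact: (ideal_mull Ji)|ring].
    + by move=> x Px; exists x, 0; rewrite mulr0 addr0; split=> //; exact: sPJ.
    move=> f [x [r [Jx def_f]]]; apply/eqP/negPn/negP => kf; apply: nof.
    by exists f, x, r.
  - by move=> x Jx; exists x, 0; rewrite mulr0 addr0.
have [f [x [r [Jx def_f kf]]]] := ext a nJa; have [g [y [v [Jy def_g kg]]]] := ext b nJb.
suff /overJ/eqP : J (param (f * g)) by rewrite rmorphM mulf_eq0 (negPf kf) (negPf kg).
rewrite rmorphM /= def_f def_g.
have -> : (x + a * r) * (y + b * v) = (y + b * v) * x + (a * r) * y + (r * v) * (a * b) by ring.
by apply: (idealD Ji); [apply: (idealD Ji)|]; exact: (ideal_mull Ji).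
Qed.

Lemma cone_max t P J0 : cone t P J0 -> exists J, cone t P J /\
  (forall x, J0 x -> J x) /\
  (forall J', (forall x, J x -> J' x) -> cone t P J' -> forall x, J' x -> J x).
Proof.
move=> coneJ0.
pose good (J : classical_sets.set S) := (forall x, ~ J x) \/ (cone t P J /\ forall x, J0 x -> J x).
have [|J [[J_empty|[coneJ sJ]] maxJ]] := @classical_sets.Zorn_bigcup S good.
- move=> F F_good F_chain.
  have [[A [FA [a Aa]]]|noA] := boolp.pselect (exists A, F A /\ exists a, A a); last first.
    by left=> x [A FA Ax]; apply: noA; exists A; split=> //; exists x.
  have goodF C x : F C -> C x -> cone t P C /\ forall x, J0 x -> C x.
    by move=> FC Cx; case: (F_good C FC) => // /(_ x)/(_ Cx).
  have [[Ai sPA overA] sJA] := goodF A a FA Aa.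
  right; split; last by move=> x /sJA Ax; exists A.
  split; last first.
  + by move=> f [C FC Cf]; have [[_ _ overC] _] := goodF C _ FC Cf; exact: overC.
  + by move=> x /sPA Ax; exists A.
  split; first by exists A => //; exact: ideal0 Ai.
    move=> x y [C FC Cx] [C' FC' C'y].
    have [[Ci _ _] _] := goodF C x FC Cx; have [[C'i _ _] _] := goodF C' y FC' C'y.
    case: (F_chain C C' FC FC') => [sC|sC].
      by exists C' => //; apply: (idealD C'i) => //; exact: sC.
    by exists C => //; apply: (idealD Ci) => //; exact: sC.
  move=> x y [C FC Cy]; have [[Ci _ _] _] := goodF C y FC Cy.
  by exists C => //; exact: (ideal_mull Ci).
- have [] : ~ good J0; last by right.
  apply: maxJ; split=> [x /J_empty //|sJ0J].
  by have [J0i _ _] := coneJ0; apply: (J_empty 0); apply: sJ0J; exact: ideal0 J0i.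
exists J; split=> //; split=> // J' sJJ' coneJ' x J'x.
apply: boolp.contrapT => nJx; have [] : ~ good J'; last first.
  by right; split=> // y /sJ/sJJ'.
by apply: maxJ; split=> // sJ'J; apply/nJx/sJ'J.
Qed.

Lemma going_up t P : (t < d)%N -> prime_ideal P -> (forall x, I x -> P x) -> over t P ->
  exists P', [/\ prime_ideal P', forall x, P x -> P' x, over t.+1 P' & exists x, P' x /\ ~ P x].
Proof.
move=> lt_td primeP sIP overP; have cone0 := cone_start lt_td primeP sIP overP.
have [J [coneJ [sJ maxJ]]] := cone_max cone0; have [Ji sPJ overJ] := coneJ.
exists J; split=> //; first exact: cone_prime coneJ maxJ.
exists (w (Ordinal lt_td)); split.
  apply: sJ; exists 0, 1; rewrite mulr1 add0r; split=> //.
  by case: primeP => Pi _ _; exact: ideal0 Pi.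
(* The next parameter is not in [P] because [kill t] leaves it unchanged. *)
rewrite -paramX => /overP; rewrite killX ltnn => /eqP.
by rewrite -msupp_eq0 msuppX.
Qed.

Lemma going_up_chain : prime_ideal I -> (forall f, I (param f) -> f = 0) ->
  exists P, prime_chain I d P.
Proof.
move=> primeI inj_param.
suff [P [chainP _]] : exists P, prime_chain I d P /\ over d (P d) by exists P.
suff : forall t, (t <= d)%N -> exists P, prime_chain I t P /\ over t (P t) by apply.
elim=> [|t IHt] lt_t.
  by exists (fun=> I); split=> [|f /inj_param ->]; [split | rewrite rmorph0].
have [P [[primeP strictP] overP]] := IHt (ltnW lt_t).
have [prPt sIPt] := primeP t (leqnn t).
have [P' [prP' sPP' overP' [x [P'x nPx]]]] := going_up lt_t prPt sIPt overP.
exists (fun k => if (k <= t)%N then P k else P'); split; last by rewrite ltnn.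
split=> k; rewrite leq_eqVlt.
  case/orP => [/eqP ->|]; last by rewrite ltnS => le_k; rewrite le_k; exact: primeP.
  by rewrite ltnn; split=> // y /sIPt/sPP'.
case/orP => [/eqP[->]|]; first by rewrite leqnn ltnn; split=> //; exists x.
by rewrite ltnS => lt_k; rewrite (ltnW lt_k) lt_k; exact: strictP.
Qed.

End GoingUp.

Section PointEvaluation.
Variable K : numFieldType.

Lemma poly_eq0_points (p : {poly K}) : (forall a, p.[a] = 0) -> p = 0.
Proof.
move=> p0; apply/eqP; apply: contraT => nz.
have := max_poly_roots (rs := [seq i%:R | i <- iota 0 (size p)]) nz.
rewrite size_map size_iota ltnn => -> //.
  by apply/allP => _ /mapP[i _ ->]; rewrite /root p0.
by rewrite map_inj_uniq ?iota_uniq // => i j /eqP; rewrite eqr_nat => /eqP.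
Qed.

Lemma mpoly_eq0_points n (p : {mpoly K[n]}) : (forall v, p.@[v] = 0) -> p = 0.
Proof.
elim: n p => [|n IHn] p p0.
  by have := p0 (fun=> 0); rewrite (mpoly0_const p) mevalC => ->.
rewrite -(muniK p) (_ : muni p = 0) ?rmorph0 //.
apply/polyP => k; rewrite coef0; apply: IHn => v.
pose ext a (i : 'I_n.+1) := oapp v a (insub (i : nat)).
have evalE a : (map_poly (meval v) (muni p)).[a] = 0.
  rewrite -[RHS](p0 (ext a)).
  apply: (mpoly_morph_ext (f := horner_eval a \o (map_poly (meval v) \o @muni n K))
    (g := meval (ext a))) => [c|i] /=.
    by rewrite muniC map_polyC /= /horner_eval hornerC !mevalC.
  have [[j ->]|->] := ord_widen_or_max i.
    by rewrite muniXwiden map_polyC /= /horner_eval hornerC !mevalXU /ext /= valK.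
  by rewrite muniXmax map_polyX /horner_eval hornerX mevalXU /ext /= insubF ?ltnn.
have /(congr1 (fun f : {poly K} => f`_k)) := poly_eq0_points evalE.
by rewrite coef0 coef_map.
Qed.

End PointEvaluation.

Section MonicProducts.
Variables (R : idomainType) (T : finType) (P : pred T) (a : T -> R) (n : T -> nat).

Lemma monic_prod_XsubC : \prod_(i | P i) ('X - (a i)%:P) ^+ n i \is monic.
Proof. by apply: monic_prod => i _; rewrite monic_exp ?monicXsubC. Qed.

Lemma size_prod_XsubC_gt1 i0 : P i0 -> (0 < n i0)%N ->
  (1 < size (\prod_(i | P i) ('X - (a i)%:P) ^+ n i)%R)%N.
Proof.
move=> P0 n0; rewrite (bigD1 i0) //= size_Mmonic ?expf_neq0 ?polyXsubC_eq0 //; last first.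
  by apply: monic_prod => i _; rewrite monic_exp ?monicXsubC.
set p := \prod_(_ | _) _; have : (0 < size p)%N.
  by rewrite size_poly_gt0 monic_neq0 // monic_prod // => i _; rewrite monic_exp ?monicXsubC.
by rewrite size_exp_XsubC; move: (size p) (n i0) n0 => x y; lia.
Qed.

End MonicProducts.

Section BlockDimension.
Variables (K : numClosedFieldType) (N s q : nat) (B : block_data K N s q).
Local Notation S := {mpoly K[N]}.
Local Notation Y := {mpoly K[q]}.
Local Notation bet := (blk B).
Local Notation lam := (wexp B).

Variable tau : 'I_s -> 'I_N.
Hypothesis tauK : forall i, bet (tau i) = i.
Local Notation off := [pred j | j != tau (bet j)].

(** With [z_j] the difference of [X_j] and the chosen variable [x] of block [i], the relation says
    that the product of the [(x + z_j) ^ lam j] is [ell_i(y)]. It is monic in [x], so everything is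
    integral over the [y_b] and the [z_j]. *)
Definition sysparam (k : 'I_(q + #|off|)) : S :=
  match split k with
  | inl b => yhat B b
  | inr k => 'X_(enum_val k) - 'X_(tau (bet (enum_val k)))
  end.

Local Notation A0 := {mpoly K[q + #|off|]}.
Local Notation par := (param sysparam).

Definition offset_var j (z : A0) :=
  if j != tau (bet j) then exists2 k : 'I_#|off|, enum_val k = j & z = 'X_(rshift q k) else z = 0.

Lemma offset_var_exists : exists z : 'I_N -> A0, forall j, offset_var j (z j).
Proof.
have choosable j : exists z, offset_var j z; last first.
  by have [z zP] := boolp.choice choosable; exists z.
have [joff|nj] := boolP (j \in off); last first.
  by exists 0; rewrite /offset_var; move: nj; rewrite inE => /negPf ->.
rewrite /offset_var; move: (joff); rewrite inE => ->.
by exists 'X_(rshift q (enum_rank_in joff j)), (enum_rank_in joff j) => //; exact: enum_rankK_in.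
Qed.

Definition yemb : Y -> A0 := mmap (@mpolyC _ K) (fun b => 'X_(lshift #|off| b)).
HB.instance Definition _ := GRing.RMorphism.copy yemb
  (mmap (@mpolyC _ K) (fun b => 'X_(lshift #|off| b))).
Arguments yemb : simpl never.

Lemma yembX b : yemb 'X_b = 'X_(lshift #|off| b).
Proof. by rewrite /yemb mmapX mmap1U. Qed.

Lemma param_yemb h : par (yemb h) = ysub B h.
Proof.
apply: (mpoly_morph_ext (f := par \o yemb) (g := ysub B)) => [c|b] /=.
  by rewrite /yemb mmapC paramC ysubC.
rewrite yembX paramX ysubX /sysparam; case: splitP => k /= def_b.
  by congr (yhat B _); apply/val_inj/esym.
by have := ltn_ord b; rewrite def_b ltnNge leq_addr.
Qed.

Lemma param_offset z j : offset_var j z -> par z = 'X_j - 'X_(tau (bet j)).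
Proof.
rewrite /offset_var /=; case: ifPn => [_ [k <- ->]|/negPn/eqP <- ->]; last by rewrite rmorph0 subrr.
rewrite paramX /sysparam; case: splitP => k' /= def_k.
  by have := ltn_ord k'; rewrite -def_k ltnNge leq_addr.
by have -> : k = k' by apply/val_inj/(@addnI q).
Qed.

Lemma tm_prod i : 'X_[tm B i] = \prod_(j | bet j == i) 'X_j ^+ lam j :> S.
Proof.
rewrite mpolyXE_id [RHS]big_mkcond; apply: eq_bigr => j _.
by rewrite mnmE; case: eqP; rewrite ?mul1n ?mul0n ?expr0.
Qed.

Lemma sysparam_integral x : exists2 p : {poly A0}, p \is monic &
  blockI B (\sum_(i < size p) par p`_i * x ^+ i).
Proof.
have [E def_tau] := kummer_ext_exists tauK.
pose f : {rmorphism A0 -> ke_field E} := Phi E \o par.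
suff [p mon_p] : integralOver f (Phi E x).
  rewrite /root horner_poly => /eqP p0; exists p => //; apply: (Phi_kernel (E := E)).
  by rewrite rmorph_sum -[RHS]p0; apply: eq_bigr => i _ /=; rewrite rmorphM rmorphXn.
have [z zP] := offset_var_exists.
have int_tau i : integralOver f (Phi E 'X_(tau i)).
  pose p := \prod_(j | bet j == i) ('X - (- z j)%:P) ^+ lam j.
  have szp : (1 < size p)%N.
    by apply: (@size_prod_XsubC_gt1 _ _ _ _ _ (tau i)); rewrite ?tauK ?wexp_gt0.
  exists (p - (yemb (ell B i))%:P).
    rewrite monicE lead_coefDl ?(monicP (monic_prod_XsubC _ _ _)) // size_polyN.
    by apply: leq_ltn_trans (size_polyC_leq1 _) szp.
  rewrite /root rmorphB /= map_polyC hornerD hornerN hornerC /p rmorph_prod horner_prod /=.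
  rewrite param_yemb Phi_ysub -(Phi_tm E i).
  rewrite tm_prod rmorph_prod subr_eq0; apply/eqP/eq_bigr => j /eqP def_i /=.
  rewrite !rmorphXn rmorphB /= map_polyX map_polyC horner_exp hornerXsubC /=.
  have -> : par (- z j) = 'X_(tau i) - 'X_j by rewrite rmorphN /= (param_offset (zP j)) def_i opprB.
  by rewrite -rmorphB opprB addrC subrK.
have int_X j : integralOver f (Phi E 'X_j).
  rewrite -[X in Phi E X](subrK 'X_(tau (bet j))) rmorphD /=; apply: integral_add => //.
  by rewrite -(param_offset (zP j)); exact: (integral_id f).
rewrite (mpolyE x) rmorph_sum; apply: big_ind => [|a b|m _].
- exact: integral0.
- exact: integral_add.
rewrite -mul_mpolyC rmorphM /=; apply: integral_mul.
  by rewrite -(paramC sysparam); exact: (integral_id f).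
rewrite mpolyXE_id rmorph_prod; apply: big_ind => [|a b|j _].
- exact: integral1.
- exact: integral_mul.
rewrite rmorphXn /=; elim: (m j) => [|n IHn]; first by rewrite expr0; exact: integral1.
by rewrite exprS; exact: integral_mul.
Qed.

(** Over an algebraically closed field all values [v] of the parameters are taken at points of the
    variety, found by solving one monic equation per block. Hence [f] vanishes at every [v]. *)
Lemma sysparam_free f : blockI B (par f) -> f = 0.
Proof.
move=> If; apply: mpoly_eq0_points => v; have [z zP] := offset_var_exists.
pose y b := v (lshift #|off| b).
have /boolp.choice[x0 x0P] : forall i, exists x : K,
    \prod_(j | bet j == i) (x + (z j).@[v]) ^+ lam j = (ell B i).@[y].
  move=> i; pose p := \prod_(j | bet j == i) ('X - (- (z j).@[v])%:P) ^+ lam j - (ell B i).@[y]%:P.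
  have : size p != 1%N.
    have [j0 def_i] := blk_surj B i; rewrite size_polyDl ?size_polyN.
      by rewrite gtn_eqF // (@size_prod_XsubC_gt1 _ _ _ _ _ j0) ?def_i ?wexp_gt0.
    apply: leq_ltn_trans (size_polyC_leq1 _) _.
    by rewrite (@size_prod_XsubC_gt1 _ _ _ _ _ j0) ?def_i ?wexp_gt0.
  case/closed_rootP => x; rewrite /root hornerD hornerN hornerC subr_eq0 horner_prod => /eqP <-.
  by exists x; apply: eq_bigr => j _; rewrite horner_exp hornerXsubC opprK.
pose x j := x0 (bet j) + (z j).@[v].
have evtm i : 'X_[tm B i].@[x] = (ell B i).@[y].
  rewrite tm_prod rmorph_prod -x0P; apply: eq_bigr => j /eqP def_i /=.
  by rewrite rmorphXn /= mevalXU /x def_i.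
have ev0 p : blockI B p -> p.@[x] = 0.
  move: p; apply: gen_ideal_sub => [|_ [w [Aw0 ->]]]; first exact: ker_ideal.
  rewrite rmorph_sum /=; under eq_bigr do rewrite mevalZ evtm -mevalZ.
  by rewrite -rmorph_sum /= (ell_relation Aw0) rmorph0.
rewrite -(ev0 _ If); apply: (mpoly_morph_ext (f := meval v) (g := meval x \o par)) => [c|k] /=.
  by rewrite paramC !mevalC.
rewrite paramX mevalXU /sysparam; case: (splitP k) => [b def_k|k' def_k].
  have -> : k = lshift #|off| b by exact: val_inj.
  rewrite /yhat rmorph_sum /=; under eq_bigr do rewrite mevalZ evtm -mevalZ.
  by rewrite -rmorph_sum /= -var_ell mevalXU.
have -> : k = rshift q k' by exact: val_inj.
rewrite mevalB !mevalXU /x tauK opprD addrACA subrr add0r.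
have := zP (tau (bet (enum_val k'))); rewrite /offset_var /= tauK eqxx => ->.
rewrite meval0 subr0; have := zP (enum_val k'); rewrite /offset_var ifT.
  by case=> k2 /enum_val_inj -> ->; rewrite mevalXU.
by have := enum_valP k'; rewrite inE.
Qed.

End BlockDimension.

Lemma block_dim (K : numClosedFieldType) N s q (B : block_data K N s q) :
  quot_dim (blockI B) (N - s + q).
Proof.
split=> [|d' P]; last exact: growth_bound (block_growth (B := B)).
have /boolp.choice[tau tauK] := blk_surj B.
rewrite addnC -(card_off tauK).
apply: (@going_up_chain _ _ _ (sysparam (B := B) (tau := tau)) (blockI B)); last first.
- exact: sysparam_free tauK.
- exact: block_prime.
exact: sysparam_integral tauK.
Qed.

(** * Homogeneous elements *)

Section MultiHomogeneous.
Variables (R : idomainType) (n : nat) (T : finType) (cl : 'I_n -> T).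
Local Notation Y := {mpoly R[n]}.
Implicit Types (h : Y) (y : 'X_{1..n}) (D : T -> nat).

Definition cdeg k y := (\sum_(b | cl b == k) y b)%N.

Definition multihom D h := forall y, y \in msupp h -> forall k, cdeg k y = D k.

Lemma cdegD k y y' : cdeg k (y + y')%MM = (cdeg k y + cdeg k y')%N.
Proof. by rewrite /cdeg -big_split; apply: eq_bigr => b _; rewrite mnmDE. Qed.

Lemma multihom0 D : multihom D 0.
Proof. by move=> y; rewrite msupp0. Qed.

Lemma multihom1 : multihom (fun=> 0%N) 1.
Proof.
move=> y; rewrite msupp1 inE => /eqP -> k.
by rewrite /cdeg big1 // => b _; rewrite mnm0E.
Qed.

Lemma multihomD D a b : multihom D a -> multihom D b -> multihom D (a + b).
Proof.
by move=> ha hb y /msuppD_le; rewrite mem_cat => /orP[/ha|/hb].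
Qed.

Lemma multihomZ D c a : multihom D a -> multihom D (c *: a).
Proof. by move=> ha y /msuppZ_le /ha. Qed.

Lemma multihom_sum D (I : Type) (r : seq I) (P : pred I) (F : I -> Y) :
  (forall i, P i -> multihom D (F i)) -> multihom D (\sum_(i <- r | P i) F i).
Proof. by move=> hF; apply: big_ind => //; [exact: multihom0 | exact: multihomD]. Qed.

Lemma multihomX y : multihom (fun k => cdeg k y) 'X_[y].
Proof. by move=> y'; rewrite msuppX inE => /eqP ->. Qed.

Lemma multihomM D D' a b : multihom D a -> multihom D' b ->
  multihom (fun k => (D k + D' k)%N) (a * b).
Proof.
move=> ha hb y /msuppM_le /allpairsP[[m m'] /= [ma mb ->]] k.
by rewrite cdegD ha // hb.
Qed.

Lemma multihomXn D a l : multihom D a -> multihom (fun k => (l * D k)%N) (a ^+ l).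
Proof.
move=> ha; elim: l => [|l IHl]; first by rewrite expr0 => y /multihom1 h k; rewrite h.
rewrite exprS => y yP k; rewrite (multihomM ha IHl yP) mulSn //.
Qed.

Lemma multihom_prod (I : finType) (D : I -> T -> nat) (F : I -> Y) :
  (forall i, multihom (D i) (F i)) -> multihom (fun k => (\sum_i D i k)%N) (\prod_i F i).
Proof.
move=> hF; suff : forall r : seq I, multihom (fun k => (\sum_(i <- r) D i k)%N) (\prod_(i <- r) F i) by apply.
elim=> [|i r IHr].
  by rewrite big_nil => y /multihom1 h k; rewrite h big_nil.
by rewrite big_cons => y yP k; rewrite big_cons (multihomM (hF i) IHr yP).
Qed.

(* Multihomogeneity becomes divisibility of a power of ['X], which passes to factors. *)
Definition stretch k : Y -> {poly Y} :=
  mmap (polyC \o @mpolyC n R) (fun b => ('X_b)%:P * 'X^(cl b == k)).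

HB.instance Definition _ k := GRing.RMorphism.copy (stretch k)
  (mmap (polyC \o @mpolyC n R) (fun b => ('X_b)%:P * 'X^(cl b == k))).

Arguments stretch : simpl never.

Lemma stretchX k y : stretch k 'X_[y] = ('X_[y])%:P * 'X^(cdeg k y).
Proof.
rewrite /stretch mmapX /mmap1 [in RHS]mpolyXE_id rmorph_prod /cdeg.
rewrite [(\sum_(b | _) _)%N]big_mkcond -prodrXr -big_split; apply: eq_bigr => b _ /=.
rewrite exprMn rmorphXn -exprM; congr (_ * _ ^+ _).
by case: eqP; rewrite ?mul1n ?mul0n.
Qed.

Lemma stretchE k h : stretch k h = \sum_(y <- msupp h) (h@_y *: 'X_[y])%:P * 'X^(cdeg k y).
Proof.
rewrite {1}(mpolyE h) rmorph_sum; apply: eq_bigr => y _ /=.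
rewrite -!mul_mpolyC !rmorphM /= stretchX mulrA; congr (_ * _ * _).
exact: mmapC.
Qed.

Lemma stretch_coef k h y : y \in msupp h -> ((stretch k h)`_(cdeg k y))@_y = h@_y.
Proof.
move=> yh; rewrite stretchE coef_sum raddf_sum (bigD1_seq y) ?msupp_uniq //= big1 ?addr0.
  by rewrite coefCM coefXn eqxx mulr1 mcoeffZ mcoeffX eqxx mulr1.
move=> y' ny; rewrite coefCM coefXn; case: eqP => _; last by rewrite mulr0 mcoeff0.
by rewrite mulr1 mcoeffZ mcoeffX (negPf ny) mulr0.
Qed.

Lemma multihom_stretch D k h : multihom D h -> stretch k h = h%:P * 'X^(D k).
Proof.
move=> hh; rewrite stretchE [in RHS](mpolyE h) rmorph_sum mulr_suml.
by apply: eq_big_seq => y /hh ->.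
Qed.

Lemma monomial_divisor (A : idomainType) (f g : {poly A}) c l : f * g = c%:P * 'X^l -> c != 0 ->
  exists c' i, f = c'%:P * 'X^i.
Proof.
elim: l f g => [|l IHl] f g eq_fg c0.
  have fg0 : f * g != 0 by rewrite eq_fg expr0 mulr1 polyC_eq0.
  have := congr1 (fun p : {poly A} => size p) eq_fg; rewrite expr0 mulr1 size_polyC c0.
  move: fg0; rewrite mulf_eq0 negb_or => /andP[f0 g0]; rewrite size_mul // => sz.
  have szf : (size f <= 1)%N.
    by move: f0 g0 sz; rewrite -!size_poly_gt0; move: (size f) (size g) => x y; lia.
  by exists f`_0, 0%N; rewrite expr0 mulr1 -size1_polyC.
have : root (f * g) 0 by rewrite /root eq_fg hornerM hornerXn expr0n mulr0.
have X0 : ('X : {poly A}) != 0 by rewrite -size_poly_eq0 size_polyX.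
rewrite rootM => /orP[] /factor_theorem[f']; rewrite subr0 => def_f'.
  have [|c' [i def_i]] := IHl f' g _ c0.
    by apply: (mulIf X0); rewrite mulrAC -def_f' eq_fg exprSr mulrA.
  by exists c', i.+1; rewrite def_f' def_i exprSr mulrA.
by apply: (IHl f f' _ c0); apply: (mulIf X0); rewrite -mulrA -def_f' eq_fg exprSr mulrA.
Qed.

Lemma multihom_factor D a b : multihom D (a * b) -> a * b != 0 -> exists D', multihom D' a.
Proof.
move=> hab ab0.
have hk k : exists d, forall y, y \in msupp a -> cdeg k y = d.
  have := multihom_stretch k hab; rewrite rmorphM => /monomial_divisor/(_ ab0)[c [d def_d]].
  exists d => y ya; have := stretch_coef k ya; rewrite def_d coefCM coefXn.
  case: eqP => // _; rewrite mulr0 mcoeff0 => /esym/eqP.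
  by rewrite mcoeff_eq0 ya.
have [D' D'P] := boolp.choice hk; exists D' => y ya k; exact: D'P.
Qed.

End MultiHomogeneous.

Lemma posz_sum (I : Type) (r : seq I) (Q : pred I) (F : I -> nat) :
  (\sum_(i <- r | Q i) F i)%N = \sum_(i <- r | Q i) (F i)%:Z :> int.
Proof. exact: (big_morph Posz PoszD). Qed.

Section InImP.
Variables (K : fieldType) (N k : nat) (P : 'M[int]_(k, N)).
Local Notation S := {mpoly K[N]}.
Local Notation deg := (@Defs.mdeg N).
Implicit Types (m e : 'X_{1..N}) (w : 'rV[int]_N) (p : S).

Lemma in_imP0 : in_imP P 0.
Proof. by exists 0; rewrite mul0mx. Qed.

Lemma in_imPN w : in_imP P w -> in_imP P (- w).
Proof. by case=> z ->; exists (- z); rewrite mulNmx. Qed.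

Lemma in_imPD w w' : in_imP P w -> in_imP P w' -> in_imP P (w + w').
Proof. by move=> [z ->] [z' ->]; exists (z + z'); rewrite mulmxDl. Qed.

Lemma in_imPB w w' : in_imP P w -> in_imP P w' -> in_imP P (w - w').
Proof. by move=> Pw /in_imPN; exact: in_imPD. Qed.

Lemma degD m e : deg (m + e)%MM = deg m + deg e.
Proof. by apply/rowP => j; rewrite !mxE mnmDE PoszD. Qed.

Lemma deg0 : deg 0%MM = 0.
Proof. by apply/rowP => j; rewrite !mxE mnm0E. Qed.

Lemma KhomogP p : Khomog P p <->
  (forall m m', m \in msupp p -> m' \in msupp p -> in_imP P (deg m - deg m')).
Proof.
split=> [[w hw] m m' /hw mP /hw m'P|hp]; first by rewrite -(subrKA w) -[w - _]opprB; exact: in_imPB.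
have [->|p0] := eqVneq p 0; first by exists 0 => m; rewrite msupp0.
by exists (deg (mlead p)) => m mp; apply: hp => //; exact: mlead_supp.
Qed.

End InImP.

(** * Normal forms of homogeneous elements *)

Section BlockGrading.
Variables (K : numClosedFieldType) (N s q k : nat) (B : block_data K N s q).
Variables (P : 'M[int]_(k, N)) (T : finType) (col : 'I_s -> T) (coly : 'I_q -> T).
Local Notation S := {mpoly K[N]}.
Local Notation Y := {mpoly K[q]}.
Local Notation bet := (blk B).
Local Notation lam := (wexp B).
Local Notation II := (blockI B).
Local Notation deg := (@Defs.mdeg N).
Local Notation mhom := (@multihom K q T coly).
Let IIi := blockI_ideal B.

(** Under [in_imPP] the relations of the grading group are the integer combinations of the [t_i]
    whose coefficients sum to zero within each colour; so [t_i] of the same colour have the same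
    degree. *)
Definition balanced (z : 'I_s -> int) := forall c, \sum_(i | col i == c) z i = 0.

Hypothesis in_imPP : forall w : 'rV[int]_N, in_imP P w <->
  exists2 z : 'I_s -> int, balanced z & forall j, w 0 j = z (bet j) * (lam j)%:Z.
Hypothesis cmx_col : forall b i, cmx B b i != 0 -> coly b = col i.
Hypothesis cinv_col : forall i b, cinv B i b != 0 -> coly b = col i.
Implicit Types (m e : 'X_{1..N}) (p : S) (h : Y) (z : 'I_s -> int).

Lemma quo_shift m m' z : (forall j, (m j)%:Z = (m' j)%:Z + z (bet j) * (lam j)%:Z) ->
  red B m = red B m' /\ forall i, (quo B m i)%:Z = (quo B m' i)%:Z + z i.
Proof.
(* Exponents are natural numbers, so [z] is split into its positive part [c] and its negative part
   [c']. *)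
move=> eq_m; pose c i := if 0 <= z i then `|z i|%N else 0%N.
pose c' i := if 0 <= z i then 0%N else `|z i|%N.
have zE i : (c i)%:Z = (c' i)%:Z + z i.
  by rewrite /c /c'; case: ifP => zi; lia.
have eq_mc : (m + tsum B c' = m' + tsum B c)%MM.
  apply/mnmP => j; have := eq_m j; have := zE (bet j); rewrite !mnmDE !mnmE.
  move: (c _) (c' _) (z _) (lam j) (m j) (m' j) => a b x l y y' eq_a eq_y.
  by apply/eqP; rewrite -eqz_nat !PoszD !PoszM eq_y eq_a; apply/eqP; ring.
split; first by rewrite -(red_tsum B m c') eq_mc red_tsum.
move=> i; have := quo_tsum B m c' i; rewrite eq_mc quo_tsum; have := zE i.
by move: (quo _ _ _) (quo _ _ _) (c i) (c' i) (z i); lia.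
Qed.

Lemma imP_shift m m' : in_imP P (deg m - deg m') -> red B m = red B m' /\
  forall c, (\sum_(i | col i == c) quo B m i = \sum_(i | col i == c) quo B m' i)%N.
Proof.
case/in_imPP=> z bal_z def_z; have [|eq_red quoE] := @quo_shift m m' z.
  by move=> j; have := def_z j; rewrite !mxE => /eqP; rewrite subr_eq addrC => /eqP.
split=> // c; apply/eqP; rewrite -eqz_nat !posz_sum (eq_bigr _ (fun i _ => quoE i)) big_split /=.
by rewrite bal_z addr0.
Qed.

Lemma multihom_ell i : mhom (fun c => col i == c : nat) (ell B i).
Proof.
apply: multihom_sum => b _; have [->|cb] := eqVneq (cmx B b i) 0.
  by rewrite scale0r; exact: multihom0.
apply: multihomZ => y /multihomX hy c; rewrite hy /cdeg -(cmx_col cb).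
have [<-|nc] := eqVneq (coly b) c.
  rewrite (bigD1 b) //= mnm1E eqxx big1 // => b' /andP[_ nb].
  by rewrite mnm1E eq_sym (negPf nb).
rewrite big1 // => b' /eqP def_c; rewrite mnm1E; case: eqP => // eq_b.
by rewrite -def_c -eq_b eqxx in nc.
Qed.

Lemma multihom_mval m : mhom (fun c => (\sum_(i | col i == c) quo B m i)%N) (mval B m).
Proof.
have hm := multihom_prod (fun i => multihomXn (l := quo B m i) (multihom_ell (i := i))).
move=> y yP c; rewrite (hm y yP) [RHS]big_mkcond; apply: eq_bigr => i _.
by case: eqP; rewrite ?muln1 ?muln0.
Qed.

(** Monomials of equal degree differ by a balanced shift, so they have the same reduced part and the
    same number of factors [t_i] of each colour. The first fact leaves one coordinate, the second
    makes it multihomogeneous. *)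
Lemma homog_split p : Khomog P p -> exists e D h, mhom D h /\ II (p - ysub B h * 'X_[e]).
Proof.
have [->|p0] := eqVneq p 0.
  move=> _; exists 0%MM, (fun=> 0%N), 0; rewrite rmorph0 mul0r subr0.
  by split; [exact: multihom0 | exact: ideal0 IIi].
move/KhomogP=> hp; set m0 := mlead p; have m0p : m0 \in msupp p := mlead_supp p0.
have shift m : m \in msupp p -> red B m = red B m0 /\
    forall c, (\sum_(i | col i == c) quo B m i = \sum_(i | col i == c) quo B m0 i)%N.
  by move=> mp; apply/imP_shift/hp.
exists (red B m0), (fun c => (\sum_(i | col i == c) quo B m0 i)%N), (NF B (red B m0) p); split.
  rewrite /NF /mlin big_seq_cond; apply: multihom_sum => m; rewrite andbT => mp.
  have [-> eq_quo] := shift m mp; rewrite eqxx; apply: multihomZ => y yP c.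
  by rewrite (multihom_mval yP) eq_quo.
have := blockI_normal B p; rewrite (_ : undup _ = [:: red B m0]) ?big_seq1 //.
apply: perm_small_eq => //; apply: uniq_perm; rewrite ?undup_uniq // => e.
rewrite mem_undup inE; apply/mapP/eqP => [[m mp ->]|->]; last by exists m0.
by have [] := shift m mp.
Qed.

(** Monomials in the [t_i] with [D x] factors of colour [x]. These are the terms of [ysub h] for [h]
    of multidegree [D], and they all have the same degree in the grading group. *)
Definition tform D m := exists c, m = tsum B c /\
  forall x, (\sum_(i | col i == x) c i)%N = D x :> nat.

Lemma tform_imP D m m' : tform D m -> tform D m' -> in_imP P (deg m - deg m').
Proof.
move=> [c [-> cD]] [c' [-> c'D]]; apply/in_imPP; exists (fun i => (c i)%:Z - (c' i)%:Z).
  by move=> x; rewrite sumrB -!posz_sum cD c'D subrr.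
by move=> j; rewrite !mxE !mnmE !PoszM mulrBl.
Qed.

Lemma tformD D D' m m' : tform D m -> tform D' m' -> tform (fun c => (D c + D' c)%N) (m + m')%MM.
Proof.
move=> [c [-> cD]] [c' [-> c'D]]; exists (fun i => (c i + c' i)%N); split.
  by apply/mnmP => j; rewrite mnmDE !mnmE mulnDl.
by move=> x; rewrite big_split /= cD c'D.
Qed.

Lemma tform_ext D D' m : D =1 D' -> tform D m -> tform D' m.
Proof. by move=> eqD [c [-> cD]]; exists c; split=> // x; rewrite cD eqD. Qed.

Lemma tform0 : tform (fun=> 0%N) 0%MM.
Proof.
exists (fun=> 0%N); split=> [|x]; last exact: big1.
by apply/mnmP => j; rewrite mnm0E.
Qed.

Definition thom D p := forall m, m \in msupp p -> tform D m.

Lemma thom1 : thom (fun=> 0%N) 1.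
Proof. by move=> m; rewrite msupp1 inE => /eqP ->; exact: tform0. Qed.

Lemma thomM D D' p p' : thom D p -> thom D' p' -> thom (fun c => (D c + D' c)%N) (p * p').
Proof.
move=> hp hp' m /msuppM_le /allpairsP[[y y'] /= [/hp yD /hp' y'D ->]]; exact: tformD.
Qed.

Lemma thom_sum D (I : eqType) (r : seq I) (F : I -> S) :
  (forall i, i \in r -> thom D (F i)) -> thom D (\sum_(i <- r) F i).
Proof.
move=> hF; rewrite big_seq; apply: big_ind => [m|a b ha hb m|//]; first by rewrite msupp0.
by move/msuppD_le; rewrite mem_cat => /orP[/ha|/hb].
Qed.

Lemma thomZ D a p : thom D p -> thom D (a *: p).
Proof. by move=> hp m /msuppZ_le /hp. Qed.

Lemma thom_yhat b : thom (fun c => coly b == c : nat) (yhat B b).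
Proof.
apply: thom_sum => i _; have [->|ci] := eqVneq (cinv B i b) 0.
  by rewrite scale0r => m; rewrite msupp0.
apply: thomZ => m; rewrite msuppX inE => /eqP ->; exists (fun i' => (i' == i) : nat); split=> // c.
rewrite (cinv_col ci); have [<-|nc] := eqVneq (col i) c.
  by rewrite (bigD1 i) //= eqxx big1 // => i' /andP[_ /negPf ->].
by rewrite big1 // => i' /eqP def_c; case: eqP => // eq_i; rewrite -def_c eq_i eqxx in nc.
Qed.

Lemma thom_ysub D h : mhom D h -> thom D (ysub B h).
Proof.
move=> hh; rewrite (mpolyE h) rmorph_sum; apply: thom_sum => y yh.
rewrite /= ysubZ; apply: thomZ; rewrite mpolyXE_id rmorph_prod.
suff hr (r : seq 'I_q) : thom (fun c => (\sum_(b <- r) (coly b == c) * y b)%N)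
    (\prod_(b <- r) ysub B ('X_b ^+ y b)).
  move=> m /hr; apply: tform_ext => c; rewrite -(hh y yh) /cdeg [RHS]big_mkcond.
  by apply: eq_bigr => b _; case: eqP; rewrite ?mul1n ?mul0n.
elim: r => [|b r IHr].
  by rewrite big_nil => m /thom1; apply: tform_ext => c; rewrite big_nil.
rewrite big_cons rmorphXn /= ysubX.
have hb l : thom (fun c => (coly b == c) * l)%N (yhat B b ^+ l).
  elim: l => [|l IHl]; first by rewrite expr0 => m /thom1; apply: tform_ext => c; rewrite muln0.
  rewrite exprS => m /(thomM (@thom_yhat b) IHl); apply: tform_ext => c; by rewrite mulnS.
by move=> m /(thomM (hb (y b)) IHr); apply: tform_ext => c; rewrite big_cons.
Qed.

Lemma Khomog_ysub D h e : mhom D h -> Khomog P (ysub B h * 'X_[e]).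
Proof.
move=> hh; apply/KhomogP => m m' /msuppM_le /allpairsP[[y x] /= [yP xP ->]].
move=> /msuppM_le /allpairsP[[y' x'] /= [y'P x'P ->]].
move: xP x'P; rewrite !msuppX !inE => /eqP -> /eqP ->; rewrite !degD opprD addrACA subrr addr0.
exact: tform_imP (thom_ysub hh yP) (thom_ysub hh y'P).
Qed.

End BlockGrading.

Lemma rowMz N (w : 'rV[int]_N) (n : int) j : (w *~ n) 0 j = w 0 j * n.
Proof.
case: n => n; first by rewrite -pmulrn mulmxnE -mulr_natr natz.
by rewrite NegzE mulrNz -pmulrn mxE mulmxnE -mulr_natr natz mulrN.
Qed.

(** * K-primes and factorisation of homogeneous elements *)

Section BlockFactorial.
Variables (K : numClosedFieldType) (N s q k : nat) (B : block_data K N s q).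
Variables (P : 'M[int]_(k, N)) (T : finType) (col : 'I_s -> T) (coly : 'I_q -> T).
Local Notation S := {mpoly K[N]}.
Local Notation Y := {mpoly K[q]}.
Local Notation bet := (blk B).
Local Notation lam := (wexp B).
Local Notation II := (blockI B).
Local Notation deg := (@Defs.mdeg N).
Local Notation mhom := (@multihom K q T coly).
Let IIi := blockI_ideal B.

Hypothesis in_imPP : forall w : 'rV[int]_N, in_imP P w <->
  exists2 z : 'I_s -> int, balanced col z & forall j, w 0 j = z (bet j) * (lam j)%:Z.
Hypothesis cmx_col : forall b i, cmx B b i != 0 -> coly b = col i.
Hypothesis cinv_col : forall i b, cinv B i b != 0 -> coly b = col i.
Implicit Types (m e : 'X_{1..N}) (p : S) (h : Y) (z : 'I_s -> int).

Lemma Khomog_X m : Khomog P ('X_[m] : S).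
Proof.
by apply/KhomogP => m1 m2; rewrite msuppX !inE => /eqP -> /eqP ->; rewrite subrr; exact: in_imP0.
Qed.

(** Every [t_i] is a nonconstant monomial, so all relations vanish at the origin. Vanishing there
    thus certifies a nonunit. *)
Lemma blockI_origin p : II p -> p.@[fun=> 0] = 0.
Proof.
move: p; apply: gen_ideal_sub => [|_ [w [Aw0 ->]]]; first exact: ker_ideal.
rewrite rmorph_sum big1 // => i _ /=; have [j def_i] := blk_surj B i.
rewrite mevalZ mevalX (bigD1 j) //= !mnmE def_i eqxx mul1n expr0n.
by rewrite gtn_eqF ?wexp_gt0 // mul0r mulr0.
Qed.

Lemma nonunit_origin p : p.@[fun=> 0] = 0 -> ~ quot_unit II p.
Proof.
move=> p0 [v /blockI_origin]; rewrite mevalB mevalM p0 mul0r meval1 sub0r => /eqP.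
by rewrite oppr_eq0 oner_eq0.
Qed.

Lemma ysub_origin h : (ysub B h).@[fun=> 0] = h.@[fun=> 0].
Proof.
apply: (mpoly_morph_ext (f := meval (fun=> 0) \o ysub B) (g := meval (fun=> 0))) => [c|b] /=.
  by rewrite ysubC !mevalC.
rewrite ysubX mevalXU /yhat rmorph_sum big1 // => i _ /=.
have [j def_i] := blk_surj B i.
rewrite mevalZ mevalX (bigD1 j) //= !mnmE def_i eqxx mul1n expr0n.
by rewrite gtn_eqF ?wexp_gt0 // mul0r mulr0.
Qed.

Lemma quo_eq0 m j : m j = 0%N -> quo B m (bet j) = 0%N.
Proof.
move=> mj; have := quo_le B m j; rewrite mj leqn0 muln_eq0 => /orP[/eqP //|].
by rewrite gtn_eqF ?wexp_gt0.
Qed.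

Lemma ell_ndiv_mval m j : m j = 0%N -> ~ divides (ell B (bet j)) (mval B m).
Proof.
move=> mj /prime_div_prod-/(_ (prime_ell B _))[i _].
have [->|ni] := eqVneq i (bet j).
  by rewrite quo_eq0 // expr0 => /prime_not_div_unit; apply; [exact: prime_ell | exact: unitr1].
by move=> /prime_div_exp-/(_ (prime_ell B _)); apply: ell_ndiv; rewrite eq_sym.
Qed.

Lemma quot_dvdI (f a b : S) : II (a - b) -> quot_dvd II f b -> quot_dvd II f a.
Proof.
move=> eq_ab [h hP]; exists h; apply: (ideal_trans IIi eq_ab hP).
Qed.

Lemma quot_dvdM (f a b : S) : quot_dvd II f a -> quot_dvd II f (a * b).
Proof.
by case=> h hP; exists (h * b); rewrite mulrA -mulrBl; exact: (ideal_mulr IIi).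
Qed.

(** A nonzero constant term forces every colour degree to be zero, and [h] to be a constant, hence a
    unit. *)
Lemma multihom_origin D h : mhom D h -> h \isn't a GRing.unit -> h.@[fun=> 0] = 0.
Proof.
move=> hh /negP hU; rewrite mevalE big1_seq // => y /andP[_ yh].
have [y0|[b yb]] : y = 0%MM \/ exists b, y b != 0%N.
  have [|nz] := boolp.pselect (exists b, y b != 0%N); first by right.
  by left; apply/mnmP => b; rewrite mnm0E; apply/eqP/negPn/negP => yb; apply: nz; exists b.
  case: hU; have constP y' : y' \in msupp h -> y' = 0%MM.
    move=> y'h; apply/mnmP => b; rewrite mnm0E; have := hh _ y'h (coly b).
    rewrite -(hh _ yh) y0 /cdeg [in RHS]big1 => [|b' _]; last exact: mnm0E.
    by move/eqP; rewrite sum_nat_eq0 => /forall_inP/(_ b (eqxx _))/eqP.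
  have h0 : h != 0 by apply: contraTneq yh => ->; rewrite msupp0.
  rewrite unit_msize; apply/msize_poly1P; exists h@_0.
    by rewrite -mcoeff_msupp -y0.
  apply/mpolyP => y'; rewrite mcoeffC; have [->|ny'] := eqVneq; first by rewrite mulr1.
  by rewrite mulr0; apply: memN_msupp_eq0; apply: contra ny' => /constP ->.
by rewrite (bigD1 b) //= expr0n (negPf yb) mul0r mulr0.
Qed.

Lemma K_prime_normal (f : S) : Khomog P f -> f.@[fun=> 0] = 0 -> ~ II f ->
  (forall e e' h h' g, II (ysub B h * 'X_[e] * (ysub B h' * 'X_[e']) - f * g) ->
     quot_dvd II f (ysub B h * 'X_[e]) \/ quot_dvd II f (ysub B h' * 'X_[e'])) ->
  K_prime P II f.
Proof.
move=> hf f0 nf fP; split=> //; first exact: nonunit_origin.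
move=> a b ha hb [g fg].
have [e [_ [h [_ eq_a]]]] := homog_split in_imPP cmx_col ha.
have [e' [_ [h' [_ eq_b]]]] := homog_split in_imPP cmx_col hb.
have [|/(quot_dvdI eq_a)|/(quot_dvdI eq_b)] := fP e e' h h' g; last 2 first.
- by left.
- by right.
by apply: (ideal_trans IIi _ fg); apply/(ideal_sym IIi)/(ideal_mul IIi).
Qed.

Lemma NF_ysubX h e : NF B (red B e) (ysub B h * 'X_[e]) = h * mval B e.
Proof. by rewrite NF_ysub NFX eqxx. Qed.

Lemma NF_congr e p p' : II (p - p') -> NF B e p = NF B e p'.
Proof. by move/NF_blockI/(_ e)/eqP; rewrite linearB subr_eq0 => /eqP. Qed.

(** If [e] and [e'] both avoid [X_j], divisibility of the product forces [ell_i], with [i] the block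
    of [j], to divide [h h'] times an [mval] prime to it. So [ell_i] divides [h] or [h'], and in the
    quotient [ell_i] is [t_i], a multiple of [X_j]. *)
Lemma K_prime_var j : K_prime P II 'X_j.
Proof.
apply: K_prime_normal.
- exact: Khomog_X.
- by rewrite mevalXU.
- exact: mon_notin.
have dvdX e h : e j != 0%N -> quot_dvd II 'X_j (ysub B h * 'X_[e]).
  move=> ej; exists (ysub B h * 'X_[e - U_(j)]).
  rewrite mulrCA -mpolyXD addmC submK ?lep1mP // subrr; exact: ideal0 IIi.
have dvd_ell e h : divides (ell B (bet j)) h -> quot_dvd II 'X_j (ysub B h * 'X_[e]).
  case=> c ->; apply: quot_dvdM; rewrite rmorphM /=.
  apply: (quot_dvdI (b := ysub B c * 'X_[tm B (bet j)])).
    rewrite -mulrBr; apply: (ideal_mull IIi); apply: (ideal_sym IIi); exact: blockI_tm.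
  by apply: dvdX; rewrite !mnmE eqxx mul1n -lt0n wexp_gt0.
move=> e e' h h' g eq_g.
have [ej|/dvdX] := eqVneq (e j) 0%N; last by left.
have [e'j|/dvdX] := eqVneq (e' j) 0%N; last by right.
have eej : (e + e')%MM j = 0%N by rewrite mnmDE ej e'j.
have red_j : red B (e + e')%MM j = 0%N by have := red_le B (e + e')%MM j; rewrite eej leqn0 => /eqP.
have := var_divides_NF B g red_j; rewrite -(NF_congr _ eq_g) mulrACA -mpolyXD -rmorphM NF_ysubX.
have [_ _ pr] := prime_ell B (bet j); case/pr => [/pr|/ell_ndiv_mval //].
by case=> /dvd_ell; [left | right].
Qed.

(** One coordinate of the product shows that [h] divides [a b] times a product of forms [ell_i],
    none of which it divides. *)
Lemma K_prime_ysub h D : prime_elt h -> mhom D h -> h.@[fun=> 0] = 0 ->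
  (forall i, ~ divides h (ell B i)) -> K_prime P II (ysub B h).
Proof.
move=> prh hh h0 nell; have [hn0 _ prP] := prh.
apply: K_prime_normal.
- rewrite -[ysub B h]mulr1 -mpolyX0; exact: Khomog_ysub hh.
- by rewrite ysub_origin.
- move/NF_blockI/(_ (red B 0)); rewrite -[ysub B h]mulr1 -mpolyX0 NF_ysubX => /eqP.
  by rewrite mulf_eq0 (negPf hn0) (negPf (mval_neq0 _ _)).
move=> e e' a b g eq_g.
have : divides h (a * b * mval B (e + e')%MM).
  exists (NF B (red B (e + e')%MM) g).
  by rewrite [RHS]mulrC -NF_ysub -(NF_congr _ eq_g) [X in NF B _ X]mulrACA -mpolyXD -rmorphM NF_ysubX.
case/prP => [/prP|/prime_div_prod-/(_ prh)[i _ /prime_div_exp-/(_ prh)/nell //]].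
have dvd c x : divides h c -> quot_dvd II (ysub B h) (ysub B c * 'X_[x]).
  case=> d ->; apply: quot_dvdM; exists (ysub B d).
  rewrite rmorphM /= mulrC subrr; exact: ideal0 IIi.
by case=> /dvd; [left | right].
Qed.

(** The scalar [a] collects units on the way; in the end it is absorbed into one K-prime factor. *)
Definition K_factors p := exists (a : K) (fs : seq S),
  [/\ a != 0, forall f, f \in fs -> K_prime P II f & II (p - a *: \prod_(f <- fs) f)].

Lemma K_factorsM p p' : K_factors p -> K_factors p' -> K_factors (p * p').
Proof.
move=> [a [fs [a0 fsP eq_p]]] [b [gs [b0 gsP eq_p']]]; exists (a * b), (fs ++ gs); split.
- by rewrite mulf_neq0.
- by move=> f; rewrite mem_cat => /orP[/fsP|/gsP].
have -> : (a * b) *: \prod_(f <- fs ++ gs) f = (a *: \prod_(f <- fs) f) * (b *: \prod_(f <- gs) f).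
  by rewrite big_cat /= -scalerAl -scalerAr scalerA.
exact: (ideal_mul IIi).
Qed.

Lemma K_factorsI p p' : II (p - p') -> K_factors p' -> K_factors p.
Proof.
move=> eq_p [a [fs [a0 fsP eq_p']]]; exists a, fs; split=> //.
exact: (ideal_trans IIi eq_p eq_p').
Qed.

Lemma K_factorsC (a : K) : a != 0 -> K_factors a%:MP.
Proof.
move=> a0; exists a, [::]; split=> //; rewrite big_nil -mul_mpolyC mulr1 subrr; exact: ideal0 IIi.
Qed.

Lemma K_factors1 f : K_prime P II f -> K_factors f.
Proof.
move=> prf; exists 1, [:: f]; split=> [|g|]; first exact: oner_neq0.
  by rewrite inE => /eqP ->.
rewrite big_seq1 scale1r subrr; exact: ideal0 IIi.
Qed.

Lemma K_factors_prod (I : eqType) (r : seq I) (F : I -> S) :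
  {in r, forall i, K_factors (F i)} -> K_factors (\prod_(i <- r) F i).
Proof.
move=> hF; rewrite big_seq; apply: big_ind => //; last exact: K_factorsM.
by rewrite -(mpolyC1 N K); apply: K_factorsC; exact: oner_neq0.
Qed.

Lemma K_factorsX m : K_factors 'X_[m].
Proof.
rewrite mpolyXE_id; apply: K_factors_prod => j _; elim: (m j) => [|l IHl].
  by rewrite expr0 -(mpolyC1 N K); apply: K_factorsC; exact: oner_neq0.
by rewrite exprS; apply: K_factorsM IHl; apply: K_factors1; exact: K_prime_var.
Qed.

(** A prime associated with some [ell_i] need not give a K-prime: it is a constant times [t_i],
    which splits into variables. *)
Lemma K_factors_ysub h D : prime_elt h -> mhom D h -> K_factors (ysub B h).
Proof.
move=> prh hh; have [h0 hU _] := prh.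
have [[i dvd_h]|nell] := boolp.pselect (exists i, divides h (ell B i)).
  have [u uU def_ell] := prime_div_prime prh (prime_ell B i) dvd_h.
  have /msize_poly1P[a a0 def_u] : msize u == 1%N by rewrite -unit_msize.
  apply: (K_factorsI (p' := (a^-1)%:MP * 'X_[tm B i])); last first.
    by apply: K_factorsM (K_factorsX _); apply: K_factorsC; rewrite invr_eq0.
  have -> : h = (a^-1)%:MP * ell B i.
    by rewrite def_ell def_u mulrA -mpolyCM mulVf // mul1r.
  rewrite rmorphM /= ysubC -mulrBr; apply: (ideal_mull IIi); apply: (ideal_sym IIi); exact: blockI_tm.
apply/K_factors1/(K_prime_ysub prh hh) => [|i dvd_h]; last by apply: nell; exists i.
apply: multihom_origin hh hU.
Qed.

Lemma K_factors_homog p : Khomog P p -> ~ II p -> K_factors p.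
Proof.
move=> hp np; have [e [D [h [hh eq_p]]]] := homog_split in_imPP cmx_col hp.
apply: (K_factorsI eq_p); apply: K_factorsM (K_factorsX _).
have h0 : h != 0.
  apply/eqP => h0; apply: np; apply: (ideal_eqr IIi eq_p).
  by rewrite h0 rmorph0 mul0r; exact: ideal0 IIi.
have [u [ps [uU prps def_h]]] := factorial_Y h0.
have /msize_poly1P[a a0 def_u] : msize u == 1%N by rewrite -unit_msize.
rewrite def_h rmorphM rmorph_prod; apply: K_factorsM.
  by rewrite def_u /= ysubC; exact: K_factorsC.
apply: K_factors_prod => g gps.
have def_hg : g * (u * \prod_(f <- rem g ps) f) = h.
  by rewrite [RHS]def_h (big_rem g gps) /= mulrCA.
have [D' hg] : exists D', mhom D' g.
  by apply: (@multihom_factor _ _ _ _ D g (u * \prod_(f <- rem g ps) f)); rewrite def_hg.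
exact: K_factors_ysub (prps g gps) hg.
Qed.

Lemma quot_dvdZ (a : K) (f g : S) : a != 0 -> quot_dvd II (a *: f) g <-> quot_dvd II f g.
Proof.
move=> a0; split=> [[h hP]|[h hP]].
  by exists (a *: h); rewrite -scalerAr scalerAl.
by exists (a^-1 *: h); rewrite -scalerAl -scalerAr scalerA mulfV // scale1r.
Qed.

Lemma K_primeZ (a : K) f : a != 0 -> K_prime P II f -> K_prime P II (a *: f).
Proof.
move=> a0 [hf nf fU prf]; split=> [|||x y hx hy].
- by apply/KhomogP => m m' /msuppZ_le mf /msuppZ_le m'f; move/KhomogP: hf; apply.
- by move/(idealZ IIi a^-1); rewrite scalerA mulVf // scale1r.
- by case=> v fv; apply: fU; exists (a *: v); rewrite -scalerAr scalerAl.
by move=> /(quot_dvdZ _ _ a0)/(prf _ _ hx hy)[]/(quot_dvdZ _ _ a0); [left | right].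
Qed.

Lemma block_K_factorial : K_factorial P II.
Proof.
split=> [a b _ _|p hp np nU]; first by case: (block_prime B) => _ _; apply.
have [a [[|f fs] [a0 fsP eq_p]]] := K_factors_homog hp np.
  case: nU; exists (a^-1)%:MP; rewrite big_nil in eq_p.
  rewrite (_ : p * _ - 1 = (a^-1)%:MP * (p - a *: 1)); first exact: (ideal_mull IIi).
  by rewrite mulrBr -mul_mpolyC mulr1 -mpolyCM mulVf // mulrC.
exists (a *: f :: fs); split; last by move: eq_p; rewrite !big_cons -scalerAl.
move=> g; rewrite inE => /orP[/eqP ->|gfs]; last by apply: fsP; rewrite inE gfs orbT.
exact: K_primeZ a0 (fsP f (mem_head _ _)).
Qed.

Lemma block_effective : grading_effective P II.
Proof.
move=> u; exists [seq (deg U_(j), u 0 j) | j : 'I_N]; split.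
  move=> _ /mapP[j _ ->]; exists 'X_j; split; last exact: mon_notin.
  by move=> e; rewrite msuppX inE => /eqP ->; rewrite subrr; exact: in_imP0.
rewrite (_ : \sum_(x <- _) _ = u) ?subrr; first exact: in_imP0.
apply/rowP => j; rewrite big_map big_enum summxE (bigD1 j) //= big1 ?addr0 => [|i ni].
  by rewrite rowMz mxE mnm1E eqxx mul1r.
by rewrite rowMz mxE mnm1E (negPf ni) mul0r.
Qed.

(** Nonnegative entries force all [z i] to be nonnegative, and a balanced family of nonnegative
    integers is zero. This is pointedness at the level of monomials. *)
Lemma imP_nat_eq0 m : in_imP P (deg m) -> m = 0%MM.
Proof.
case/in_imPP=> z bal_z zE; have z_ge0 i : 0 <= z i.
  have [j def_i] := blk_surj B i; have := zE j; rewrite !mxE def_i => eq_m.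
  by rewrite -(pmulr_lge0 _ (x := (lam j)%:Z)) ?ltz_nat ?wexp_gt0 // -eq_m.
have z0 i : z i = 0.
  have := bal_z (col i) => /eqP; rewrite psumr_eq0 // => /allP/(_ i).
  by rewrite mem_index_enum eqxx /= => /(_ isT)/eqP.
apply/mnmP => j; have := zE j; rewrite !mxE z0 mul0r mnm0E => /eqP.
by rewrite eqz_nat => /eqP.
Qed.

Lemma block_pointed : grading_pointed P II.
Proof.
split=> [w [p [hp np]] [p' [hp' np']]|p hp].
  have p0 : p != 0 by apply/eqP => p0; apply: np; rewrite p0; exact: ideal0 IIi.
  have p'0 : p' != 0 by apply/eqP => p0'; apply: np'; rewrite p0'; exact: ideal0 IIi.
  have wm := hp _ (mlead_supp p0); have wm' := hp' _ (mlead_supp p'0).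
  have := in_imPD wm wm'; rewrite opprK addrACA addNr addr0 -degD => /imP_nat_eq0 /mnmP m0.
  have lead0 : mlead p = 0%MM.
    by apply/mnmP => j; have := m0 j; rewrite mnmDE !mnm0E => /eqP; rewrite addn_eq0 => /andP[/eqP].
  exists 1%N; split=> //; move: wm; rewrite lead0 deg0 sub0r => /in_imPN.
  by rewrite opprK mulr1n.
exists p@_0; rewrite (_ : p - _ = 0); first exact: ideal0 IIi.
apply/eqP; rewrite subr_eq0; apply/eqP/mpolyP => m; rewrite mcoeffC.
have [->|nm] := eqVneq; first by rewrite mulr1.
rewrite mulr0; apply: memN_msupp_eq0; apply: contra nm => /hp; rewrite subr0.
by move/imP_nat_eq0 => ->.
Qed.

End BlockFactorial.

(** * Rank of the grading group *)

Section RankOfQuotient.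
Variables (N k : nat) (P : 'M[int]_(k, N)) (sg : 'I_k -> 'I_N) (dg : 'I_k -> int).
Hypothesis P_diag : forall i i', P i (sg i') = if i == i' then dg i else 0.
Hypothesis dg_neq0 : forall i, dg i != 0.

Lemma sg_inj : injective sg.
Proof.
move=> i i' eq_sg; have := P_diag i i'; rewrite -eq_sg P_diag eqxx.
by case: eqP => // _ /eqP; rewrite (negPf (dg_neq0 i)).
Qed.

Lemma mul_P_sg (z : 'rV[int]_k) i : (z *m P) 0 (sg i) = z 0 i * dg i.
Proof.
rewrite mxE (bigD1 i) //= P_diag eqxx big1 ?addr0 // => i' ni.
by rewrite P_diag (negPf ni) mulr0.
Qed.

Lemma card_sg : #|[pred j | j \notin codom sg]| = (N - k)%N.
Proof.
have := cardC (mem (codom sg)); rewrite card_codom ?card_ord; last exact: sg_inj.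
by move/(congr1 (subn^~ k)); rewrite addKn => <-; apply: eq_card => j; rewrite !inE.
Qed.

Lemma int_row_kernel a (M : 'M[int]_(a, N)) : (N < a)%N -> exists2 x : 'rV[int]_a, x != 0 & x *m M = 0.
Proof.
move=> lt_Na; pose MQ := map_mx (intr : int -> rat) M.
have /rowV0Pn[v /sub_kermxP vM v0] : kermx MQ != 0.
  rewrite -mxrank_eq0 mxrank_ker subn_eq0 -ltnNge; exact: leq_ltn_trans (rank_leq_col _) lt_Na.
pose x : 'rV[int]_a := \row_i (numq (v 0 i) * \prod_(i' | i' != i) denq (v 0 i')).
pose d : rat := \prod_i (denq (v 0 i))%:~R.
have xE : map_mx intr x = d *: v.
  apply/rowP => i; rewrite !mxE rmorphM /= rmorph_prod /= numqE /d [in RHS](bigD1 i) //=.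
  by rewrite -mulrA mulrC.
have d0 : d != 0 by apply/prodf_neq0 => i _; rewrite intr_eq0 denq_neq0.
exists x.
  apply: contraNneq v0 => x0; move: xE; rewrite x0 map_mx0 => /esym/eqP.
  by rewrite scaler_eq0 (negPf d0).
have /rowP xM0 : map_mx (intr : int -> rat) (x *m M) = 0.
  by rewrite map_mxM xE -scalemxAl vM scaler0.
apply/rowP => j; have xMj := xM0 j; rewrite [LHS]mxE [RHS]mxE in xMj.
by rewrite [RHS]mxE; apply/eqP; rewrite -(intr_eq0 rat); exact/eqP.
Qed.

Lemma delta_comb (j0 : 'I_N) (js : seq 'I_N) (zs : seq int) j :
  (\sum_(t < size js) [seq (delta_mx 0 j : 'rV[int]_N) | j <- js]`_t *~ zs`_t) ord0 j =
  \sum_(t < size js) (nth j0 js t == j)%:R * zs`_t :> int.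
Proof.
rewrite summxE; apply: eq_bigr => t _.
by rewrite rowMz (nth_map j0) // mxE eqxx eq_sym.
Qed.

(** [P] has a nonsingular diagonal block in the columns [sg], so the basis vectors of the other
    [N - k] columns are independent in the quotient. Conversely, more than [N - k] elements together
    with the [k] rows of [P] are more than [N] vectors of [Z^N], hence dependent. *)
Lemma quotient_rank : K_rank P (N - k).
Proof.
split.
  pose js := enum [pred j | j \notin codom sg]; exists [seq (delta_mx 0 j : 'rV[int]_N) | j <- js].
  split; first by rewrite size_map -cardE card_sg.
  move=> zs; rewrite size_map => szz [x def_x].
  have x0 : x = 0.
    apply/rowP => i; rewrite [RHS]mxE; have : x 0 i * dg i = 0.
      rewrite -mul_P_sg -def_x (delta_comb (sg i)) big1 // => t _.
      case: eqP => [def_i|_]; last by rewrite mul0r.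
      have : nth (sg i) js t \in js by exact: mem_nth.
      by rewrite def_i mem_enum inE codom_f.
    by move/eqP; rewrite mulf_eq0 (negPf (dg_neq0 i)) orbF => /eqP.
  move=> t; have [lt_t|le_t] := ltnP t (size js); last by rewrite nth_default ?szz.
  have [j0 _] : exists j, j \in js by case: (js) lt_t => // j js' _; exists j; exact: mem_head.
  move/rowP/(_ (nth j0 js t)): def_x; rewrite x0 mul0mx (delta_comb j0) mxE.
  rewrite (bigD1 (Ordinal lt_t)) //= eqxx mul1r big1 ?addr0 // => t' nt.
  by rewrite nth_uniq ?enum_uniq // -[_ == t]/(t' == Ordinal lt_t) (negPf nt) mul0r.
move=> ws ind; rewrite leqNgt; apply/negP => lt_ws.
pose W : 'M[int]_(size ws, N) := \matrix_(t < size ws) ws`_t.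
have [|x x0 xM] := int_row_kernel (col_mx W P); first by lia.
rewrite -[x]hsubmxK mul_row_col in xM.
have Wx (y : 'rV[int]_(size ws)) : y *m W = \sum_(t < size ws) ws`_t *~ y 0 t.
  by apply/rowP => j; rewrite mxE summxE; apply: eq_bigr => t _; rewrite rowMz mxE mulrC.
have lx0 : lsubmx x = 0.
  pose zs := [seq lsubmx x 0 t | t : 'I_(size ws)].
  have zsE (t : 'I_(size ws)) : zs`_t = lsubmx x 0 t.
    by rewrite (nth_map t) ?size_enum_ord // nth_ord_enum.
  have zs0 : forall t, zs`_t = 0.
    apply: ind; first by rewrite size_map size_enum_ord.
    under eq_bigr do rewrite zsE; rewrite -Wx; exists (- rsubmx x).
    by rewrite mulNmx; apply/eqP; rewrite -addr_eq0 xM.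
  by apply/rowP => t; rewrite -zsE zs0 mxE.
rewrite lx0 mul0mx add0r in xM.
have rx0 : rsubmx x = 0.
  apply/rowP => i; rewrite [RHS]mxE; have := mul_P_sg (rsubmx x) i; rewrite xM mxE => /esym/eqP.
  by rewrite mulf_eq0 (negPf (dg_neq0 i)) orbF => /eqP.
by case/eqP: x0; rewrite -[x]hsubmxK lx0 rx0 row_mx0.
Qed.

End RankOfQuotient.

(* The weights [W / (n_i lam_j)], with [n_i] the number of variables in block [i], give
   every [tm i] the weight [W]. *)
Lemma block_unit_const (K : numClosedFieldType) N s q (B : block_data K N s q) p :
  quot_unit (blockI B) p -> exists a : K, a != 0 /\ blockI B (p - a%:MP).
Proof.
pose n i := #|[pred j | blk B j == i]|.
have n_gt0 i : (0 < n i)%N.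
  by have [j def_i] := blk_surj B i; apply/card_gt0P; exists j; rewrite inE def_i.
pose wt j := (\prod_(j' | j' != j) wexp B j' * \prod_(i | i != blk B j) n i)%N.
apply: (@block_units _ _ _ _ B wt (\prod_j wexp B j * \prod_i n i)%N) => [j|i].
  by rewrite muln_gt0 !prodn_cond_gt0 // => j' _; exact: wexp_gt0.
rewrite (bigID (fun j => blk B j == i)) /= [X in (_ + X)%N]big1 ?addn0 => [|j nj]; last first.
  by rewrite mnmE (negPf nj) mul0n muln0.
rewrite (eq_bigr (fun=> \prod_j wexp B j * \prod_(i' | i' != i) n i'))%N => [|j /eqP def_i].
  by rewrite sum_nat_const [in RHS](bigD1 i) //= -/(n i) mulnCA.
rewrite mnmE /wt def_i eqxx mul1n mulnAC [in RHS](bigD1 j) //=; congr (_ * _)%N.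
by rewrite mulnC.
Qed.

(** * The blocks of [R(A,P_0)] *)

Section TrinomialData.
Variables (R : realType) (r c m : nat) (ns : 'I_r.+1 -> nat).
Variables (l : forall i : 'I_r.+1, 'I_(ns i) -> nat) (A : 'M[R[i]]_(c.+1, r.+1)).
Hypothesis c_gt0 : (0 < c)%N.
Hypothesis le_cr : (c <= r)%N.
Hypothesis ns_gt0 : forall i, (0 < ns i)%N.
Hypothesis l_gt0 : forall i (j : 'I_(ns i)), (0 < l j)%N.
Hypothesis rankA : \rank A = c.+1.
Hypothesis colA : forall i j : 'I_r.+1, i != j -> row_free (col_mx (col i A)^T (col j A)^T).
Local Notation N := (ntot ns + m)%N.
Local Notation K := R[i].

Definition Tvar i (j : 'I_(ns i)) : 'I_N := lshift m (tagnat.Rank i j).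
Definition Svar (t : 'I_m) : 'I_N := rshift (ntot ns) t.

Lemma varP (k : 'I_N) : (exists i (j : 'I_(ns i)), k = Tvar j) \/ exists t, k = Svar t.
Proof.
rewrite -(splitK k); case: (split k) => [k'|t] /=; last by right; exists t.
by left; exists (tagnat.sig1 k'), (tagnat.sig2 k'); rewrite /Tvar tagnat.sig2K.
Qed.

Lemma Tvar_pos i (j : 'I_(ns i)) : Tvar j = pos ns i j :> nat.
Proof. exact: (tagnat.rankEsum (Tagged (fun i => 'I_(ns i)) j)).
Qed.

Definition dblk (k : 'I_N) : 'I_(r.+1 + m) :=
  match split k with
  | inl k => lshift m (tag (tagnat.sig k))
  | inr t => rshift r.+1 t
  end.

Definition dwexp (k : 'I_N) : nat :=
  match split k with
  | inl k => l (tagged (tagnat.sig k))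
  | inr _ => 1%N
  end.

Lemma dblk_T i (j : 'I_(ns i)) : dblk (Tvar j) = lshift m i.
Proof. by rewrite /dblk /Tvar -[lshift m _]/(unsplit (inl _)) unsplitK /tagnat.Rank tagnat.rankK. Qed.

Lemma dblk_S t : dblk (Svar t) = rshift r.+1 t.
Proof. by rewrite /dblk /Svar -[rshift _ _]/(unsplit (inr _)) unsplitK. Qed.

Lemma dwexp_T i (j : 'I_(ns i)) : dwexp (Tvar j) = l j.
Proof. by rewrite /dwexp /Tvar -[lshift m _]/(unsplit (inl _)) unsplitK /tagnat.Rank tagnat.rankK. Qed.

Lemma dwexp_S t : dwexp (Svar t) = 1%N.
Proof. by rewrite /dwexp /Svar -[rshift _ _]/(unsplit (inr _)) unsplitK. Qed.

Lemma dwexp_gt0 k : (0 < dwexp k)%N.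
Proof. by case: (varP k) => [[i [j ->]]|[t ->]]; rewrite ?dwexp_T ?dwexp_S. Qed.

Lemma dblk_surj i : exists k, dblk k = i.
Proof.
rewrite -(splitK i); case: (split i) => [i'|t] /=.
  by exists (Tvar (Ordinal (ns_gt0 i'))); rewrite dblk_T.
by exists (Svar t); rewrite dblk_S.
Qed.

(** The linear form of the block of [S_k] is a new variable of [Y], so these blocks contribute no
    relation. *)
Definition dcmx : 'M[K]_(c.+1 + m, r.+1 + m) := block_mx A 0 0 1%:M.
Definition dcinv : 'M[K]_(r.+1 + m, c.+1 + m) := block_mx (pinvmx A) 0 0 1%:M.

Lemma dcmx_inv : dcmx *m dcinv = 1%:M.
Proof.
rewrite mulmx_block !mulmx0 !mul0mx !mulmx1 !addr0 !add0r mulmxVp -?scalar_mx_block //.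
by rewrite /row_free rankA.
Qed.

Lemma colA_indep i k (a b : K) : i != k -> a *: col i A + b *: col k A = 0 -> a = 0 /\ b = 0.
Proof.
move=> nik; move/(congr1 trmx); rewrite linearD !linearZ trmx0 /= => rel.
have /row_freeP[X XV] := colA nik.
have ab0 : row_mx (a%:M : 'M_1) (b%:M : 'M_1) = 0.
  by rewrite -[LHS]mulmx1 -XV mulmxA mul_row_col !mul_scalar_mx rel mul0mx.
by split; [have /rowP/(_ (lshift 1 0)) := ab0 | have /rowP/(_ (rshift 1 0)) := ab0];
  rewrite ?row_mxEl ?row_mxEr !mxE eqxx mulr1n.
Qed.

(** [r >= c > 0] provides a second column, and a zero column would be dependent on it. *)
Lemma colA_neq0 i : col i A != 0.
Proof.
apply/eqP => coli0; have [k nik] : exists k : 'I_r.+1, i != k.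
  have [->|] := eqVneq i ord0; last by exists ord0.
  by exists (inord 1); rewrite -val_eqE /= inordK ?ltnS // (leq_trans c_gt0).
have [|/eqP] := @colA_indep i k 1 0 nik; last by rewrite oner_eq0.
by rewrite coli0 scaler0 scale0r addr0.
Qed.

Lemma col_dcmx_l i : col (lshift m i) dcmx = col_mx (col i A) 0.
Proof. by rewrite /dcmx block_mxEh colKl col_col_mx col0. Qed.

Lemma col_dcmx_r t : col (rshift r.+1 t) dcmx = col_mx 0 (col t 1%:M).
Proof. by rewrite /dcmx block_mxEh colKr col_col_mx col0. Qed.

Lemma col1_indep t u (a b : K) : t != u ->
  a *: col t (1%:M : 'M[K]_m) + b *: col u 1%:M = 0 -> a = 0 /\ b = 0.
Proof.
move=> ntu /colP rel; split; [have := rel t | have := rel u];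
  by rewrite !mxE eqxx eq_sym 1?(negPf ntu) 1?eq_sym ?(negPf ntu) mulr1 mulr0 ?addr0 ?add0r.
Qed.

Lemma dcmx_indep i k (a b : K) : i != k ->
  a *: col i dcmx + b *: col k dcmx = 0 -> a = 0 /\ b = 0.
Proof.
have l0 i' (d : K) : d *: col i' A = 0 -> d = 0.
  by move/eqP; rewrite scaler_eq0 (negPf (colA_neq0 i')) orbF => /eqP.
have r0 t (d : K) : d *: col t (1%:M : 'M[K]_m) = 0 -> d = 0.
  by move/colP/(_ t); rewrite !mxE eqxx mulr1.
rewrite -(splitK i) -(splitK k); case: (split i) => [i'|t]; case: (split k) => [k'|u] /= nik;
  rewrite ?col_dcmx_l ?col_dcmx_r !scale_col_mx add_col_mx ?scaler0 ?addr0 ?add0r;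
  move/eqP; rewrite col_mx_eq0 => /andP[/eqP + /eqP].
- by move=> rel _; apply: colA_indep rel; apply: contraNneq nik => ->.
- by move=> /l0 -> /r0 ->.
- by move=> /l0 -> /r0 ->.
- by move=> _ rel; apply: col1_indep rel; apply: contraNneq nik => ->.
Qed.

Lemma dcmx_neq0 i : col i dcmx != 0.
Proof.
apply/eqP => coli0; have [k nik] : exists k, i != k.
  have [->|] := eqVneq i (lshift m ord0); last by exists (lshift m ord0).
  exists (lshift m (inord 1)); rewrite (inj_eq (@lshift_inj _ _)) -val_eqE /= inordK //.
  by rewrite ltnS (leq_trans c_gt0).
have [|/eqP] := @dcmx_indep i k 1 0 nik; last by rewrite oner_eq0.
by rewrite coli0 scaler0 scale0r addr0.
Qed.

Definition dblock : block_data K N (r.+1 + m) (c.+1 + m) :=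
  BlockData dwexp_gt0 dblk_surj dcmx_inv dcmx_neq0 dcmx_indep.
Local Notation B := dblock.

Lemma Texp_tm i : Texp l m i = tm B (lshift m i).
Proof.
apply/mnmP => k; rewrite !mnmE /=; case: (varP k) => [[i' [j ->]]|[t ->]]; last first.
  rewrite dblk_S eq_rlshift big1 // => j _; rewrite gtn_eqF ?muln0 //.
  by rewrite -Tvar_pos; apply: leq_trans (ltn_ord (tagnat.Rank i j)) (leq_addr _ _).
rewrite dblk_T dwexp_T (inj_eq (@lshift_inj _ _)) Tvar_pos.
have posE i1 i2 (j1 : 'I_(ns i1)) (j2 : 'I_(ns i2)) :
    (pos ns i1 j1 == pos ns i2 j2) = (i1 == i2) && (j1 == j2 :> nat).
  by rewrite -!Tvar_pos -tagnat.eq_Rank.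
have [eq_i|ni] := eqVneq i' i; last first.
  by rewrite big1 // => j' _; rewrite posE (negPf ni) muln0.
case: _ / eq_i; rewrite (bigD1 j) //= eqxx muln1 mul1n big1 ?addn0 // => j' nj.
by rewrite posE eqxx /= eq_sym -[_ == _ :> nat]/(j' == j) (negPf nj) muln0.
Qed.

(** The kernel of [A] extended by an identity block is the kernel of [A] padded with zeros. *)
Lemma idealRAP_blockI : @idealRAP r ns l R m c A = blockI B.
Proof.
apply: boolp.funext => p; apply: boolp.propext; split; move: p.
  apply: gen_ideal_sub (blockI_ideal B) _ => _ [v [Av0 ->]].
  apply: gen_ideal_gen; exists (col_mx v 0); split.
    by rewrite mul_block_col Av0 !mulmx0 mul0mx !addr0 col_mx0.
  rewrite big_split_ord /= [X in _ + X]big1 ?addr0 => [|t _]; last by rewrite col_mxEd mxE scale0r.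
  by apply: eq_bigr => i _; rewrite col_mxEu Texp_tm.
apply: gen_ideal_sub (gen_ideal_is_ideal _) _ => _ [v [Av0 ->]].
rewrite -[v]vsubmxK in Av0 *; move: Av0; rewrite /= mul_block_col !mul0mx mul1mx addr0 add0r.
move/eqP; rewrite col_mx_eq0 => /andP[/eqP Av0 /eqP dv0]; apply: gen_ideal_gen; exists (usubmx v); split=> //.
rewrite big_split_ord /= [X in _ + X]big1 ?addr0 => [|t _]; last by rewrite col_mxEd dv0 mxE scale0r.
by apply: eq_bigr => i _; rewrite col_mxEu Texp_tm.
Qed.

(** The colour of a block: [None] if it consists of [T_ij], [Some t] for [S_t]. [P0] vanishes in the
    column of [S_t], so a balanced coefficient there must be zero, while those of the other blocks
    only have sum zero. *)
Definition dcol (i : 'I_(r.+1 + m)) : option 'I_m :=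
  match split i with inl _ => None | inr t => Some t end.

Definition dcoly (b : 'I_(c.+1 + m)) : option 'I_m :=
  match split b with inl _ => None | inr t => Some t end.

Lemma dcmx_col b i : cmx B b i != 0 -> dcoly b = dcol i.
Proof.
rewrite -(splitK b) -(splitK i) /dcol /dcoly !unsplitK /=.
case: (split b) => [b'|t]; case: (split i) => [i'|u] //=.
- by rewrite block_mxEur mxE eqxx.
- by rewrite block_mxEdl mxE eqxx.
by rewrite block_mxEdr mxE; have [->|] := eqVneq t u; rewrite // mulr0n eqxx.
Qed.

Lemma dcinv_col i b : cinv B i b != 0 -> dcoly b = dcol i.
Proof.
rewrite -(splitK b) -(splitK i) /dcol /dcoly !unsplitK /=.
case: (split b) => [b'|t]; case: (split i) => [i'|u] //=.
- by rewrite block_mxEdl mxE eqxx.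
- by rewrite block_mxEur mxE eqxx.
by rewrite block_mxEdr mxE; have [->|] := eqVneq t u; rewrite // mulr0n eqxx.
Qed.

(** The rows of [P0] are the differences [t_i - t_0] of exponent vectors, so in a combination of
    rows [t_0] receives minus the sum of the coefficients. *)
Lemma P0_row (z : 'rV[int]_r) (y : 'I_r.+1 -> int) k : y ord0 = - \sum_i z 0 i ->
  (forall i, y (lift ord0 i) = z 0 i) ->
  (z *m P0 l m) 0 k = \sum_i y i * (Texp l m i k)%:Z.
Proof.
move=> y0 yl; rewrite mxE big_ord_recl y0 mulNr mulr_suml addrC -sumrB.
by apply: eq_bigr => i _; rewrite mxE yl mulrBr.
Qed.

Lemma Texp_sum (y : 'I_(r.+1 + m) -> int) k : (forall t, y (rshift r.+1 t) = 0) ->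
  \sum_i y (lshift m i) * (Texp l m i k)%:Z = y (dblk k) * (dwexp k)%:Z.
Proof.
move=> yr; transitivity (\sum_i y i * (tm B i k)%:Z).
  rewrite big_split_ord /= [X in _ + X]big1 ?addr0 => [|t _]; last by rewrite yr mul0r.
  by apply: eq_bigr => i _; rewrite Texp_tm.
rewrite (bigD1 (dblk k)) //=.
rewrite big1 ?addr0 => [|i ni]; rewrite mnmE /=; last by rewrite eq_sym (negPf ni) mulr0.
by rewrite eqxx mul1n.
Qed.

Lemma dimPP (w : 'rV[int]_N) : in_imP (P0 l m) w <->
  exists2 z : 'I_(r.+1 + m) -> int, balanced dcol z &
    forall j, w 0 j = z (blk B j) * (wexp B j)%:Z.
Proof.
have sumN (z : 'I_(r.+1 + m) -> int) : \sum_(i | dcol i == None) z i = \sum_i z (lshift m i).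
  rewrite big_split_ord /= [X in _ + X]big_pred0 ?addr0 => [|t]; last by rewrite /dcol (unsplitK (inr t)).
  by apply: eq_bigl => i; rewrite /dcol (unsplitK (inl i)).
have sumS (z : 'I_(r.+1 + m) -> int) t : \sum_(i | dcol i == Some t) z i = z (rshift r.+1 t).
  rewrite big_split_ord /= [X in X + _]big_pred0 ?add0r => [|i]; last by rewrite /dcol (unsplitK (inl i)).
  by rewrite (big_pred1 t) // => u; rewrite /dcol (unsplitK (inr u)).
split=> [[x ->]|[z bal_z zE]].
  pose y i : int := if unlift ord0 i is Some i' then x 0 i' else - \sum_i x 0 i.
  pose z (i : 'I_(r.+1 + m)) : int := match split i with inl i => y i | inr _ => 0 end.
  have zl i : z (lshift m i) = y i by rewrite /z (unsplitK (inl i)).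
  have zr t : z (rshift r.+1 t) = 0 by rewrite /z (unsplitK (inr t)).
  have y0 : y ord0 = - \sum_i x 0 i by rewrite /y unlift_none.
  have yl i : y (lift ord0 i) = x 0 i by rewrite /y liftK.
  exists z => [[t|]|k].
  - by rewrite sumS zr.
  - rewrite sumN (eq_bigr y) => [|i _]; last exact: zl.
    by rewrite big_ord_recl y0 (eq_bigr _ (fun i _ => yl i)) addNr.
  rewrite (P0_row k y0 yl); apply: etrans (Texp_sum k zr).
  by apply: eq_bigr => i _; rewrite zl.
exists (\row_i z (lshift m (lift ord0 i))); apply/rowP => k; rewrite zE.
rewrite (@P0_row _ (fun i => z (lshift m i))).
- by rewrite Texp_sum // => t; rewrite -sumS bal_z.
- have := bal_z None; rewrite sumN big_ord_recl => /eqP; rewrite addr_eq0 => /eqP ->.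
  by under [in RHS]eq_bigr do rewrite mxE.
by move=> i; rewrite mxE.
Qed.

Definition Tfirst i : 'I_(ns i) := Ordinal (ns_gt0 i).

(** The columns of the first variables of the blocks [1, ..., r] form the diagonal block that
    [quotient_rank] asks for. *)
Lemma P0_diag (i i' : 'I_r) : P0 l m i (Tvar (Tfirst (lift ord0 i'))) =
  if i == i' then (l (Tfirst (lift ord0 i)))%:Z else 0.
Proof.
rewrite mxE !Texp_tm !mnmE /= dblk_T dwexp_T !(inj_eq (@lshift_inj _ _)) (inj_eq lift_inj).
rewrite mul0n subr0 eq_sym; case: eqP => [->|_]; by rewrite ?mul1n ?mul0n.
Qed.

Lemma N_ge : (r.+1 + m <= N)%N.
Proof.
rewrite leq_add2r /ntot -[X in (X <= _)%N]card_ord -sum1_card; exact: leq_sum.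
Qed.

Lemma RAP_dim : quot_dim (@idealRAP r ns l R m c A) (N - r + c).
Proof.
rewrite idealRAP_blockI (_ : N - r + c = N - (r.+1 + m) + (c.+1 + m))%N; first exact: block_dim.
(* Truncated subtraction is exact here because [r.+1 + m <= N]. *)
by have := N_ge; move: N => n; lia.
Qed.

Lemma RAP_complete_intersection : quot_complete_intersection (@idealRAP r ns l R m c A).
Proof.
(* A basis of the kernel of [A] has [r - c] elements, which is the codimension, and [gv] is linear
   in [v]. *)
pose C := row_base (kermx A^T).
exists [seq @gv r ns l R m (row t C)^T | t <- enum 'I_(\rank (kermx A^T))], (N - r + c)%N; split; first exact: RAP_dim.
split.
  rewrite size_map size_enum_ord mxrank_ker mxrank_tr rankA.
  have := N_ge; move: N => n; lia.
move=> p; split; move: p.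
  apply: gen_ideal_sub (gen_ideal_is_ideal _) _ => _ [v [Av0 ->]].
  have /submxP[x def_v] : (v^T <= C)%MS.
    by rewrite eq_row_base; apply/sub_kermxP; rewrite -trmx_mul Av0 trmx0.
  rewrite (_ : gv _ _ _ = \sum_t x 0 t *: @gv r ns l R m (row t C)^T).
    apply: (ideal_sum (gen_ideal_is_ideal _)) => t _; apply: (idealZ (gen_ideal_is_ideal _)).
    by apply: gen_ideal_gen; apply: map_f; rewrite mem_enum.
  rewrite /gv; under [in RHS]eq_bigr do rewrite scaler_sumr.
  rewrite exchange_big; apply: eq_bigr => i _; under eq_bigr do rewrite scalerA.
  rewrite -scaler_suml; congr (_ *: _); have /rowP/(_ i) := def_v; rewrite !mxE => ->.
  by apply: eq_bigr => t _; rewrite !mxE.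
apply: gen_ideal_sub (gen_ideal_is_ideal _) _ => _ /mapP[t _ ->].
apply: gen_ideal_gen; exists (row t C)^T; split=> //.
apply: trmx_inj; rewrite trmx_mul trmxK trmx0; apply/sub_kermxP.
by apply: submx_trans (row_sub _ _) _; rewrite eq_row_base.
Qed.

Lemma RAP_complexity : grading_complexity (P0 l m) (@idealRAP r ns l R m c A) c.
Proof.
exists (N - r + c)%N, (N - r)%N; split; first exact: RAP_dim.
split; first by apply: (quotient_rank P0_diag) => i; rewrite eqz_nat -lt0n l_gt0.
by rewrite PoszD addrC addKr.
Qed.

End TrinomialData.

Theorem theorem2p6 (R : realType) (r c m : nat)
    (ns : 'I_r.+1 -> nat) (l : forall i : 'I_r.+1, 'I_(ns i) -> nat)
    (A : 'M[R[i]]_(c.+1, r.+1)) :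
  (0 < c)%N -> (c <= r)%N ->
  (forall i, (0 < ns i)%N) ->
  (forall i j, (0 < l i j)%N) ->
  \rank A = c.+1 ->
  (forall i j : 'I_r.+1, i != j -> row_free (col_mx (col i A)^T (col j A)^T)) ->
  let N := (ntot ns + m)%N in
  let I := @idealRAP r ns l R m c A in
  let P := P0 l m in
  [/\ quot_integral I /\ quot_normal I /\ quot_complete_intersection I,
      quot_dim I (N - r + c)%N,
      (forall u, quot_unit I u -> exists a : R[i], a != 0 /\ I (u - a%:MP)),
      grading_effective P I /\ grading_pointed P I &
      K_factorial P I /\ grading_complexity P I c].
Proof.
move=> c_gt0 le_cr ns_gt0 l_gt0 rankA colA N I P.
have RAP := idealRAP_blockI m c_gt0 le_cr ns_gt0 l_gt0 rankA colA.
have imPP := dimPP (m := m) c_gt0 le_cr ns_gt0 l_gt0 rankA colA.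
split.
- split; first by rewrite /I RAP; exact: block_prime.
  split; last exact: RAP_complete_intersection.
  rewrite /I RAP; split; first exact: block_prime.
  (* An arbitrary variable serves to obtain the first monomial denominator. *)
  by move=> a b; apply: block_normal; exact: (Tvar m (Tfirst ns_gt0 ord0)).
- exact: RAP_dim.
- by move=> u; rewrite /I RAP; exact: block_unit_const.
- by rewrite /I RAP; split; [exact: block_effective | exact: block_pointed imPP].
split; last exact: RAP_complexity.
rewrite /I RAP; apply: (block_K_factorial imPP); [exact: dcmx_col | exact: dcinv_col].
Qed.
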